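(* Let $G$ be a connected linear differential algebraic group over $\mathbf{k}$ and let $$0\to V\to W\to\mathbf{1}\to0$$ be an exact sequence of $G$-modules, where $V$ is faithful and semisimple and $\mathbf{1}$ is the trivial one-dimensional $G$-module. Let $\overline{G}$ denote the Zariski closure of $G$ in $\operatorname{GL}(V)$. If $V$, viewed as a $\overline{G}$-module, does not contain non-zero submodules isomorphic to a quotient of the adjoint module for $\overline{G}$, that is, if $$\operatorname{Hom}_{\overline{G}}(\operatorname{Lie}\overline{G},V)=0,$$ then the sequence $0\to V\to W\to\mathbf{1}\to0$ splits.
   Context: $(\mathbf{k},\delta)$ is a $\delta$-closed field of characteristic $0$ (every finite system of $\delta$-polynomial equations over $\mathbf{k}$ solvable in a $\delta$-field extension is solvable in $\mathbf{k}$). A linear differential algebraic group over $\mathbf{k}$ is a subgroup of some $\operatorname{GL}_n(\mathbf{k})$ that is Kolchin-closed, i.e. the zero set of $\delta$-polynomials over $\mathbf{k}$ in the matrix entries; it is connected if it is irreducible in the Kolchin topology. A $G$-module is a finite-dimensional $\mathbf{k}$-vector space $V$ with a group homomorphism $G\to\operatorname{GL}(V)$ given by $\delta$-polynomial maps; faithful means this homomorphism is injective (so $G$ is identified with a subgroup of $\operatorname{GL}(V)$), and semisimple means completely reducible. $\operatorname{Lie}\overline{G}$ is the adjoint module of the algebraic group $\overline{G}$ (action by conjugation). *)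

(* Defs.v *)
From HB Require Import structures.
From mathcomp Require Import all_boot all_order all_algebra all_field.
From mathcomp.multinomials Require Import mpoly.
From Stdlib Require Import Classical IndefiniteDescription.

Set Implicit Arguments.
Unset Strict Implicit.
Unset Printing Implicit Defensive.

Import GRing.Theory.
Local Open Scope ring_scope.

Definition is_derivation (F : fieldType) (d : F -> F) : Prop :=
  (forall x y, d (x + y) = d x + d y) /\
  (forall x y, d (x * y) = d x * y + x * d y).

(* A delta-polynomial in n indeterminates of order < r is an ordinary
   polynomial in the n * r variables d^j x_i (i < n, j < r), indexed through
   mxvec_index; it is evaluated at the jet of a point x. *)
Definition jet (F : fieldType) (d : F -> F) (n r : nat) (x : 'rV[F]_n) :
    'rV[F]_(n * r) :=
  mxvec (\matrix_(i < n, j < r) iter j d (x 0 i)).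

Definition deval (F : fieldType) (d : F -> F) (n r : nat)
    (p : {mpoly F[n * r]}) (x : 'rV[F]_n) : F :=
  p.@[jet d r x 0].

Definition delta_closed (F : fieldType) (d : F -> F) : Prop :=
  forall (n r : nat) (S : seq {mpoly F[n * r]}),
    (exists (E : fieldType) (dE : E -> E) (iota : {rmorphism F -> E}),
       [/\ is_derivation dE,
           (forall a, dE (iota a) = iota (d a)) &
           exists x : 'rV[E]_n,
             forall p, p \in S -> deval dE (map_mpoly iota p) x = 0]) ->
    exists x : 'rV[F]_n, forall p, p \in S -> deval d p x = 0.

Section DifferentialAlgebraicGroups.

Variables (F : fieldType) (d : F -> F) (n : nat).

Implicit Types G X Y : 'M[F]_n -> Prop.

Definition kolchin_closed X : Prop :=
  exists S : forall r : nat, {mpoly F[(n * n) * r]} -> Prop,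
    forall A, X A <->
      A \in unitmx /\ forall r p, S r p -> deval d p (mxvec A) = 0.

Definition linear_diff_alg_group G : Prop :=
  [/\ kolchin_closed G,
      G 1%:M,
      (forall A B, G A -> G B -> G (A *m B)) &
      (forall A, G A -> G (invmx A))].

Definition kolchin_irreducible X : Prop :=
  (exists A, X A) /\
  forall Y1 Y2, kolchin_closed Y1 -> kolchin_closed Y2 ->
    (forall A, X A -> Y1 A \/ Y2 A) ->
    (forall A, X A -> Y1 A) \/ (forall A, X A -> Y2 A).

(* The coordinates on GL_n are the matrix entries together with 1/det. *)
Definition GL_coords (A : 'M[F]_n) : 'rV[F]_(n * n + 1) :=
  row_mx (mxvec A) (const_mx (\det A)^-1).

Definition delta_polynomial_on G (f : 'M[F]_n -> F) : Prop :=
  exists (r : nat) (p : {mpoly F[(n * n + 1) * r]}),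
    forall A, G A -> f A = deval d p (GL_coords A).

Definition is_module G (V : vectType F) (rho : 'M[F]_n -> 'End(V)) : Prop :=
  [/\ rho 1%:M = \1%VF,
      (forall A B, G A -> G B -> rho (A *m B) = (rho A \o rho B)%VF) &
      forall i, delta_polynomial_on G
        (fun A => coord (vbasis {:'End(V)}) i (rho A))].

Definition faithful_on G (V : vectType F) (rho : 'M[F]_n -> 'End(V)) : Prop :=
  forall A B, G A -> G B -> rho A = rho B -> A = B.

Definition trivial_rep : 'M[F]_n -> 'End(F^o) := fun _ => \1%VF.

End DifferentialAlgebraicGroups.

Section Representations.

Variables (F : fieldType) (T : Type) (H : T -> Prop).

Definition submodule (V : vectType F) (rho : T -> 'End(V))
    (U : {vspace V}) : Prop :=
  forall g, H g -> (rho g @: U <= U)%VS.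

Definition semisimple_rep (V : vectType F) (rho : T -> 'End(V)) : Prop :=
  forall U, submodule rho U ->
    exists U', [/\ submodule rho U', (U + U')%VS = fullv & (U :&: U')%VS = 0%VS].

Definition equivariant (V1 V2 : vectType F)
    (rho1 : T -> 'End(V1)) (rho2 : T -> 'End(V2)) (f : 'Hom(V1, V2)) : Prop :=
  forall g, H g -> forall v, f (rho1 g v) = rho2 g (f v).

Definition short_exact (V1 V2 V3 : vectType F)
    (rho1 : T -> 'End(V1)) (rho2 : T -> 'End(V2)) (rho3 : T -> 'End(V3))
    (f : 'Hom(V1, V2)) (g : 'Hom(V2, V3)) : Prop :=
  [/\ equivariant rho1 rho2 f, equivariant rho2 rho3 g,
      lker f = 0%VS, limg f = lker g & limg g = fullv].

Definition splits (V2 V3 : vectType F)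
    (rho2 : T -> 'End(V2)) (rho3 : T -> 'End(V3)) (g : 'Hom(V2, V3)) : Prop :=
  exists s : 'Hom(V3, V2), equivariant rho3 rho2 s /\ (g \o s)%VF = \1%VF.

End Representations.

Lemma vspace_of_pred_ex (F : fieldType) (U : vectType F) (P : U -> Prop) :
  P 0 -> (forall (a : F) u v, P u -> P v -> P (a *: u + v)) ->
  exists L : {vspace U}, forall u, u \in L <-> P u.
Proof.
move=> P0 Plin.
have Padd u v : P u -> P v -> P (u + v).
  by move=> Pu Pv; rewrite -[u]scale1r; apply: Plin.
suff main m (L : {vspace U}) : (forall u, u \in L -> P u) ->
    (\dim {:U} - \dim L <= m)%N ->
    exists L' : {vspace U}, forall u, u \in L' <-> P u.
  apply: (main (\dim {:U}) 0%VS); last by rewrite leq_subr.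
  by move=> u; rewrite memv0 => /eqP->.
elim: m L => [|m IHm] L LP dimL.
  have /eqP defL : L == fullv.
    by rewrite eqEdim subvf /= -subn_eq0 -leqn0.
  by exists L => u; split=> [/LP //|_]; rewrite defL memvf.
have [[u [Pu uL]] | noU] := classic (exists u, P u /\ u \notin L); last first.
  exists L => u; split=> [/LP //|Pu]; apply/negPn/negP => uL.
  by apply: noU; exists u.
apply: (IHm (L + <[u]>)%VS) => [w /memv_addP[x Lx [y /vlineP[a ->] ->]]|].
  by rewrite addrC; apply: Plin => //; apply: LP.
have ltL : (\dim L < \dim (L + <[u]>))%N.
  rewrite ltnNge; apply/negP => leL; case/negP: uL.
  have /eqP-> : L == (L + <[u]>)%VS by rewrite eqEdim addvSl.
  by apply: (subvP (addvSr _ _)); rewrite memv_line.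
have := dimvS (subvf (L + <[u]>)%VS).
move=> leUL; rewrite -ltnS; apply: leq_trans dimL.
by rewrite ltn_sub2l // (leq_trans ltL).
Qed.

Section ZariskiClosure.

Variables (F : fieldType) (V : vectType F).

Implicit Types (H : 'End(V) -> Prop) (X g : 'End(V)).

(* Polynomial functions on End(V) are polynomials in linear coordinates. *)
Definition End_coords X : 'I_(\dim {:'End(V)}) -> F :=
  fun i => coord (vbasis {:'End(V)}) i X.

Definition vanishes_on H (f : {mpoly F[\dim {:'End(V)}]}) : Prop :=
  forall g, H g -> f.@[End_coords g] = 0.

Definition zariski_closure H g : Prop :=
  lker g = 0%VS /\ forall f, vanishes_on H f -> f.@[End_coords g] = 0.

(* X lies in the tangent space at the identity: the differential at 1 of each
   polynomial vanishing on H kills X. *)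
Definition tangent_at_id H X : Prop :=
  forall f, vanishes_on H f ->
    \sum_i (mderiv i f).@[End_coords \1%VF] * End_coords X i = 0.

Lemma tangent_vspace_ex H :
  exists L : {vspace 'End(V)}, forall X, X \in L <-> tangent_at_id H X.
Proof.
apply: vspace_of_pred_ex => [f _|a X Y tX tY f Hf].
  by rewrite big1 // => i _; rewrite /End_coords linear0 mulr0.
rewrite (eq_bigr (fun i => a * ((mderiv i f).@[End_coords \1%VF] * End_coords X i)
    + (mderiv i f).@[End_coords \1%VF] * End_coords Y i)); last first.
  by move=> i _; rewrite /End_coords linearP /= mulrDr mulrCA.
by rewrite big_split /= -mulr_sumr tX // tY // mulr0 addr0.
Qed.

Definition LieAlg H : {vspace 'End(V)} :=
  proj1_sig (constructive_indefinite_description _ (tangent_vspace_ex H)).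

Lemma memLieAlg H X : X \in LieAlg H <-> tangent_at_id H X.
Proof.
exact: (proj2_sig (constructive_indefinite_description _ (tangent_vspace_ex H))).
Qed.

(* For a group H, LieAlg H is stable under conjugation by H, so for g in H
   vsproj only casts g X g^-1 back into the subtype. *)
Definition Ad_fun H g (X : subvs_of (LieAlg H)) : subvs_of (LieAlg H) :=
  vsproj (LieAlg H) (g \o vsval X \o g^-1)%VF.

Fact Ad_fun_linear H g : linear (@Ad_fun H g).
Proof.
move=> a u v; rewrite /Ad_fun -linearP; congr (vsproj _ _).
by rewrite linearP /= comp_lfunDr comp_lfunDl -?comp_lfunZr -?comp_lfunZl.
Qed.

HB.instance Definition _ H g :=
  GRing.isLinear.Build F (subvs_of (LieAlg H)) (subvs_of (LieAlg H)) *:%R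
    (@Ad_fun H g) (@Ad_fun_linear H g).

Definition Ad H (g : 'End(V)) : 'End(subvs_of (LieAlg H)) :=
  linfun (@Ad_fun H g).

Arguments Ad : clear implicits.

Lemma AdE H g (Y : subvs_of (LieAlg H)) : Ad H g Y = Ad_fun g Y.
Proof. by rewrite lfunE. Qed.

Definition tautological_rep : 'End(V) -> 'End(V) := id.

Definition Hom_Lie_zero H : Prop :=
  forall phi : 'Hom(subvs_of (LieAlg H), V),
    equivariant H (Ad H) tautological_rep phi -> phi = 0.

End ZariskiClosure.

Definition image_in_End (F : fieldType) (n : nat) (V : vectType F)
    (G : 'M[F]_n -> Prop) (rho : 'M[F]_n -> 'End(V)) : 'End(V) -> Prop :=
  fun g => exists2 A, G A & rho A = g.

(* Main.v *)
Require Import Defs.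
From HB Require Import structures.
From mathcomp Require Import all_boot all_order all_algebra all_field.
From mathcomp.multinomials Require Import mpoly.
From mathcomp Require Import perm ring zify.
From mathcomp.classical Require boolp.
From Stdlib Require Import Classical IndefiniteDescription FunctionalExtensionality.

Set Implicit Arguments.
Unset Strict Implicit.
Unset Printing Implicit Defensive.

Import Order.TTheory GRing.Theory.
Local Open Scope ring_scope.

(** Choose w0 in W mapping to 1.  Then c(A) = A w0 - w0 takes values in V and is a
    1-cocycle of G, and the sequence splits if and only if c(A) = A u - u for some u.
    If V carried an action of a reductive algebraic group and c were polynomial,
    one would differentiate c and apply the Casimir operator of the Lie algebra.
    For differential polynomial cocycles the derivative of c lives on the
    prolongations of the Lie algebra of G, and the hypothesis on Hom (Lie, V) is
    what makes it descend to matrices acting on V.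

    Jets.  First G is replaced by the group of block matrices that carry A, the
    module V and the cocycle (emb_group); it is again Kolchin closed, and c becomes
    an affine function of the matrix entries.  For each order r the jets of the
    elements of G form a subset of an affine space with a prime vanishing ideal, since
    G is irreducible.  The tangent vectors of this set
    at the jet of 1, called tangent jets, generate linear vector fields that
    preserve its ideal, and a function that vanishes at 1 and satisfies a linear
    system along these fields vanishes on G (flat_family_vanish, by Krull's
    intersection theorem).  This replaces the passage between groups and Lie
    algebras by statements on ideals of polynomials.

    Faithfulness.  There is an order r such that a tangent jet of order r whose
    image in End V has r + 1 zero components has zeroth component 0
    (faithful_jets).  Otherwise a linear differential system over K, solved by
    differential closedness, would give a nonzero X all of whose jets are tangent
    and whose image is 0; its exponential exp(tX) is a point of G with coordinates
    in power series, and specializing it to K yields a nontrivial element of the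
    kernel of the representation (exponential_point).

    Reductivity.  Let g be the Lie algebra of the image of G in GL(V).  Since V is
    semisimple and g contains the replicas of its elements, Cartan's criterion,
    in the form for algebraic Lie algebras, and Engel's theorem show that the trace
    form is nondegenerate on g (trace_form_nondegenerate).  Every subspace of g
    stable under conjugation then has a stable complement (stable_complement), so
    that the vanishing of equivariant maps from g to V is inherited by all stable
    subspaces of g (partial_hom).

    Descent.  Suppose that the first i components of the image of a tangent jet
    vanish.  The image of the next one lies in g, and the value of the
    differentiated cocycle, if it depends on that component only, does so
    equivariantly; hence it is zero.  By descending induction from i = r + 1, where
    faithfulness applies, the differentiated cocycle depends only on the zeroth
    component of the image (dcocycle_kernel): it is a map f on a Lie algebra k0
    contained in g, whose defect of equivariance is given by c.

    Conclusion.  Let U be a submodule containing the values of c.  The elements of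
    k0 that act trivially on U form an ideal on which f is equivariant, hence zero.
    On a stable complement of it the trace form of U is nondegenerate; its Casimir
    operator Om is invertible on a nonzero part of U, and the invariance of
    sum f(x_i) x^i shows that c Om is a coboundary.  So c is cohomologous to a
    cocycle with values in a smaller submodule, unless the complement is 0 and
    c = 0 (casimir_reduction); induction on U proves the theorem (cocycle_trivial).
    The hypothesis speaks of the Zariski closure of the image, which has the same
    Lie algebra as the image and satisfies the same polynomial identities
    (hom_transfer). *)

(** * Noetherianity of polynomial rings *)

Lemma mpoly_alg_ind (R : comNzRingType) n (P : {mpoly R[n]} -> Prop) :
  (forall c, P c%:MP) -> (forall i, P 'X_i) ->
  (forall p q, P p -> P q -> P (p + q)) ->
  (forall p q, P p -> P q -> P (p * q)) -> forall p, P p.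
Proof.
move=> PC PX PD PM p.
have P1 : P 1 by rewrite -mpolyC1; apply: (PC).
rewrite (mpolyE p); apply: (big_ind P) => [|q r|m _]; last 1 first.
- rewrite -mul_mpolyC; apply: (PM) => //; rewrite mpolyXE_id.
  apply: (big_ind P) => // i _.
  elim: (m i) => [|k IHk]; first by rewrite expr0.
  by rewrite exprS; apply: (PM).
- by rewrite -mpolyC0.
- exact: PD.
Qed.

Lemma nat_seq_min (a : nat -> nat) (N : nat) :
  exists2 t, (N <= t)%N & forall t', (N <= t')%N -> (a t <= a t')%N.
Proof.
suff main b t : (a t <= b)%N -> (N <= t)%N ->
    exists2 t0, (N <= t0)%N & forall t', (N <= t')%N -> (a t0 <= a t')%N.
  exact: (main (a N) N).
elim: b t => [|b IHb] t le_atb leNt.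
  by exists t => // t' _; rewrite (leq_trans le_atb).
have [[t' leNt' lt_t']|no] :=
  classic (exists2 t', (N <= t')%N & (a t' < a t)%N).
  by apply: (IHb t') => //; rewrite -ltnS (leq_trans lt_t').
exists t => // t' leNt'; rewrite leqNgt; apply/negP => lt.
by apply: no; exists t'.
Qed.

Lemma monotone_subseq (a : nat -> nat) :
  exists s : nat -> nat, {homo s : i j / (i < j)%N} /\
    {homo (a \o s) : i j / (i <= j)%N}.
Proof.
have /functional_choice [t Ht] : forall N, exists t, (N <= t)%N /\
    forall t', (N <= t')%N -> (a t <= a t')%N.
  by move=> N; have [t le_t min_t] := nat_seq_min a N; exists t.
pose s := fix s k := if k is k'.+1 then t (s k').+1 else t 0%N.
have s_step i : (s i < s i.+1)%N by rewrite /= (proj1 (Ht _)).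
exists s; split; first exact/(homo_ltn ltn_trans).
apply: homo_leq => [x|y x z|i] /=; [exact: leqnn|exact: leq_trans|].
case: i => [|i] /=; apply: (proj2 (Ht _)) => //.
apply: leq_trans (proj1 (Ht _)) _.
exact: leq_trans (leqnSn _) (proj1 (Ht _)).
Qed.

(** Pass to a subsequence along which all exponents are nondecreasing. *)
Lemma dickson n (m : nat -> 'X_{1..n}) :
  exists i j, (i < j)%N /\ (m i <= m j)%MM.
Proof.
have [s [s_mono ms_mono]] : exists s : nat -> nat, {homo s : i j / (i < j)%N} /\
    forall k : 'I_n, (k < n)%N -> {homo (fun i => m (s i) k) : i j / (i <= j)%N}.
  suff main b : (b <= n)%N -> exists s : nat -> nat,
      {homo s : i j / (i < j)%N} /\ forall k : 'I_n, (k < b)%N ->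
      {homo (fun i => m (s i) k) : i j / (i <= j)%N} by exact: main (leqnn n).
  elim: b => [|b IHb] leb; first by exists id; split=> [i j|k] //.
  have [s [s_mono ms_mono]] := IHb (ltnW leb).
  have [t [t_mono mt_mono]] := monotone_subseq (fun i => m (s i) (Ordinal leb)).
  exists (s \o t); split=> [i j ltij|k]; first by apply/s_mono/t_mono.
  rewrite ltnS leq_eqVlt.
  case/orP=> [/eqP defk i j /mt_mono /=|ltkb i j leij /=].
    by have -> : k = Ordinal leb by apply: val_inj.
  apply: ms_mono => //; move: leij; rewrite leq_eqVlt.
  by case/orP=> [/eqP-> //|/t_mono/ltnW].
exists (s 0%N), (s 1%N); split; first exact: s_mono.
by apply/mnm_lepP => k; apply: ms_mono.
Qed.

Definition is_ideal (R : nzRingType) (J : R -> Prop) :=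
  [/\ J 0, forall p q, J p -> J q -> J (p + q) & forall c p, J p -> J (c * p)].

Definition ideal_span (R : nzRingType) (s : seq R) (p : R) :=
  exists c : nat -> R, p = \sum_(i < size s) c i * s`_i.

Lemma ideal_span_mem (R : nzRingType) (s : seq R) p : p \in s -> ideal_span s p.
Proof.
move=> /(nthP 0)[i lti <-]; exists (fun j => (j == i)%:R).
rewrite (bigD1 (Ordinal lti)) //= eqxx mul1r big1 ?addr0 // => j.
by rewrite -val_eqE /= => /negPf->; rewrite mul0r.
Qed.

Lemma ideal_span_ideal (R : nzRingType) (s : seq R) : is_ideal (ideal_span s).
Proof.
split=> [|_ _ [c ->] [c' ->]|a _ [c ->]].
- by exists (fun=> 0); rewrite big1 // => i _; rewrite mul0r.
- exists (fun i => c i + c' i); rewrite -big_split.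
  by apply: eq_bigr => i _; rewrite mulrDl.
- exists (fun i => a * c i); rewrite mulr_sumr.
  by apply: eq_bigr => i _; rewrite mulrA.
Qed.

Lemma ideal_sum (R : nzRingType) (J : R -> Prop) I r (P : pred I) F :
  is_ideal J -> (forall i, P i -> J (F i)) -> J (\sum_(i <- r | P i) F i).
Proof. by move=> [J0 JD _] JF; apply: big_ind. Qed.

Lemma idealN (R : nzRingType) (J : R -> Prop) p : is_ideal J -> J p -> J (- p).
Proof. by move=> [_ _ JM] Jp; rewrite -mulN1r; apply: JM. Qed.

Lemma idealB (R : nzRingType) (J : R -> Prop) p q :
  is_ideal J -> J p -> J q -> J (p - q).
Proof. by move=> idJ Jp Jq; case: (idJ) => _ JD _; apply: JD (idealN idJ Jq). Qed.

Lemma ideal_span_sub (R : nzRingType) (J : R -> Prop) (s : seq R) p :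
  is_ideal J -> (forall q, q \in s -> J q) -> ideal_span s p -> J p.
Proof.
move=> idJ Js [c ->]; apply: ideal_sum => // i _.
by case: (idJ) => _ _ JM; apply: JM; apply: Js; apply: mem_nth.
Qed.

Lemma mlead_cancel (F : fieldType) n (p q : {mpoly F[n]}) :
    p != 0 -> q != 0 -> (mlead q <= mlead p)%MM ->
  exists c, p - c * q = 0 \/ (mlead (p - c * q) < mlead p)%O.
Proof.
move=> nzp nzq leqp; set a := mleadc p / mleadc q.
have nza : a != 0 by rewrite mulf_neq0 ?invr_eq0 ?mleadc_eq0.
pose c := a *: 'X_[mlead p - mlead q]; exists c.
have nzX : 'X_[mlead p - mlead q] != 0 :> {mpoly F[n]}.
  by rewrite -msupp_eq0 msuppX.
have nzc : c != 0 by rewrite scaler_eq0 negb_or nza.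
have lcq' : (mlead c + mlead q)%MM = mlead p by rewrite mleadZ // mleadXm submK.
have lcq : mlead (c * q) = mlead p by rewrite mleadM.
case: (eqVneq (p - c * q) 0) => [|nzr]; first by left.
right; rewrite lt_neqAle; apply/andP; split; last first.
  by apply: le_trans (mleadB_le _ _) _; rewrite lcq joinxx.
apply/eqP => eqm; have := mlead_supp nzr; rewrite eqm mcoeff_msupp.
rewrite mcoeffB -[in X in _ - X]lcq' mleadcM /c mleadcZE mcoeffX mleadXm eqxx mulr1.
by rewrite /a divfK ?mleadc_eq0 // subrr eqxx.
Qed.

(** Hilbert's basis theorem.  An ideal that is not finitely generated would
    yield generators f_0, f_1, .. with f_k outside the ideal of its
    predecessors and of minimal leading monomial there; by Dickson's lemma
    some leading monomial divides a later one, and cancelling it contradicts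
    minimality. *)
Theorem hilbert_basis (F : fieldType) n (J : {mpoly F[n]} -> Prop) :
  is_ideal J ->
  exists2 s : seq {mpoly F[n]}, (forall p, p \in s -> J p) &
                                forall p, J p -> ideal_span s p.
Proof.
move=> idJ; apply: NNPP => nofg.
have pick_ex (s : seq {mpoly F[n]}) : exists f, (forall p, p \in s -> J p) ->
    [/\ J f, ~ ideal_span s f &
        forall g, J g -> ~ ideal_span s g -> ~~ (mlead g < mlead f)%O].
  have [Js|] := classic (forall p, p \in s -> J p); last by exists 0.
  have [f0 [Jf0 sf0]] : exists f, J f /\ ~ ideal_span s f.
    apply: NNPP => no; apply: nofg; exists s => // p Jp.
    by apply: NNPP => sp; apply: no; exists p.
  move: (mlead f0) {-2}f0 (erefl (mlead f0)) Jf0 sf0 => m.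
  elim/(well_founded_ind (@ltom_wf n)): m => m IHm f defm Jf sf.
  have [[g [Jg sg ltg]]|no] := classic (exists g, [/\ J g, ~ ideal_span s g &
      (mlead g < mlead f)%O]).
    by apply: (IHm (mlead g) _ g) => //; rewrite -defm.
  exists f => _; split=> // g Jg sg; apply/negP => ltg.
  by apply: no; exists g.
have [pick pickP] := functional_choice _ pick_ex.
pose s := fix s k := if k is k'.+1 then rcons (s k') (pick (s k')) else [::].
have Js k : forall p, p \in s k -> J p.
  elim: k => //= k IHk p; rewrite mem_rcons inE => /orP[/eqP->|]; last exact: IHk.
  by case: (pickP _ IHk).
pose f k := pick (s k).
have f_in i j : (i < j)%N -> f i \in s j.
  elim: j => //= j IHj; rewrite ltnS leq_eqVlt mem_rcons inE.
  by case/orP=> [/eqP->|/IHj->]; rewrite ?eqxx ?orbT.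
have nzf k : f k != 0.
  case: (pickP _ (Js k)) => _ sf _; apply/eqP => f0; apply: sf.
  by rewrite -/(f k) f0; case: (ideal_span_ideal (s k)).
have [i [j [ltij lemij]]] := dickson (fun k => mlead (f k)).
have [c lead_lt] := mlead_cancel (nzf j) (nzf i) lemij.
have [Jj sj minj] := pickP _ (Js j).
have [Ji _ _] := pickP _ (Js i).
have [span0 spanD spanM] := ideal_span_ideal (s j).
have si : ideal_span (s j) (c * f i).
  by apply: spanM; apply: ideal_span_mem; apply: f_in.
have sg : ~ ideal_span (s j) (f j - c * f i).
  by move=> sg; apply: sj; rewrite -[pick _](subrK (c * f i)); apply: spanD.
have Jg : J (f j - c * f i).
  by apply: idealB => //; case: (idJ) => _ _ JM; apply: JM.
case: lead_lt => [g0|ltg]; first by apply: sg; rewrite g0.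
by have := minj _ Jg sg; rewrite ltg.
Qed.

(** * Polynomial functions on a vector space: differentials and linear fields *)

Lemma submx_of_pred (F : fieldType) m (P : 'rV[F]_m -> Prop) :
  P 0 -> (forall (a : F) u v, P u -> P v -> P (a *: u + v)) ->
  exists B : 'M[F]_m, forall u, (u <= B)%MS <-> P u.
Proof.
move=> P0 Plin; have [L LP] := vspace_of_pred_ex P0 Plin.
pose C := \matrix_(i < \dim L) (vbasis L)`_i.
exists <<C>>%MS => u; rewrite genmxE -LP; split=> [/submxP[D ->]|uL].
  rewrite mulmx_sum_row; apply: memv_suml => i _; apply: memvZ.
  by rewrite rowK; apply: vbasis_mem; apply: mem_nth; rewrite size_tuple.
apply/submxP; exists (\row_i coord (vbasis L) i u).
rewrite {1}(coord_vbasis uL) mulmx_sum_row; apply: eq_bigr => i _.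
by rewrite rowK mxE.
Qed.

Section PolyFun.

Variable (K : fieldType).
Implicit Types (M N : nat).

Definition dd M (p : {mpoly K[M]}) (x v : 'rV[K]_M) : K :=
  \sum_i (p^`M(i)).@[x 0] * v 0 i.

Lemma ddC M c (x v : 'rV[K]_M) : dd c%:MP x v = 0.
Proof. by rewrite /dd big1 // => i _; rewrite mderivC meval0 mul0r. Qed.

Lemma mderivXU M (i j : 'I_M) : ('X_j : {mpoly K[M]})^`M(i) = (i == j)%:R.
Proof.
rewrite mderivX mnm1E eq_sym; case: eqP => [->|_]; last by rewrite scale0r.
rewrite scale1r; suff -> : (U_(j) - U_(j))%MM = 0%MM :> 'X_{1..M}.
  by rewrite mpolyX0.
by apply/mnmP => k; rewrite mnmBE subnn mnm0E.
Qed.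

Lemma ddX M i (x v : 'rV[K]_M) : dd 'X_i x v = v 0 i.
Proof.
rewrite /dd (bigD1 i) //= mderivXU eqxx meval1 mul1r big1 ?addr0 // => j.
by move=> /negPf ne; rewrite mderivXU ne meval0 mul0r.
Qed.

Lemma ddD M (p q : {mpoly K[M]}) x v : dd (p + q) x v = dd p x v + dd q x v.
Proof.
by rewrite /dd -big_split; apply: eq_bigr => i _; rewrite mderivD mevalD mulrDl.
Qed.

Lemma ddM M (p q : {mpoly K[M]}) x v :
  dd (p * q) x v = p.@[x 0] * dd q x v + q.@[x 0] * dd p x v.
Proof.
rewrite /dd !mulr_sumr -big_split; apply: eq_bigr => i _ /=.
by rewrite mderivM mevalD !mevalM; ring.
Qed.

(** A point derivation is determined by its values on the coordinates.  Applied
    to the differential of a composite, this is the chain rule. *)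
Lemma point_derivation M (L : {mpoly K[M]} -> K) (x : 'rV[K]_M) :
    (forall c, L c%:MP = 0) -> {morph L : p q / p + q} ->
    (forall p q, L (p * q) = p.@[x 0] * L q + q.@[x 0] * L p) ->
  forall p, L p = dd p x (\row_i L 'X_i).
Proof.
move=> LC LD LM; elim/mpoly_alg_ind => [c|i|p q IHp IHq|p q IHp IHq].
- by rewrite LC ddC.
- by rewrite ddX mxE.
- by rewrite LD ddD IHp IHq.
- by rewrite LM ddM IHp IHq.
Qed.

Lemma dd_lin M (p : {mpoly K[M]}) x a u v :
  dd p x (a *: u + v) = a * dd p x u + dd p x v.
Proof.
rewrite /dd mulr_sumr -big_split; apply: eq_bigr => i _ /=.
by rewrite !mxE; ring.
Qed.

Lemma dd0 M (p : {mpoly K[M]}) x : dd p x 0 = 0.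
Proof. by rewrite /dd big1 // => i _; rewrite mxE mulr0. Qed.

Definition grad M (p : {mpoly K[M]}) (x : 'rV[K]_M) : 'rV[K]_M :=
  \row_i (p^`M(i)).@[x 0].

Lemma dd_grad M (p : {mpoly K[M]}) x v : dd p x v = (v *m (grad p x)^T) 0 0.
Proof. by rewrite mxE; apply: eq_bigr => i _; rewrite !mxE mulrC. Qed.

Definition linform M (w : 'cV[K]_M) : {mpoly K[M]} := \sum_j w j 0 *: 'X_j.

Lemma linformE M (w : 'cV[K]_M) (x : 'rV_M) : (linform w).@[x 0] = (x *m w) 0 0.
Proof.
rewrite (big_morph _ (mevalD _) (meval0 _)) mxE.
by apply: eq_bigr => j _; rewrite mevalZ mevalXU mulrC.
Qed.

Lemma dd_linform M (w : 'cV[K]_M) x v : dd (linform w) x v = (v *m w) 0 0.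
Proof.
have dd_0 : dd 0 x v = 0 by rewrite -mpolyC0 ddC.
rewrite (big_morph (fun p => dd p x v) (fun p q => ddD p q x v) dd_0).
rewrite mxE; apply: eq_bigr => j _.
by rewrite -mul_mpolyC ddM ddC ddX mevalC mulr0 addr0 mulrC.
Qed.

Definition linsub N M (B : 'M[K]_(N, M)) (p : {mpoly K[M]}) : {mpoly K[N]} :=
  p \mPo [tuple linform (col i B) | i < M].

Lemma linsubE N M (B : 'M[K]_(N, M)) p (x : 'rV_N) : (linsub B p).@[x 0] = p.@[(x *m B) 0].
Proof.
rewrite comp_mpoly_meval; apply: meval_eq => i.
rewrite tnth_mktuple linformE !mxE; apply: eq_bigr => j _.
by rewrite !mxE.
Qed.

Lemma dd_linsub N M (B : 'M[K]_(N, M)) p x v :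
  dd (linsub B p) x v = dd p (x *m B) (v *m B).
Proof.
rewrite (point_derivation (L := fun p => dd (linsub B p) x v) (x := x *m B)).
- congr dd; apply/rowP => i; rewrite mxE /linsub comp_mpolyXU -tnth_nth.
  rewrite tnth_mktuple dd_linform !mxE; apply: eq_bigr => j _.
  by rewrite !mxE.
- by move=> c; rewrite /linsub comp_mpolyC ddC.
- by move=> q r; rewrite /linsub comp_mpolyD ddD.
- by move=> q r; rewrite /linsub rmorphM /= ddM !linsubE.
Qed.

(** The derivation along the linear vector field x |-> x *m A. *)
Definition Dfield M (A : 'M[K]_M) (p : {mpoly K[M]}) : {mpoly K[M]} :=
  \sum_i p^`M(i) * linform (col i A).

Lemma DfieldE M (A : 'M[K]_M) p (x : 'rV_M) : (Dfield A p).@[x 0] = dd p x (x *m A).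
Proof.
rewrite (big_morph _ (mevalD _) (meval0 _)); apply: eq_bigr => i _.
rewrite mevalM linformE !mxE; congr (_ * _).
by apply: eq_bigr => j _; rewrite mxE.
Qed.

Lemma DfieldD M (A : 'M[K]_M) : {morph Dfield A : p q / p + q}.
Proof.
move=> p q; rewrite /Dfield -big_split; apply: eq_bigr => i _.
by rewrite mderivD mulrDl.
Qed.

Lemma DfieldC M (A : 'M[K]_M) c : Dfield A c%:MP = 0.
Proof. by rewrite /Dfield big1 // => i _; rewrite mderivC mul0r. Qed.

Lemma DfieldM M (A : 'M[K]_M) p q :
  Dfield A (p * q) = Dfield A p * q + p * Dfield A q.
Proof.
rewrite /Dfield mulr_suml mulr_sumr -big_split; apply: eq_bigr => i _ /=.
by rewrite mderivM; ring.
Qed.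

Lemma DfieldZ M (A : 'M[K]_M) a p : Dfield A (a *: p) = a *: Dfield A p.
Proof. by rewrite -!mul_mpolyC DfieldM DfieldC mul0r add0r. Qed.

Lemma DfieldB M (A : 'M[K]_M) p q : Dfield A (p - q) = Dfield A p - Dfield A q.
Proof. by rewrite DfieldD -scaleN1r DfieldZ scaleN1r. Qed.

Lemma Dfield0 M (A : 'M[K]_M) : Dfield A 0 = 0.
Proof. by rewrite -mpolyC0 DfieldC. Qed.

Lemma Dfield_sum M (A : 'M[K]_M) I r (P : pred I) F :
  Dfield A (\sum_(i <- r | P i) F i) = \sum_(i <- r | P i) Dfield A (F i).
Proof. exact: (big_morph _ (DfieldD A) (Dfield0 A)). Qed.

Lemma DfieldX M (A : 'M[K]_M) i : Dfield A 'X_i = linform (col i A).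
Proof.
rewrite /Dfield (bigD1 i) //= mderivXU eqxx mul1r big1 ?addr0 // => j.
by move=> /negPf ne; rewrite mderivXU ne mul0r.
Qed.

Lemma Dfield_linform M (A : 'M[K]_M) w : Dfield A (linform w) = linform (A *m w).
Proof.
rewrite Dfield_sum; under eq_bigr do rewrite DfieldZ DfieldX scaler_sumr.
rewrite exchange_big /=; apply: eq_bigr => j _.
rewrite mxE scaler_suml; apply: eq_bigr => i _.
by rewrite scalerA mxE mulrC.
Qed.

Section Vanishing.

Variables (M : nat) (S : 'rV[K]_M -> Prop) (e : 'rV[K]_M).

Definition vanish (p : {mpoly K[M]}) := forall x, S x -> p.@[x 0] = 0.

Definition tangent (v : 'rV[K]_M) := forall p, vanish p -> dd p e v = 0.

Lemma vanish_ideal : is_ideal vanish.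
Proof.
split=> [x _|p q Ip Iq x Sx|c p Ip x Sx]; first by rewrite meval0.
  by rewrite mevalD Ip // Iq // addr0.
by rewrite mevalM Ip // mulr0.
Qed.

Lemma tangent_lin a u v : tangent u -> tangent v -> tangent (a *: u + v).
Proof. by move=> Tu Tv p Ip; rewrite dd_lin Tu // Tv // mulr0 addr0. Qed.

Lemma tangent0 : tangent 0.
Proof. by move=> p _; rewrite dd0. Qed.

Lemma tangent_linform (w : 'cV[K]_M) c v :
  (forall x, S x -> (x *m w) 0 0 = c) -> tangent v -> (v *m w) 0 0 = 0.
Proof.
move=> Sw Tv; have := Tv (linform w - c%:MP); rewrite ddD dd_linform.
rewrite -mpolyCN ddC addr0; apply=> x Sx.
by rewrite mevalD mevalC linformE Sw // subrr.
Qed.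

(** Finite-dimensional biduality: the gradients at e of the polynomials vanishing
    on S form a subspace, hence the full annihilator of what they annihilate. *)
Lemma cotangent (w : 'cV[K]_M) :
  (forall v, tangent v -> (v *m w) 0 0 = 0) ->
  exists2 p, vanish p & forall v, dd p e v = (v *m w) 0 0.
Proof.
move=> Tw; have [|a _ _ [p Ip <-] [q Iq <-]|B BP] :=
    @submx_of_pred _ _ (fun u => exists2 p, vanish p & grad p e = u).
- exists 0; first by case: vanish_ideal.
  by apply/rowP => i; rewrite !mxE mderiv0 meval0.
- exists (a%:MP * p + q).
    by case: vanish_ideal => _ VD VM; apply: (VD) => //; apply: (VM).
  by apply/rowP => i; rewrite !mxE mderivD mderiv_mulC mevalD mevalM mevalC.
suff /BP[p Ip gp] : (w^T <= B)%MS.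
  by exists p => // v; rewrite dd_grad gp trmxK.
rewrite submxE; apply/eqP/rowP => j; rewrite [RHS]mxE.
have -> : (w^T *m cokermx B) 0 j = ((col j (cokermx B))^T *m w) 0 0.
  rewrite !mxE; apply: eq_bigr => i _; rewrite !mxE mulrC; congr (_ * _).
apply: Tw => p Ip; rewrite dd_grad.
have /submxP[D ->] : (grad p e <= B)%MS by apply/BP; exists p.
rewrite trmx_mul mulmxA -trmx_mul.
by rewrite colE mulmxA mulmx_coker mul0mx trmx0 mul0mx mxE.
Qed.

End Vanishing.

End PolyFun.

(** * Krull intersection at a point *)

Section PointPowers.

Variables (K : fieldType) (M : nat) (e : 'rV[K]_M).
Local Notation R := {mpoly K[M]}.

Definition local_coord (i : 'I_M) : R := 'X_i - (e 0 i)%:MP.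

(** The powers of the maximal ideal of the point e, as predicates. *)
Fixpoint point_pow (k : nat) (p : R) : Prop :=
  if k is k'.+1 then
    exists2 a : 'I_M -> R, forall i, point_pow k' (a i)
                         & p = \sum_i local_coord i * a i
  else True.

Arguments point_pow : simpl never.

Lemma point_pow_ideal k : is_ideal (point_pow k).
Proof.
elim: k => [|k [IH0 IHD IHM]]; first by split.
split=> [|_ _ [a Ha ->] [b Hb ->]|c _ [a Ha ->]] /=.
- by exists (fun=> 0) => //; rewrite big1 // => i _; rewrite mulr0.
- exists (fun i => a i + b i) => [i|]; first by apply: IHD; [apply: Ha|apply: Hb].
  by rewrite -big_split; apply: eq_bigr => i _; rewrite mulrDr.
- exists (fun i => c * a i) => [i|]; first by apply: IHM; apply: Ha.
  by rewrite mulr_sumr; apply: eq_bigr => i _; rewrite mulrCA.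
Qed.

Lemma local_coordE i : (local_coord i).@[e 0] = 0.
Proof. by rewrite mevalB mevalXU mevalC subrr. Qed.

Lemma point_powX k i p : point_pow k p -> point_pow k.+1 (local_coord i * p).
Proof.
move=> Hp; exists (fun j => if j == i then p else 0) => [j|].
  by case: eqP => // _; case: (point_pow_ideal k).
by rewrite (bigD1 i) //= eqxx big1 ?addr0 // => j /negPf->; rewrite mulr0.
Qed.

Lemma point_powM j k p q :
  point_pow j p -> point_pow k q -> point_pow (j + k) (p * q).
Proof.
elim: j p => [|j IHj] p; first by move=> _ Hq; case: (point_pow_ideal k) => _ _; apply.
case=> a Ha -> Hq; rewrite mulr_suml addSn.
apply: ideal_sum => [|i _]; first exact: (point_pow_ideal (j + k).+1).
by rewrite -mulrA; apply: point_powX; exact: IHj (Ha i) Hq.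
Qed.

Lemma point_pow_eval k p : (0 < k)%N -> point_pow k p -> p.@[e 0] = 0.
Proof.
case: k => // k _ [a _ ->]; rewrite (big_morph _ (mevalD _) (meval0 _)).
by apply: big1 => i _; rewrite mevalM local_coordE mul0r.
Qed.

Lemma taylor1 p : point_pow 1 (p - (p.@[e 0])%:MP).
Proof.
elim/mpoly_alg_ind: p => [c|i|p q IHp IHq|p q IHp IHq].
- by rewrite mevalC subrr; case: (point_pow_ideal 1).
- by rewrite mevalXU -[X in point_pow _ X]mulr1; apply: (@point_powX 0).
- rewrite mevalD mpolyCD opprD addrACA.
  by case: (point_pow_ideal 1) => _ H _; apply: H.
- case: (point_pow_ideal 1) => _ HD HM.
  have -> : p * q - ((p * q).@[e 0])%:MP = q * (p - (p.@[e 0])%:MP)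
      + (p.@[e 0])%:MP * (q - (q.@[e 0])%:MP) by rewrite mevalM mpolyCM; ring.
  by apply: (HD); apply: (HM).
Qed.

Lemma taylor2 p :
  point_pow 2 (p - (p.@[e 0])%:MP - \sum_i (p^`M(i)).@[e 0] *: local_coord i).
Proof.
have [_ HD HM] := point_pow_ideal 2.
elim/mpoly_alg_ind: p => [c|i|p q IHp IHq|p q IHp IHq].
- rewrite mevalC subrr big1 ?subr0 => [|i _]; first by case: (point_pow_ideal 2).
  by rewrite mderivC meval0 scale0r.
- rewrite mevalXU (bigD1 i) //= mderivXU eqxx meval1 scale1r big1 => [|j /negPf ne].
    by rewrite addr0 subrr; case: (point_pow_ideal 2).
  by rewrite mderivXU ne meval0 scale0r.
- rewrite mevalD mpolyCD opprD addrACA.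
  under eq_bigr do rewrite mderivD mevalD scalerDl.
  rewrite big_split /=.
  rewrite [X in point_pow 2 X](_ : _ = (p - (p.@[e 0])%:MP - \sum_i (p^`M(i)).@[e 0] *: local_coord i) + (q - (q.@[e 0])%:MP - \sum_i (q^`M(i)).@[e 0] *: local_coord i)); last by ring.
  exact: HD.
- set dp := \sum_i _ in IHp; set dq := \sum_i _ in IHq.
  have -> : \sum_i (p * q)^`M(i).@[e 0] *: local_coord i =
      (q.@[e 0])%:MP * dp + (p.@[e 0])%:MP * dq.
    rewrite !mulr_sumr -big_split; apply: eq_bigr => i _ /=.
    by rewrite mderivM mevalD !mevalM -!mul_mpolyC mpolyCD !mpolyCM; ring.
  have -> : p * q - ((p * q).@[e 0])%:MP
              - ((q.@[e 0])%:MP * dp + (p.@[e 0])%:MP * dq) =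
      (q.@[e 0])%:MP * (p - (p.@[e 0])%:MP - dp)
      + ((p.@[e 0])%:MP * (q - (q.@[e 0])%:MP - dq)
        + (p - (p.@[e 0])%:MP) * (q - (q.@[e 0])%:MP)).
    by rewrite mevalM mpolyCM; ring.
  apply: (HD); [exact: (HM)|apply: (HD); [exact: (HM)|]].
  exact: (@point_powM 1 1 _ _ (taylor1 _) (taylor1 _)).
Qed.

Lemma point_pow2P p :
  p.@[e 0] = 0 -> (forall v, dd p e v = 0) -> point_pow 2 p.
Proof.
move=> p0 dp0; have := taylor2 p; rewrite p0 mpolyC0 subr0 big1 ?subr0 // => i _.
have := dp0 (delta_mx 0 i); rewrite /dd (bigD1 i) //= mxE !eqxx mulr1 big1.
  by rewrite addr0 => ->; rewrite scale0r.
by move=> j /negPf ne; rewrite mxE eqxx ne mulr0.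
Qed.

(** The Rees algebra of the point: the image of K[x, y] in K[x][s] under
    y_i |-> s (x_i - e_i).  The degree-k part in s lies in the k-th power of the
    maximal ideal. *)
Definition rees : {mpoly K[M + M]} -> {poly R} :=
  mmap (polyC \o @mpolyC M K)
    (fun i => match split i with
              | inl i => ('X_i)%:P
              | inr i => (local_coord i)%:P * 'X
              end).

HB.instance Definition _ := GRing.RMorphism.on rees.

Lemma reesC c : rees c%:MP = (c%:MP)%:P.
Proof. by rewrite /rees mmapC. Qed.

Lemma reesXl i : rees 'X_(lshift M i) = ('X_i)%:P.
Proof. by rewrite /rees mmapX mmap1U (unsplitK (inl i)). Qed.

Lemma reesXr i : rees 'X_(rshift M i) = (local_coord i)%:P * 'X.
Proof. by rewrite /rees mmapX mmap1U (unsplitK (inr i)). Qed.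

Lemma rees_polyC p : exists P, rees P = p%:P.
Proof.
elim/mpoly_alg_ind: p => [c|i|p q [P HP] [Q HQ]|p q [P HP] [Q HQ]].
- by exists c%:MP; rewrite reesC.
- by exists 'X_(lshift M i); rewrite reesXl.
- by exists (P + Q); rewrite rmorphD /= HP HQ polyCD.
- by exists (P * Q); rewrite rmorphM /= HP HQ polyCM.
Qed.

Lemma rees_surj k p : point_pow k p -> exists P, rees P = p%:P * 'X^k.
Proof.
elim: k p => [|k IHk] p; first by rewrite expr0 mulr1 => _; apply: rees_polyC.
case=> a Ha ->; have /functional_choice [P HP] : forall i, exists P,
    rees P = (a i)%:P * 'X^k by move=> i; apply: IHk; apply: Ha.
exists (\sum_i 'X_(rshift M i) * P i); rewrite rmorph_sum /= rmorph_sum mulr_suml.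
apply: eq_bigr => i _; rewrite rmorphM /= reesXr HP polyCM exprS.
by rewrite mulrACA mulrA.
Qed.

Lemma rees_coef P j : point_pow j (rees P)`_j.
Proof.
elim/mpoly_alg_ind: P j => [c|i|p q IHp IHq|p q IHp IHq] j.
- rewrite reesC coefC; case: eqP => [->//|_].
  by case: (point_pow_ideal j).
- rewrite -(splitK i); case: (split i) => k /=.
    by rewrite reesXl coefC; case: eqP => [->//|_]; case: (point_pow_ideal j).
  rewrite reesXr coefCM coefX; case: eqP => [->|_].
    by apply: (@point_powX 0).
  by rewrite mulr0; case: (point_pow_ideal j).
- have -> : rees (p + q) = rees p + rees q by rewrite rmorphD.
  move: (rees p) (rees q) IHp IHq => P Q HP HQ; rewrite coefD.
  by case: (point_pow_ideal j) => _ HD _; apply: (HD).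
- have -> : rees (p * q) = rees p * rees q by rewrite rmorphM.
  move: (rees p) (rees q) IHp IHq => P Q HP HQ; rewrite coefM; apply: ideal_sum => [|i _]; first exact: point_pow_ideal.
  by rewrite -[X in point_pow X](subnKC (ltn_ord i : (i <= j)%N)); apply: point_powM.
Qed.

(** Krull's intersection theorem at the point e.  With P_k in K[x, y] mapping to
    s^k h_k, Noetherianity writes some P_n as a combination of its
    predecessors; the coefficient of s^n expresses h as a h modulo I with a
    vanishing at e. *)
Lemma krull_point (I : R -> Prop) h : is_ideal I ->
    (forall k, exists2 hk, I (h - hk) & point_pow k hk) ->
  exists2 a, a.@[e 0] = 0 & I ((1 - a) * h).
Proof.
move=> idI Hh; have /functional_choice [hk Hhk] :
    forall k, exists hk, I (h - hk) /\ point_pow k hk.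
  by move=> k; have [hk] := Hh k; exists hk.
have /functional_choice [P HP] : forall k, exists P, rees P = (hk k)%:P * 'X^k.
  by move=> k; apply: rees_surj; case: (Hhk k).
pose J p := exists n (c : nat -> {mpoly K[M + M]}), p = \sum_(k < n) c k * P k.
have pad n m (c : nat -> {mpoly K[M + M]}) : (n <= m)%N -> exists c' : nat -> {mpoly K[M + M]},
    \sum_(k < n) c k * P k = \sum_(k < m) c' k * P k.
  move=> lenm; exists (fun k => if (k < n)%N then c k else 0).
  rewrite (big_ord_widen m (fun k => c k * P k)) // big_mkcond.
  by apply: eq_bigr => k _; case: ifP; rewrite ?mul0r.
have idJ : is_ideal J.
  split=> [|p q [n [c ->]] [m [c' ->]]|a p [n [c ->]]].
  - by exists 0%N, (fun=> 0); rewrite big_ord0.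
  - have [b ->] := pad _ _ c (leq_maxl n m).
    have [b' ->] := pad _ _ c' (leq_maxr n m).
    exists (maxn n m), (fun k => b k + b' k); rewrite -big_split.
    by apply: eq_bigr => k _; rewrite mulrDl.
  - exists n, (fun k => a * c k); rewrite mulr_sumr.
    by apply: eq_bigr => k _; rewrite mulrA.
have [s Js spans] := hilbert_basis idJ.
have [n Hn] : exists n, forall p, p \in s ->
    exists c : nat -> {mpoly K[M + M]}, p = \sum_(k < n) c k * P k.
  elim: s Js {spans} => [|p s IHs] Js; first by exists 0%N.
  have [|n Hn] := IHs; first by move=> q sq; apply: Js; rewrite inE sq orbT.
  have [m [c ->]] := Js p (mem_head _ _).
  exists (maxn n m) => q; rewrite inE => /orP[/eqP->|/Hn[b ->]].
    by have [b ->] := pad _ _ c (leq_maxr n m); exists b.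
  by have [b' ->] := pad _ _ b (leq_maxl n m); exists b'.
have [c Pn] : exists c : nat -> {mpoly K[M + M]}, P n = \sum_(k < n) c k * P k.
  apply: (@ideal_span_sub _ (fun p => exists c : nat -> {mpoly K[M + M]},
      p = \sum_(k < n) c k * P k) s) => //.
    split=> [|p q [b ->] [b' ->]|a p [b ->]].
    - by exists (fun=> 0); rewrite big1 // => k _; rewrite mul0r.
    - exists (fun k => b k + b' k); rewrite -big_split.
      by apply: eq_bigr => k _; rewrite mulrDl.
    - exists (fun k => a * b k); rewrite mulr_sumr.
      by apply: eq_bigr => k _; rewrite mulrA.
  apply: spans; exists n.+1, (fun k => (k == n)%:R).
  by rewrite big_ord_recr /= eqxx mul1r big1 ?add0r // => k _;
    rewrite ltn_eqF ?ltn_ord // mul0r.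
pose a k := (rees (c k))`_(n - k).
have hn : hk n = \sum_(k < n) a k * hk k.
  have := congr1 (fun p => (rees p)`_n) Pn.
  rewrite rmorph_sum HP coefMXn ltnn subnn coefC eqxx => ->.
  rewrite coef_sum; apply: eq_bigr => k _; rewrite rmorphM /= HP mulrA coefMXn.
  by rewrite ltnNge ltnW ?ltn_ord //= coefMC.
exists (\sum_(k < n) a k).
  rewrite (big_morph _ (mevalD _) (meval0 _)); apply: big1 => k _.
  by apply: (@point_pow_eval (n - k)); [rewrite subn_gt0|apply: rees_coef].
have Esum : \sum_(k < n) a k * (h - hk k) = (\sum_(k < n) a k) * h - hk n.
  rewrite mulr_suml [in RHS]hn -sumrB.
  by apply: eq_bigr => k _; rewrite mulrBr.
have -> : (1 - \sum_(k < n) a k) * h =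
    (h - hk n) - \sum_(k < n) a k * (h - hk k) by rewrite Esum; ring.
apply: idealB => //; first by case: (Hhk n).
apply: ideal_sum => // k _; case: (idI) => _ _; apply.
by case: (Hhk k).
Qed.

End PointPowers.

(** * Functions that are constant along all tangent directions *)

(** Choose tangent directions v_j dual to coordinates y_j of the tangent space and
    let D_j be the fields through them.  The Euler operator E = sum_j y_j D_j acts
    on the k-th graded piece of the local ring of S at e as multiplication by k,
    while the linear system puts E h in one power of the maximal ideal higher than
    h.  In characteristic 0 the family therefore lies in all powers, so that
    krull_point yields (1 - a) h = 0 on S with a(e) = 0, and S is irreducible. *)
Theorem flat_family_vanish (K : fieldType) M (S : 'rV[K]_M -> Prop) e
    (fld : 'rV[K]_M -> 'M[K]_M) s (h : 'I_s -> {mpoly K[M]}) :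
    [pchar K] =i pred0 -> S e ->
    (forall p q, vanish S (p * q) -> vanish S p \/ vanish S q) ->
    (forall v, tangent S e v ->
       e *m fld v = v /\ forall p, vanish S p -> vanish S (Dfield (fld v) p)) ->
    (forall i, (h i).@[e 0] = 0) ->
    (forall v i, tangent S e v -> exists c : 'I_s -> {mpoly K[M]},
       vanish S (Dfield (fld v) (h i) - \sum_j c j * h j)) ->
  forall i, vanish S (h i).
Proof.
move=> char0 Se prime fldP h0 hD.
have idI : is_ideal (vanish S) := vanish_ideal S.
pose IM k p := exists2 q, vanish S (p - q) & point_pow e k q.
have idIM k : is_ideal (IM k).
  have [P0 PD PM] := point_pow_ideal e k; have [I0 ID IMul] := idI.
  split=> [|p q [p' Ip Pp] [q' Iq Pq]|c p [p' Ip Pp]].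
  - by exists 0; rewrite ?subrr.
  - by exists (p' + q'); [rewrite opprD addrACA; apply: (ID)|apply: (PD)].
  - by exists (c * p'); [rewrite -mulrBr; apply: (IMul)|apply: (PM)].
have I_IM k p : vanish S p -> IM k p.
  by exists 0; [rewrite subr0|case: (point_pow_ideal e k)].
have P_IM k p : point_pow e k p -> IM k p.
  by exists p; [rewrite subrr; case: idI|].
have IMX k i p : IM k p -> IM k.+1 (local_coord e i * p).
  case=> q Iq Pq; exists (local_coord e i * q); last exact: point_powX.
  by rewrite -mulrBr; case: idI => _ _; apply.
have IMM j k p q : IM j p -> point_pow e k q -> IM (j + k)%N (p * q).
  case=> p' Ip Pp Pq; exists (p' * q); last exact: point_powM.
  by rewrite -mulrBl mulrC; case: idI => _ _; apply.
have [|a u v Tu Tv|B BP] := @submx_of_pred _ _ (tangent S e).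
- exact: tangent0.
- exact: tangent_lin.
pose Pi := proj_mx B B^C%MS.
have PiT v : tangent S e (v *m Pi) by apply/BP; apply: proj_mx_sub.
have Pi_id v : tangent S e v -> v *m Pi = v.
  by move/BP=> vB; apply: proj_mx_id => //; apply: capmx_compl.
pose v_ j : 'rV[K]_M := delta_mx 0 j *m Pi.
pose E p := \sum_j local_coord e j * Dfield (fld (v_ j)) p.
have ED p q : E (p + q) = E p + E q.
  by rewrite -big_split; apply: eq_bigr => j _; rewrite DfieldD mulrDr.
have EM p q : E (p * q) = E p * q + p * E q.
  rewrite /E mulr_suml mulr_sumr -big_split; apply: eq_bigr => j _ /=.
  by rewrite DfieldM; ring.
have E0 : E 0 = 0 by rewrite /E big1 // => j _; rewrite Dfield0 mulr0.
have Esum I r (P : pred I) F : E (\sum_(i <- r | P i) F i) =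
    \sum_(i <- r | P i) E (F i) by apply: (big_morph _ ED E0).
have EN p : E (- p) = - E p by apply/eqP; rewrite -addr_eq0 -ED addNr E0.
have EI p : vanish S p -> vanish S (E p).
  move=> Ip; apply: ideal_sum => // j _; case: (idI) => _ _; apply.
  by case: (fldP _ (PiT (delta_mx 0 j))) => _; apply.
(* The linear part of y_i - E y_i kills T, hence is the differential of an
   element of I. *)
have Ey i : IM 2 (E (local_coord e i) - local_coord e i).
  pose w : 'cV[K]_M := col i (1%:M - Pi).
  have [|p Ip dp] := @cotangent _ _ S e w.
    move=> v Tv; have -> : (v *m w) 0 0 = (v *m (1%:M - Pi)) 0 i.
      by rewrite !mxE; apply: eq_bigr => j _; rewrite !mxE.
    by rewrite mulmxBr mulmx1 Pi_id // subrr mxE.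
  have DyE j : Dfield (fld (v_ j)) (local_coord e i) =
      linform (col i (fld (v_ j))).
    by rewrite /local_coord DfieldB DfieldX DfieldC subr0.
  exists (E (local_coord e i) - local_coord e i + p).
    have -> : E (local_coord e i) - local_coord e i
      - (E (local_coord e i) - local_coord e i + p) = - p by ring.
    exact: idealN idI Ip.
  apply: point_pow2P => [|v].
    rewrite mevalD mevalB local_coordE Ip // subr0 addr0.
    rewrite (big_morph _ (mevalD _) (meval0 _)) big1 // => j _.
    by rewrite mevalM local_coordE mul0r.
  have dd0E : dd 0 e v = 0 by rewrite -mpolyC0 ddC.
  have ddN q : dd (- q) e v = - dd q e v.
    by apply/eqP; rewrite -addr_eq0 -ddD addNr dd0E.
  have ddy j : dd (local_coord e j) e v = v 0 j by rewrite ddD ddN ddC subr0 ddX.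
  rewrite !ddD ddN ddy dp.
  rewrite (big_morph (fun q => dd q e v) (fun q r => ddD q r e v) dd0E).
  under eq_bigr => j _.
    rewrite DyE ddM local_coordE mul0r add0r ddy linformE.
    have -> : (e *m col i (fld (v_ j))) 0 0 = (e *m fld (v_ j)) 0 i.
      by rewrite !mxE; apply: eq_bigr => l _; rewrite !mxE.
    case: (fldP _ (PiT (delta_mx 0 j))) => -> _.
    rewrite -rowE mxE; over.
  have -> : (v *m w) 0 0 = v 0 i - \sum_j Pi j i * v 0 j.
    have -> : (v *m w) 0 0 = (v *m (1%:M - Pi)) 0 i.
      by rewrite !mxE; apply: eq_bigr => j _; rewrite !mxE.
    rewrite mulmxBr mulmx1 !mxE; congr (_ - _).
    by apply: eq_bigr => j _; rewrite mulrC.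
  by ring.
have euler k p : point_pow e k p -> IM k.+1 (E p - p *+ k).
  elim: k p => [|k IHk] p.
    move=> _; rewrite mulr0n subr0; apply: P_IM.
    apply: ideal_sum => [|j _]; first exact: point_pow_ideal.
    exact: (@point_powX _ _ _ 0).
  case=> a Ha ->; rewrite Esum -sumrMnl -sumrB; apply: ideal_sum => // j _.
  rewrite EM [X in IM _ X](_ : _ = (E (local_coord e j) - local_coord e j) * a j
      + local_coord e j * (E (a j) - a j *+ k)); last first.
    by rewrite mulrS -mulrnAr; ring.
  case: (idIM k.+2) => _ HD _; apply: (HD).
    exact: (@IMM 2 k _ _ (Ey j) (Ha j)).
  by apply: IMX; apply: IHk; apply: Ha.
have hIM k i : IM k.+1 (h i).
  elim: k i => [|k IHk] i.
    by apply: P_IM; have := taylor1 e (h i); rewrite h0 mpolyC0 subr0.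
  have Eh : IM k.+2 (E (h i)).
    apply: ideal_sum => // j _; apply: IMX.
    have [c Hc] := hD _ i (PiT (delta_mx 0 j)).
    rewrite -[X in IM _ X](subrK (\sum_j c j * h j)).
    case: (idIM k.+1) => _ HD HM; apply: (HD); first exact: I_IM.
    by apply: ideal_sum => // l _; apply: (HM).
  have [p Ip Pp] := IHk i.
  have Epn : IM k.+2 (p *+ k.+1).
    have -> : p *+ k.+1 = (E (h i) - E (h i - p)) - (E p - p *+ k.+1).
      by rewrite ED EN; ring.
    apply: (idealB (idIM k.+2)); last exact: euler.
    by apply: (idealB (idIM k.+2)) => //; apply: I_IM; apply: EI.
  have [_ HD HM] := idIM k.+2.
  have nzk : k.+1%:R != 0 :> K by rewrite (proj1 (pcharf0P K) char0).
  rewrite -[h i](subrK p); apply: (HD); first exact: I_IM.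
  rewrite -[p](scalerK nzk) -mul_mpolyC; apply: (HM).
  by rewrite scaler_nat.
move=> i; have [||a a0 Ia] := @krull_point _ _ e (vanish S) (h i).
- exact: idI.
- by case=> [|k]; [exists (h i); rewrite ?subrr //; case: idI|exact: hIM].
case: (prime _ _ Ia) => // /(_ e Se); rewrite mevalB meval1 a0 subr0 => /eqP.
by rewrite oner_eq0.
Qed.

(** * Jets, differential polynomials and differential terms *)

Lemma insub_ord r (j : 'I_r) : insub (j : nat) = Some j :> option 'I_r.
Proof. exact: valK. Qed.

Section JetCoding.

Variable (K : nzRingType).

Definition enc n r (Y : nat -> 'rV[K]_n) : 'rV[K]_(n * r) :=
  mxvec (\matrix_(i < n, j < r) Y j 0 i).

Definition dec n r (z : 'rV[K]_(n * r)) (k : nat) : 'rV[K]_n :=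
  \row_i (if insub k is Some j then vec_mx z i j else 0).

Lemma decK n r (z : 'rV[K]_(n * r)) : enc r (dec z) = z.
Proof.
rewrite /enc -[RHS]vec_mxK; congr mxvec; apply/matrixP => i j.
by rewrite mxE mxE insub_ord.
Qed.

Lemma encK n r Y k : (k < r)%N -> dec (enc r Y : 'rV_(n * r)) k = Y k.
Proof. by move=> ltk; apply/rowP => i; rewrite mxE insubT /enc mxvecK mxE. Qed.

Lemma dec_index n r (z : 'rV[K]_(n * r)) (i : 'I_n) (j : 'I_r) :
  dec z j 0 i = z 0 (mxvec_index i j).
Proof.
by rewrite mxE insub_ord mxE.
Qed.

Lemma dec_out n r (z : 'rV[K]_(n * r)) k : (r <= k)%N -> dec z k = 0.
Proof. by move=> lek; apply/rowP => i; rewrite !mxE insubN // -leqNgt. Qed.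

Lemma dec_lin n r a (y z : 'rV[K]_(n * r)) k :
  dec (a *: y + z) k = a *: dec y k + dec z k.
Proof.
apply/rowP => i; rewrite !mxE; case: insub => [j|]; last by rewrite mulr0 addr0.
by rewrite !mxE.
Qed.

Lemma enc_lin n r a (Y Z : nat -> 'rV[K]_n) :
  enc r (fun k => a *: Y k + Z k) = a *: enc r Y + enc r Z.
Proof.
by rewrite /enc -linearP /=; congr mxvec; apply/matrixP => i j; rewrite !mxE.
Qed.

Lemma enc_ext n r (Y Z : nat -> 'rV[K]_n) :
  (forall k, (k < r)%N -> Y k = Z k) -> enc r Y = enc r Z.
Proof.
by move=> YZ; congr mxvec; apply/matrixP => i j; rewrite !mxE YZ.
Qed.

Lemma dec0 n r k : dec (0 : 'rV[K]_(n * r)) k = 0.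
Proof. by apply/rowP=> i; rewrite !mxE; case: insub => // j; rewrite !mxE. Qed.

End JetCoding.

Lemma map_mpoly_idfun (R : nzRingType) n (p : {mpoly R[n]}) :
  map_mpoly idfun p = p.
Proof.
by apply/mpolyP => m; rewrite mcoeff_map_mpoly.
Qed.

Section Derivations.

Variables (F : fieldType) (d : F -> F).
Hypothesis d_der : is_derivation d.

Lemma derD x y : d (x + y) = d x + d y. Proof. by case: d_der. Qed.
Lemma derM x y : d (x * y) = d x * y + x * d y. Proof. by case: d_der. Qed.
Lemma der0 : d 0 = 0.
Proof. by apply: (addrI (d 0)); rewrite -derD !addr0. Qed.
Lemma der1 : d 1 = 0.
Proof. by apply: (addrI (d 1)); rewrite addr0 -{3}[1]mulr1 derM mulr1 mul1r. Qed.
Lemma derN x : d (- x) = - d x.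
Proof. by apply/eqP; rewrite -addr_eq0 -derD addNr der0. Qed.
Lemma derMn x k : d (x *+ k) = d x *+ k.
Proof. by elim: k => [|k IHk]; rewrite ?mulr0n ?der0 // !mulrS derD IHk. Qed.
Lemma der_sum I r (P : pred I) (f : I -> F) :
  d (\sum_(i <- r | P i) f i) = \sum_(i <- r | P i) d (f i).
Proof. exact: (big_morph _ derD der0). Qed.
Lemma der_nat k : d k%:R = 0.
Proof. by rewrite derMn der1 mul0rn. Qed.
Lemma iter_der0 k : iter k d 0 = 0.
Proof. by elim: k => //= k ->; apply: der0. Qed.
Lemma iter_derD k x y : iter k d (x + y) = iter k d x + iter k d y.
Proof. by elim: k => //= k ->; rewrite derD. Qed.
Lemma iter_der_sum k I r (P : pred I) (f : I -> F) :
  iter k d (\sum_(i <- r | P i) f i) = \sum_(i <- r | P i) iter k d (f i).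
Proof. exact: (big_morph _ (iter_derD k) (iter_der0 k)). Qed.

Lemma leibniz k x y : iter k d (x * y) =
  \sum_(a < k.+1) (iter a d x * iter (k - a) d y) *+ 'C(k, a).
Proof.
elim: k => [|k IHk]; first by rewrite big_ord_recl big_ord0 addr0.
pose f a := iter a d x * iter (k.+1 - a) d y.
transitivity (\sum_(a < k.+1) (f a *+ 'C(k, a) + f a.+1 *+ 'C(k, a))).
  rewrite iterS IHk der_sum; apply: eq_bigr => a _.
  rewrite derMn derM mulrnDl addrC -!iterS /f subSS.
  by rewrite -subSn // -ltnS.
rewrite big_split /= big_ord_recl [RHS]big_ord_recl /= !bin0 -addrA; congr (_ + _).
rewrite [RHS](eq_bigr (fun a : 'I_k.+1 => f a.+1 *+ 'C(k, a.+1) + f a.+1 *+ 'C(k, a))).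
  rewrite [RHS]big_split /=; congr (_ + _).
  by rewrite [RHS]big_ord_recr /= bin_small // mulr0n addr0.
by move=> a _; rewrite /bump /= add1n binS mulrnDr.
Qed.

End Derivations.

Definition dev (F E : fieldType) (dE : E -> E) (iota : F -> E) n r
    (p : {mpoly F[n * r]}) (x : 'rV[E]_n) : E :=
  (map_mpoly iota p).@[jet dE r x 0].

Definition diff_ext (F : fieldType) (d : F -> F) (E : fieldType) (dE : E -> E)
    (iota : F -> E) :=
  is_derivation dE /\ forall a, dE (iota a) = iota (d a).

Section Dev.
Variables (F E : fieldType) (dE : E -> E) (iota : {rmorphism F -> E}).

Lemma devC n r c x : dev dE iota (c%:MP : {mpoly F[n * r]}) x = iota c.
Proof. by rewrite /dev map_mpolyC mevalC. Qed.

Lemma devX n r i j x :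
  dev dE iota ('X_(mxvec_index i j) : {mpoly F[n * r]}) x = iter j dE (x 0 i).
Proof. by rewrite /dev map_mpolyX mevalXU /jet mxvecE mxE. Qed.

Lemma devD n r (p q : {mpoly F[n * r]}) x :
  dev dE iota (p + q) x = dev dE iota p x + dev dE iota q x.
Proof. by rewrite /dev !rmorphD. Qed.

Lemma devM n r (p q : {mpoly F[n * r]}) x :
  dev dE iota (p * q) x = dev dE iota p x * dev dE iota q x.
Proof. by rewrite /dev !rmorphM. Qed.

End Dev.

Section Prolongation.

Variables (F : fieldType) (d : F -> F).
Hypothesis d_der : is_derivation d.

Lemma jetE (E : fieldType) (dE : E -> E) n r (x : 'rV[E]_n) i j :
  jet dE r x 0 (mxvec_index i j) = iter j dE (x 0 i).
Proof. by rewrite /jet mxvecE mxE. Qed.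

Lemma jet_enc n r (x : 'rV[F]_n) :
  jet d r x = enc r (fun k => map_mx (iter k d) x).
Proof. by congr mxvec; apply/matrixP => i j; rewrite !mxE. Qed.

Definition dgrad n r (p : {mpoly F[n * r]}) (x : 'rV[F]_n) : nat -> 'rV[F]_n :=
  dec (grad p (jet d r x)).

Lemma dgradC n r c x k : dgrad (c%:MP : {mpoly F[n * r]}) x k = 0.
Proof.
apply/rowP => i; rewrite !mxE; case: insub => // j.
by rewrite !mxE mderivC meval0.
Qed.

Lemma dgradX n r (i : 'I_n) (j : 'I_r) x k :
  dgrad ('X_(mxvec_index i j) : {mpoly F[n * r]}) x k =
    if k == j then delta_mx 0 i else 0.
Proof.
apply/rowP => l; rewrite mxE; case: insubP => [m _ <-|]; last first.
  by case: eqP => [->|_ _]; rewrite ?ltn_ord // mxE.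
rewrite mxE mxE mderivXU.
have -> : (mxvec_index l m == mxvec_index i j) = (l == i) && (m == j).
  apply/eqP/andP => [/cast_ord_inj/enum_rank_inj[-> ->] //|[/eqP-> /eqP->] //].
rewrite -[m == j]val_eqE /=; case: (eqVneq (m : nat) j) => [_|_].
  by rewrite andbT mxE eqxx /=; case: (l == i); rewrite ?meval1 ?meval0.
by rewrite andbF meval0 mxE.
Qed.

Lemma dgradD n r (p q : {mpoly F[n * r]}) x k :
  dgrad (p + q) x k = dgrad p x k + dgrad q x k.
Proof.
rewrite -[dgrad p x k]scale1r -dec_lin; congr dec; apply/rowP => i.
by rewrite !mxE mderivD mevalD mul1r.
Qed.

Lemma dgradM n r (p q : {mpoly F[n * r]}) x k :
  dgrad (p * q) x k = deval d q x *: dgrad p x k + deval d p x *: dgrad q x k.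
Proof.
rewrite -[X in _ + X]addr0 -[X in _ + (_ + X)](dec0 F n r k) -!dec_lin.
congr dec; apply/rowP => i; rewrite !mxE mderivM mevalD !mevalM addr0 /deval.
by ring.
Qed.

Lemma lift_order n r r' (p : {mpoly F[n * r]}) : (r <= r')%N ->
  exists p' : {mpoly F[n * r']},
    (forall (E : fieldType) (dE : E -> E) (iota : {rmorphism F -> E}) x,
       dev dE iota p' x = dev dE iota p x) /\
    (forall x k, dgrad p' x k = dgrad p x k).
Proof.
move=> ler; elim/mpoly_alg_ind: p => [c|i|p q [p' [Hp Gp]] [q' [Hq Gq]]|p q [p' [Hp Gp]] [q' [Hq Gq]]].
- exists c%:MP; split=> [E dE iota x|x k]; last by rewrite !dgradC.
  by rewrite !devC.
- case/mxvec_indexP: i => i j; exists 'X_(mxvec_index i (widen_ord ler j)).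
  split=> [E dE iota x|x k]; last by rewrite !dgradX.
  by rewrite !devX.
- exists (p' + q'); split=> [E dE iota x|x k]; last by rewrite !dgradD Gp Gq.
  by rewrite !devD Hp Hq.
- have dev_d t (t' : {mpoly F[n * r']}) x :
    (forall (E : fieldType) (dE : E -> E) (iota : {rmorphism F -> E}) x,
       dev dE iota t' x = dev dE iota t x) -> deval d t' x = deval d (t : {mpoly F[n * r]}) x.
    move=> /(_ F d (idfun : {rmorphism F -> F}) x).
    by rewrite /dev !map_mpoly_idfun.
  exists (p' * q'); split=> [E dE iota x|x k].
    by rewrite !devM Hp Hq.
  by rewrite !dgradM Gp Gq (dev_d _ _ _ Hp) (dev_d _ _ _ Hq).
Qed.

(** The total derivative, D p = p^d + sum_ij (dp/dx_ij) x_i(j+1).  At any point the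
    sequence of its partial gradients is obtained from that of p by the operator
    d + shift, which is how linear differential operators compose with d. *)
Lemma total_derivative n r (p : {mpoly F[n * r]}) :
  exists p' : {mpoly F[n * r.+1]},
    (forall (E : fieldType) (dE : E -> E) (iota : {rmorphism F -> E}) x,
       diff_ext d dE iota -> dev dE iota p' x = dE (dev dE iota p x)) /\
    (forall x k, dgrad p' x k = map_mx d (dgrad p x k) +
                  (if k is k'.+1 then dgrad p x k' else 0)).
Proof.
have dev_d r1 (t : {mpoly F[n * r1]}) x : dev d (idfun : {rmorphism F -> F}) t x = deval d t x.
  by rewrite /dev map_mpoly_idfun.
have map0 : map_mx d (0 : 'rV[F]_n) = 0.
  by apply/rowP => i; rewrite !mxE der0.
elim/mpoly_alg_ind: p => [c|i|p q [p' [Hp Gp]] [q' [Hq Gq]]|p q [p' [Hp Gp]] [q' [Hq Gq]]].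
- exists (d c)%:MP; split=> [E dE iota x [_ Hd]|x k].
    by rewrite !devC Hd.
  by case: k => [|k]; rewrite !dgradC map0 addr0.
- case/mxvec_indexP: i => i j; exists 'X_(mxvec_index i (lift ord0 j)).
  split=> [E dE iota x [_ Hd]|x k].
    by rewrite !devX.
  rewrite !dgradX.
  have -> : map_mx d (if k == j then delta_mx 0 i else 0) = 0 :> 'rV[F]_n.
    case: ifP => _ //; apply/rowP => l; rewrite !mxE.
    by case: andb; rewrite ?(der1 d_der) ?(der0 d_der).
  by rewrite add0r; case: k => [|k] //; rewrite dgradX.
- exists (p' + q'); split=> [E dE iota x Hd|x k].
    rewrite !devD Hp // Hq //.
    by case: Hd => dE_der _; rewrite (derD dE_der).
  rewrite !dgradD Gp Gq addrACA; congr (_ + _).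
    by apply/rowP => i; rewrite !mxE (derD d_der).
  by case: k => [|k]; rewrite ?addr0 // dgradD.
- have [p1 [Hp1 Gp1]] := lift_order p (leqnSn r).
  have [q1 [Hq1 Gq1]] := lift_order q (leqnSn r).
  exists (p' * q1 + p1 * q'); split=> [E dE iota x Hd|x k].
    rewrite devD !devM Hp // Hq // Hp1 Hq1.
    by case: Hd => dE_der _; rewrite (derM dE_der).
  have dd_id : diff_ext d d (idfun : {rmorphism F -> F}) by split.
  rewrite dgradD !dgradM Gp Gq Gp1 Gq1.
  rewrite -!dev_d Hp // Hq // Hp1 Hq1 !dev_d.
  case: k => [|k]; rewrite ?dgradM.
    apply/rowP => i; rewrite !mxE (derD d_der) !(derM d_der); ring.
  apply/rowP => i; rewrite !mxE (derD d_der) !(derM d_der); ring.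
Qed.

End Prolongation.

(** * Differential terms and systems of differential equations *)

(** Differential terms, in which derivation is an operation.  Unlike polynomials in
    jets they have no order, so they compose by substitution. *)
Inductive dterm (F : Type) (n : nat) : Type :=
  | TConst of F
  | TVar of 'I_n
  | TAdd of dterm F n & dterm F n
  | TMul of dterm F n & dterm F n
  | TDer of dterm F n.

Arguments TConst {F n}.
Arguments TVar {F n}.

Fixpoint teval (F : Type) n (E : fieldType) (dE : E -> E) (iota : F -> E)
    (x : 'I_n -> E) (t : dterm F n) : E :=
  match t with
  | TConst c => iota c
  | TVar i => x i
  | TAdd a b => teval dE iota x a + teval dE iota x b
  | TMul a b => teval dE iota x a * teval dE iota x b
  | TDer a => dE (teval dE iota x a)
  end.

Fixpoint tsubst (F : Type) m n (s : 'I_m -> dterm F n) (t : dterm F m) : dterm F n :=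
  match t with
  | TConst c => TConst c
  | TVar i => s i
  | TAdd a b => TAdd (tsubst s a) (tsubst s b)
  | TMul a b => TMul (tsubst s a) (tsubst s b)
  | TDer a => TDer (tsubst s a)
  end.

Definition TSum (F : pzRingType) n I (r : seq I) (f : I -> dterm F n) : dterm F n :=
  foldr (fun i t => TAdd (f i) t) (TConst 0) r.

Definition TProd (F : pzRingType) n I (r : seq I) (f : I -> dterm F n) : dterm F n :=
  foldr (fun i t => TMul (f i) t) (TConst 1) r.

Definition TExp (F : pzRingType) n (t : dterm F n) k : dterm F n :=
  iter k (TMul t) (TConst 1).

Definition TSub (F : pzRingType) n (a b : dterm F n) : dterm F n :=
  TAdd a (TMul (TConst (-1)) b).

Section TermEval.

Variables (F : fieldType) (E : fieldType) (dE : E -> E).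

Lemma teval_subst (iota : F -> E) m n (s : 'I_m -> dterm F n) x t :
  teval dE iota x (tsubst s t) = teval dE iota (fun i => teval dE iota x (s i)) t.
Proof. by elim: t => //= [a -> b ->|a -> b ->|a ->]. Qed.

Lemma teval_ext (iota : F -> E) n (x y : 'I_n -> E) t :
  x =1 y -> teval dE iota x t = teval dE iota y t.
Proof. by move=> xy; elim: t => //= [a -> b ->|a -> b ->|a ->]. Qed.

Lemma teval_iter (iota : F -> E) n (x : 'I_n -> E) k t :
  teval dE iota x (iter k (@TDer F n) t) = iter k dE (teval dE iota x t).
Proof. by elim: k => //= k ->. Qed.

Variable (iota : {rmorphism F -> E}).

Lemma teval_sum n I (r : seq I) (f : I -> dterm F n) x :
  teval dE iota x (TSum r f) = \sum_(i <- r) teval dE iota x (f i).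
Proof. by elim: r => [|i r IHr] /=; rewrite ?big_nil ?rmorph0 // big_cons IHr. Qed.

Lemma teval_prod n I (r : seq I) (f : I -> dterm F n) x :
  teval dE iota x (TProd r f) = \prod_(i <- r) teval dE iota x (f i).
Proof. by elim: r => [|i r IHr] /=; rewrite ?big_nil ?rmorph1 // big_cons IHr. Qed.

Lemma teval_exp n (t : dterm F n) k x :
  teval dE iota x (TExp t k) = teval dE iota x t ^+ k.
Proof. by elim: k => [|k IHk] /=; rewrite ?rmorph1 // exprS IHk. Qed.

Lemma teval_sub n (a b : dterm F n) x :
  teval dE iota x (TSub a b) = teval dE iota x a - teval dE iota x b.
Proof. by rewrite /= rmorphN rmorph1 mulN1r. Qed.

End TermEval.

Lemma dterm_of_mpoly (F : fieldType) n r (p : {mpoly F[n * r]}) :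
  exists t : dterm F n, forall (E : fieldType) (dE : E -> E)
    (iota : {rmorphism F -> E}) (x : 'rV_n), teval dE iota (x 0) t = dev dE iota p x.
Proof.
elim/mpoly_alg_ind: p => [c|i|p q [t Ht] [u Hu]|p q [t Ht] [u Hu]].
- by exists (TConst c) => E dE iota x; rewrite devC.
- case/mxvec_indexP: i => i j; exists (iter j (@TDer F n) (TVar i)) => E dE iota x.
  by rewrite teval_iter devX.
- by exists (TAdd t u) => E dE iota x /=; rewrite devD Ht Hu.
- by exists (TMul t u) => E dE iota x /=; rewrite devM Ht Hu.
Qed.

Lemma mpoly_of_poly_term (F : fieldType) n (p : {mpoly F[n]}) m
    (s : 'I_n -> dterm F m) :
  exists t : dterm F m, forall (E : fieldType) (dE : E -> E)
    (iota : {rmorphism F -> E}) x,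
    teval dE iota x t = (map_mpoly iota p).@[fun i => teval dE iota x (s i)].
Proof.
elim/mpoly_alg_ind: p => [c|i|p q [t Ht] [u Hu]|p q [t Ht] [u Hu]].
- by exists (TConst c) => E dE iota x; rewrite map_mpolyC mevalC.
- by exists (s i) => E dE iota x; rewrite map_mpolyX mevalXU.
- by exists (TAdd t u) => E dE iota x /=; rewrite !rmorphD /= Ht Hu.
- by exists (TMul t u) => E dE iota x /=; rewrite !rmorphM /= Ht Hu.
Qed.

Section TermSystems.

Variables (F : fieldType) (d : F -> F).
Hypothesis d_der : is_derivation d.

Lemma mpoly_of_dterm n (t : dterm F n) : exists r0, forall r, (r0 <= r)%N ->
  exists p : {mpoly F[n * r]}, forall (E : fieldType) (dE : E -> E)
    (iota : {rmorphism F -> E}) (x : 'rV_n), diff_ext d dE iota ->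
    dev dE iota p x = teval dE iota (x 0) t.
Proof.
elim: t => [c|i|a [ra Ha] b [rb Hb]|a [ra Ha] b [rb Hb]|a [ra Ha]].
- by exists 0%N => r _; exists c%:MP => E dE iota x _; rewrite devC.
- exists 1%N => -[//|r] _; exists 'X_(mxvec_index i 0) => E dE iota x _.
  by rewrite devX.
- exists (maxn ra rb) => r; rewrite geq_max => /andP[/Ha[p Hp] /Hb[q Hq]].
  by exists (p + q) => E dE iota x ext /=; rewrite devD Hp // Hq.
- exists (maxn ra rb) => r; rewrite geq_max => /andP[/Ha[p Hp] /Hb[q Hq]].
  by exists (p * q) => E dE iota x ext /=; rewrite devM Hp // Hq.
- exists ra.+1 => -[//|r]; rewrite ltnS => /Ha[p Hp].
  have [p' [Hp' _]] := total_derivative d_der p.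
  by exists p' => E dE iota x ext /=; rewrite Hp' // Hp.
Qed.

Lemma mpoly_of_dterms n s (t : 'I_s -> dterm F n) :
  exists r (p : 'I_s -> {mpoly F[n * r]}), forall i (E : fieldType) (dE : E -> E)
    (iota : {rmorphism F -> E}) (x : 'rV_n), diff_ext d dE iota ->
    dev dE iota (p i) x = teval dE iota (x 0) (t i).
Proof.
have /functional_choice [r0 Hr0] := fun i => mpoly_of_dterm (t i).
exists (\max_i r0 i).
have /functional_choice [p Hp] := fun i => Hr0 i _ (leq_bigmax i).
by exists p.
Qed.

Hypothesis d_closed : delta_closed d.

(** Differential closedness is stated for polynomials in jets of a fixed order; a
    finite system of differential terms is brought to a common order. *)
Theorem delta_closed_terms n s (t : 'I_s -> dterm F n) :
    (exists (E : fieldType) (dE : E -> E) (iota : {rmorphism F -> E}) (x : 'I_n -> E),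
       diff_ext d dE iota /\ forall i, teval dE iota x (t i) = 0) ->
  exists x : 'I_n -> F, forall i, teval d idfun x (t i) = 0.
Proof.
case=> E [dE [iota [x [ext Hx]]]]; have [r [p Hp]] := mpoly_of_dterms t.
have xE : (\row_i x i) 0 =1 x by move=> i; rewrite mxE.
have [|y Hy] := @d_closed n r (codom p).
  exists E, dE, iota; split; [by case: ext|by case: ext|].
  exists (\row_i x i) => _ /codomP[i ->].
  by have := Hp i E dE iota (\row_i x i) ext; rewrite (teval_ext _ _ _ xE) Hx.
exists (y 0) => i.
have ext_id : diff_ext d d (idfun : {rmorphism F -> F}) by split.
have := Hp i F d (idfun : {rmorphism F -> F}) y ext_id.
rewrite /dev map_mpoly_idfun => <-.
exact: Hy (codom_f p i).
Qed.

End TermSystems.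

(** * Differentially closed fields are algebraically closed *)

Definition alg_closed (F : fieldType) :=
  forall p : {poly F}, (1 < size p)%N -> exists x, root p x.

Section AlgClosed.

Variables (F : fieldType) (d : F -> F).
Hypothesis d_der : is_derivation d.

Definition poly_der (a p : {poly F}) := map_poly d p + p^`() * a.

Lemma poly_derD a : {morph poly_der a : p q / p + q}.
Proof.
move=> p q; rewrite /poly_der derivD mulrDl addrACA; congr (_ + _).
by apply/polyP => i; rewrite !(coefD, coef_map_id0 _ _ (der0 d_der)) derD.
Qed.

Lemma poly_derM a p q : poly_der a (p * q) = poly_der a p * q + p * poly_der a q.
Proof.
have E : map_poly d (p * q) = map_poly d p * q + p * map_poly d q.
  apply/polyP => i; rewrite coefD !coefM !(coef_map_id0 _ _ (der0 d_der)) coefM.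
  rewrite (der_sum d_der) -big_split; apply: eq_bigr => j _.
  by rewrite (derM d_der) !(coef_map_id0 _ _ (der0 d_der)).
by rewrite /poly_der E derivM; ring.
Qed.

Lemma poly_derC a c : poly_der a c%:P = (d c)%:P.
Proof.
rewrite /poly_der derivC mul0r addr0; apply/polyP => i.
by rewrite (coef_map_id0 _ _ (der0 d_der)) !coefC; case: eqP; rewrite ?der0.
Qed.

Lemma irreducible_factor (p : {poly F}) : (1 < size p)%N ->
  exists h, [/\ irreducible_poly h, h \is monic & h %| p].
Proof.
move=> szp; have nzp : p != 0 by rewrite -size_poly_gt0 ltnW.
have [h [szh hp minh]] : exists h : {poly F}, [/\ (1 < size h)%N, h %| p &
    forall q : {poly F}, (1 < size q)%N -> q %| p -> (size h <= size q)%N].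
  suff main n (h : {poly F}) : (size h < n)%N -> h %| p -> (1 < size h)%N ->
      exists h : {poly F}, [/\ (1 < size h)%N, h %| p &
        forall q : {poly F}, (1 < size q)%N -> q %| p -> (size h <= size q)%N].
    exact: main (ltnSn _) (dvdpp p) szp.
  elim: n h => // n IHn h ltn hp szh.
  have [[q [szq qp ltq]]|no] := classic (exists q : {poly F},
      [/\ (1 < size q)%N, q %| p & (size q < size h)%N]).
    by apply: (IHn q) => //; apply: leq_trans ltq _.
  exists h; split=> // q szq qp; rewrite leqNgt; apply/negP => ltq.
  by apply: no; exists q.
have nzh : h != 0 by rewrite -size_poly_gt0 ltnW.
have nzc : (lead_coef h)^-1 != 0 by rewrite invr_eq0 lead_coef_eq0.
exists ((lead_coef h)^-1 *: h); split; last by rewrite dvdpZl.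
  split; first by rewrite size_scale.
  move=> q szq; rewrite dvdpZr // => qh.
  rewrite (eqp_rtrans (eqp_scale _ nzc)) -dvdp_size_eqp // eqn_leq dvdp_leq //=.
  apply: minh; last exact: dvdp_trans hp.
  have: (0 < size q)%N.
    by rewrite size_poly_gt0; apply: contraNneq nzh => q0; move: qh; rewrite q0 dvd0p.
  by move: szq; case: (size q) => [|[]].
by rewrite monicE lead_coefZ mulVf // lead_coef_eq0.
Qed.

Hypothesis char0 : [pchar F] =i pred0.

(** In characteristic 0 the derivative of a nonconstant polynomial is nonzero and
    of smaller degree. *)
Lemma irreducible_separable (h : {poly F}) :
  irreducible_poly h -> coprimep h h^`().
Proof.
move=> irr; have nzh := irredp_neq0 irr; rewrite irreducible_poly_coprime //.
have [szh _] := irr.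
have nzd : h^`() != 0.
  apply/eqP => /(congr1 (fun q : {poly F} => q`_(size h).-2)).
  rewrite coef_deriv coef0; have -> : (size h).-2.+1 = (size h).-1 by case: (size h) szh => [|[]].
  move/eqP; rewrite -mulr_natr mulf_eq0 lead_coef_eq0 (negPf nzh) /=.
  by rewrite (proj1 (pcharf0P F) char0); case: (size h) szh => [|[]].
by rewrite gtNdvdp ?lt_size_deriv.
Qed.

(** The derivation extends to F[X]/(h) for h irreducible: separability allows to
    choose the image of X so that the ideal of h is stable.  A root of h in this
    extension then yields one in F. *)
Theorem delta_closed_alg_closed : delta_closed d -> alg_closed F.
Proof.
move=> d_closed p szp; have [h [irr mon hp]] := irreducible_factor szp.
suff [x rx] : exists x, root h x by exists x;
  case/dvdpP: hp => q ->; rewrite rootM rx orbT.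
pose hI : monic_irreducible_poly h := (irr, mon).
pose E : fieldType := {poly %/ h with hI}.
pose pi : {rmorphism {poly F} -> E} := in_qpoly h.
have hmon : mk_monic h = h := mk_monicE hI.
have sect (u : E) : pi (u : {poly %/ h}) = u.
  by apply: val_inj; apply: (in_qpoly_small (size_mk_monic (u : {poly %/ h}))).
have pi_h : pi h = 0.
  by apply: val_inj; rewrite /= hmon Pdiv.RingMonic.rmodpp.
have pi0 q : pi q = 0 -> exists r, q = r * h.
  move/(congr1 val); rewrite /= hmon => q0; exists (Pdiv.CommonRing.rdivp q h).
  by rewrite {1}(Pdiv.RingMonic.rdivp_eq mon q) q0 addr0.
have [[u v] /= uv] := Bezout_eq1_coprimepP _ _ (irreducible_separable irr).
pose a := - v * map_poly d h; pose D := poly_der a.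
have Dh : D h = u * map_poly d h * h.
  rewrite /D /poly_der /a.
  have -> : h^`() * (- v * map_poly d h) = - (v * h^`()) * map_poly d h by ring.
  by rewrite -(addKr (u * h) (v * h^`())) uv; ring.
have piD q r : pi q = pi r -> pi (D q) = pi (D r).
  move=> eqr; have [|s qr] := pi0 (q - r); first by rewrite rmorphB /= eqr subrr.
  rewrite -[q](subrK r) qr [D _]poly_derD [poly_der _ _]poly_derM -/D Dh !mulrA.
  by rewrite rmorphD /= rmorphD !rmorphM /= pi_h !mulr0 !add0r.
pose dE (x : E) := pi (D (x : {poly %/ h})).
have dE_pi q : dE (pi q) = pi (D q) by apply: piD; rewrite sect.
have dE_der : is_derivation dE.
  split=> x y; rewrite -[x]sect -[y]sect.
    by rewrite -rmorphD !dE_pi [D _]poly_derD rmorphD.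
  by rewrite -rmorphM !dE_pi [D _]poly_derM rmorphD !rmorphM.
pose iota : {rmorphism F -> E} := pi \o polyC.
have ext : diff_ext d dE iota.
  by split=> // c; rewrite /iota /= dE_pi [D _]poly_derC.
pose t (i : 'I_1) : dterm F 1 :=
  TSum (index_iota 0 (size h)) (fun k => TMul (TConst h`_k) (TExp (TVar 0) k)).
have tE (L : fieldType) (dL : L -> L) (io : {rmorphism F -> L}) x i :
    teval dL io x (t i) = (map_poly io h).[x 0].
  rewrite teval_sum horner_poly big_mkord; apply: eq_bigr => k _ /=.
  by rewrite teval_exp.
have [|x Hx] := delta_closed_terms d_der d_closed (t := t).
  exists E, dE, iota, (fun=> pi 'X); split=> // i; rewrite tE.
  have -> : map_poly iota h = map_poly pi (map_poly polyC h).
    by rewrite -map_poly_comp.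
  rewrite horner_map; have -> : (map_poly polyC h).['X] = h by exact: comp_polyXr.
  exact: pi_h.
exists (x 0); have := Hx 0.
rewrite (tE F d (idfun : {rmorphism F -> F})) map_poly_id // => h0.
by apply/rootP.
Qed.

End AlgClosed.

(** * Power series and fraction fields as differential rings *)

Definition ring_derivation (R : nzRingType) (dR : R -> R) :=
  (forall x y, dR (x + y) = dR x + dR y) /\
  (forall x y, dR (x * y) = dR x * y + x * dR y).

(** The quotient rule does not depend on the choice of representatives. *)
Lemma fraction_derivation (R : idomainType) (dR : R -> R) :
    ring_derivation dR ->
  exists dE : {fraction R} -> {fraction R}, is_derivation dE /\
    forall a : R, dE (FracField.tofrac a) = FracField.tofrac (dR a).
Proof.
move=> [dD dM]; pose phi : {rmorphism R -> {fraction R}} := @FracField.tofrac R.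
have phi_eq0 a : (phi a == 0) = (a == 0) := tofrac_eq0 a.
have /functional_choice [rep repP] : forall x, exists ab : R * R,
    ab.2 != 0 /\ x = phi ab.1 / phi ab.2.
  move=> x; exists (\n_(repr x), \d_(repr x)); split; first exact: denom_ratioP.
  have nzd : phi \d_(repr x) != 0 by rewrite phi_eq0 denom_ratioP.
  apply: (canRL (mulfK nzd)); rewrite -{1}[x]reprK /phi /=.
  unlock FracField.tofrac; rewrite -[LHS]FracField.pi_mul.
  rewrite /FracField.mulf !numden_Ratio ?oner_neq0 // !mulr1.
  apply/eqmodP; rewrite /= FracField.equivfE !numden_Ratio ?oner_neq0 ?denom_ratioP //.
  by rewrite mulr1 mulrC.
pose q a b := phi (dR a * b - a * dR b) / phi b ^+ 2.
pose dE x := q (rep x).1 (rep x).2.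
have d0 : dR 0 = 0 by apply: (addrI (dR 0)); rewrite -dD !addr0.
have dN a : dR (- a) = - dR a by apply/eqP; rewrite -addr_eq0 -dD addNr d0.
have dEq a b : b != 0 -> dE (phi a / phi b) = q a b.
  move=> nzb; rewrite /dE; have [nzb' eqx] := repP (phi a / phi b).
  move: (rep _).1 (rep _).2 nzb' eqx => a' b' nzb' eqx.
  have e : a * b' = a' * b.
    apply/eqP; rewrite -subr_eq0 -phi_eq0 rmorphB !rmorphM /= subr_eq0.
    by rewrite -eqr_div ?phi_eq0 // eqx.
  have e' : dR a * b' + a * dR b' = dR a' * b + a' * dR b by rewrite -!dM e.
  rewrite /q; apply/eqP; rewrite eqr_div ?expf_neq0 ?phi_eq0 //.
  rewrite -!rmorphXn -!rmorphM -subr_eq0 -rmorphB phi_eq0; apply/eqP.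
  apply/eqP; rewrite subr_eq0; apply/eqP.
  have eqE : (dR a' * b' - a' * dR b') * b ^+ 2 - (dR a * b - a * dR b) * b' ^+ 2 =
      (a * b' - a' * b) * (b * dR b' + b' * dR b)
      - b * b' * ((dR a * b' + a * dR b') - (dR a' * b + a' * dR b)) by ring.
  by apply/eqP; rewrite -subr_eq0 eqE e e' !subrr mul0r mulr0 subr0.
exists dE; split; first split=> x y.
- have [nzx Ex] := repP x; have [nzy Ey] := repP y.
  move: (rep x).1 (rep x).2 nzx Ex => a b nzb ->.
  move: (rep y).1 (rep y).2 nzy Ey => a' b' nzb' ->.
  rewrite addf_div ?phi_eq0 // -!rmorphM -rmorphD !dEq ?mulf_neq0 // /q.
  rewrite addf_div ?expf_neq0 ?phi_eq0 //; congr (_ / _); last first.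
    by rewrite rmorphM exprMn.
  by rewrite -!rmorphXn -!rmorphM -rmorphD; congr (phi _); rewrite dD !dM; ring.
- have [nzx Ex] := repP x; have [nzy Ey] := repP y.
  move: (rep x).1 (rep x).2 nzx Ex => a b nzb ->.
  move: (rep y).1 (rep y).2 nzy Ey => a' b' nzb' ->.
  rewrite mulf_div -!rmorphM !dEq ?mulf_neq0 // /q !dM.
  rewrite !mulf_div addf_div ?mulf_neq0 ?expf_neq0 ?phi_eq0 //.
  apply/eqP; rewrite eqr_div ?mulf_neq0 ?expf_neq0 ?phi_eq0 ?mulf_neq0 //.
  rewrite -!rmorphXn -!rmorphM -rmorphD -!rmorphM; apply/eqP; congr (phi _).
  by ring.
- move=> a; have nz1 : (1 : R) != 0 := oner_neq0 R.
  have := dEq a 1 nz1; rewrite rmorph1 divr1 => ->; rewrite /q rmorph1 expr1n divr1.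
  have d1 : dR 1 = 0.
    by apply: (addrI (dR 1)); rewrite addr0 -{3}[1]mulr1 dM mulr1 mul1r.
  by rewrite mulr1 d1 mulr0 subr0.
Qed.

Definition powser (K : fieldType) := nat -> K.

Section PowerSeries.

Variable K : fieldType.
Local Notation PS := (powser K).

HB.instance Definition _ := boolp.gen_eqMixin PS.
HB.instance Definition _ := boolp.gen_choiceMixin PS.

Definition ps_zero : PS := fun=> 0.
Definition ps_one : PS := fun k => (k == 0%N)%:R.
Definition ps_add (f g : PS) : PS := fun k => f k + g k.
Definition ps_opp (f : PS) : PS := fun k => - f k.
Definition ps_mul (f g : PS) : PS := fun k => \sum_(i < k.+1) f i * g (k - i)%N.

Lemma ps_addA : associative ps_add.
Proof. by move=> f g h; apply: functional_extensionality => k; apply: addrA. Qed.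
Lemma ps_addC : commutative ps_add.
Proof. by move=> f g; apply: functional_extensionality => k; apply: addrC. Qed.
Lemma ps_add0 : left_id ps_zero ps_add.
Proof. by move=> f; apply: functional_extensionality => k; apply: add0r. Qed.
Lemma ps_addN : left_inverse ps_zero ps_opp ps_add.
Proof. by move=> f; apply: functional_extensionality => k; apply: addNr. Qed.

HB.instance Definition _ := GRing.isZmodule.Build PS ps_addA ps_addC ps_add0 ps_addN.

(** Associativity of the Cauchy product is inherited from polynomials, because a
    coefficient of a product depends on finitely many coefficients. *)
Definition ps_trunc n (f : PS) : {poly K} := \poly_(i < n) f i.

Lemma ps_mul_trunc n f g k : (k < n)%N ->
  ps_mul f g k = (ps_trunc n f * ps_trunc n g)`_k.
Proof.
move=> ltkn; rewrite coefM; apply: eq_bigr => i _.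
rewrite !coef_poly (leq_ltn_trans _ ltkn) ?(leq_ltn_trans (leq_subr _ _) ltkn) //.
by rewrite -ltnS.
Qed.

Lemma ps_mulC : commutative ps_mul.
Proof.
move=> f g; apply: functional_extensionality => k.
by rewrite !(@ps_mul_trunc k.+1) // mulrC.
Qed.

Lemma ps_mulA : associative ps_mul.
Proof.
move=> f g h; apply: functional_extensionality => k.
transitivity ((ps_trunc k.+1 f * ps_trunc k.+1 g * ps_trunc k.+1 h)`_k).
  rewrite -mulrA coefM; apply: eq_bigr => i _.
  rewrite coef_poly ltn_ord (@ps_mul_trunc k.+1) // ltnS leq_subr //.
rewrite coefM; apply: eq_bigr => i _.
by rewrite coef_poly ltnS leq_subr (@ps_mul_trunc k.+1).
Qed.

Lemma ps_mul1 : left_id ps_one ps_mul.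
Proof.
move=> f; apply: functional_extensionality => k.
rewrite /ps_mul big_ord_recl /= mul1r subn0 big1 ?addr0 // => i _.
by rewrite mul0r.
Qed.

Lemma ps_mulDl : left_distributive ps_mul ps_add.
Proof.
move=> f g h; apply: functional_extensionality => k.
by rewrite /ps_add -big_split; apply: eq_bigr => i _; rewrite mulrDl.
Qed.

Lemma ps_one_neq0 : ps_one != 0 :> PS.
Proof. by apply/eqP => /(congr1 (fun f : PS => f 0%N))/eqP; rewrite oner_eq0. Qed.

HB.instance Definition _ :=
  GRing.Zmodule_isComNzRing.Build PS ps_mulA ps_mulC ps_mul1 ps_mulDl ps_one_neq0.

Definition ps_unit (f : PS) : bool := boolp.asbool (exists g : PS, g * f = 1).
Definition ps_inv (f : PS) : PS :=
  if boolp.pselect (exists g : PS, g * f = 1) is left H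
  then proj1_sig (constructive_indefinite_description _ H) else f.

Lemma ps_mulV : {in ps_unit, left_inverse 1 ps_inv *%R}.
Proof.
move=> f; rewrite /in_mem /= => /boolp.asboolP Uf; rewrite /ps_inv.
by case: boolp.pselect => // H; case: constructive_indefinite_description.
Qed.
Lemma ps_unitPl (f g : PS) : g * f = 1 -> ps_unit f.
Proof. by move=> H; apply/boolp.asboolP; exists g. Qed.
Lemma ps_inv_out : {in [predC ps_unit], ps_inv =1 id}.
Proof.
move=> f; rewrite /in_mem /= => /boolp.asboolPn Uf; rewrite /ps_inv.
by case: boolp.pselect.
Qed.

HB.instance Definition _ :=
  GRing.ComNzRing_hasMulInverse.Build PS ps_mulV ps_unitPl ps_inv_out.

Lemma ps_mulE (f g : PS) k : (f * g) k = \sum_(i < k.+1) f i * g (k - i)%N.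
Proof. by []. Qed.

Lemma ps_first_coef (f : PS) : f != 0 ->
  exists2 i, f i != 0 & forall j, (j < i)%N -> f j = 0.
Proof.
move=> nzf; have [|i fi mini] := @ex_minnP (fun i => f i != 0).
  apply: NNPP => no; case/eqP: nzf; apply: functional_extensionality => k.
  by apply/eqP/negPn/negP => fk; apply: no; exists k.
exists i => // j ltj; apply/eqP; apply: contraTT ltj => fj.
by rewrite -leqNgt mini.
Qed.

Lemma ps_integral (f g : PS) : f * g = 0 -> (f == 0) || (g == 0).
Proof.
move=> fg; apply/negPn; rewrite negb_or; apply/negP => /andP[nzf nzg].
have [i fi fi0] := ps_first_coef nzf; have [j gj gj0] := ps_first_coef nzg.
have /eqP := congr1 (fun h : PS => h (i + j)%N) fg.
rewrite ps_mulE.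
have lti : (i < (i + j).+1)%N by rewrite ltnS leq_addr.
rewrite (bigD1 (Ordinal lti)) //= addKn big1 ?addr0.
  by rewrite mulf_eq0 (negPf fi) (negPf gj).
move=> k; rewrite -val_eqE /= => nek.
have [ltki|ltik|/eqP] := ltngtP k i; last by rewrite (negPf nek).
  by rewrite fi0 ?mul0r.
by rewrite gj0 ?mulr0 // ltn_subLR ?ltn_add2r // -ltnS.
Qed.

HB.instance Definition _ := GRing.ComUnitRing_isIntegral.Build PS ps_integral.

Lemma ps_addE (f g : PS) k : (f + g) k = f k + g k. Proof. by []. Qed.
Lemma ps_zeroE k : (0 : PS) k = 0. Proof. by []. Qed.
Lemma ps_ext (f g : PS) : (forall k, f k = g k) -> f = g.
Proof. exact: functional_extensionality. Qed.

Definition ps_const (c : K) : PS := fun k => if k is 0%N then c else 0.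

Lemma ps_const_zmod : zmod_morphism ps_const.
Proof. by move=> a b; apply: ps_ext => -[|k] //; symmetry; exact: (subrr 0). Qed.
Lemma ps_const_monoid : monoid_morphism ps_const.
Proof.
split=> [|a b]; first by apply: ps_ext => -[].
apply: ps_ext => k; rewrite ps_mulE big_ord_recl /= subn0 big1 ?addr0.
  by case: k => //= k; rewrite mulr0.
by move=> i _; rewrite mul0r.
Qed.
HB.instance Definition _ := GRing.isZmodMorphism.Build K PS ps_const ps_const_zmod.
HB.instance Definition _ := GRing.isMonoidMorphism.Build K PS ps_const ps_const_monoid.

Lemma ps_constM c (f : PS) k : (ps_const c * f) k = c * f k.
Proof.
rewrite ps_mulE big_ord_recl /= subn0 big1 ?addr0 // => i _.
by rewrite mul0r.
Qed.

Definition ps_coef_der (d : K -> K) (f : PS) : PS := fun k => d (f k).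
Definition ps_dt (f : PS) : PS := fun k => f k.+1 *+ k.+1.

Lemma ps_coef_derivation d : is_derivation d -> ring_derivation (ps_coef_der d).
Proof.
move=> d_der; split=> f g; apply: ps_ext => k; first exact: (derD d_der).
rewrite ps_addE !ps_mulE -big_split /ps_coef_der ps_mulE (der_sum d_der).
by apply: eq_bigr => i _; rewrite (derM d_der).
Qed.

Lemma ps_dt_derivation : ring_derivation ps_dt.
Proof.
split=> f g; apply: ps_ext => k; first by rewrite /ps_dt ps_addE mulrnDl.
rewrite ps_addE /ps_dt ps_mulE !(ps_mulE _ _ k).
transitivity (\sum_(i < k.+2) (f i * g (k.+1 - i)%N *+ i
    + f i * g (k.+1 - i)%N *+ (k.+1 - i))).
  rewrite -sumrMnl; apply: eq_bigr => i _; rewrite -mulrnDr subnKC //.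
  by rewrite -ltnS.
rewrite big_split /=; congr (_ + _).
  rewrite big_ord_recl /= mulr0n add0r; apply: eq_bigr => i _.
  by rewrite /bump /= add1n subSS mulrnAl.
rewrite big_ord_recr /= subnn mulr0n addr0; apply: eq_bigr => i _.
by rewrite -mulrnAr subSn // -ltnS.
Qed.

End PowerSeries.

Lemma ring_derivationD (R : nzRingType) (d1 d2 : R -> R) :
  ring_derivation d1 -> ring_derivation d2 -> ring_derivation (fun x => d1 x + d2 x).
Proof.
case=> a1 m1 [a2 m2]; split=> x y; first by rewrite a1 a2 addrACA.
by rewrite m1 m2 mulrDl mulrDr addrACA.
Qed.

(** * Linear differential systems *)

Section LinearSystems.

Variables (K : fieldType) (d : K -> K).
Hypothesis d_der : is_derivation d.

(** A linear differential operator is coded by the polynomial of its coefficients;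
    the product of polynomials is not the composition. *)
Definition opd (b : {poly K}) (x : K) : K := \sum_(k < size b) b`_k * iter k d x.

Definition dcomp (b : {poly K}) : {poly K} := map_poly d b + 'X * b.

Lemma opd_wide n (b : {poly K}) x : (size b <= n)%N ->
  opd b x = \sum_(k < n) b`_k * iter k d x.
Proof.
move=> leb; rewrite /opd (big_ord_widen n (fun k => b`_k * iter k d x)) //.
rewrite big_mkcond; apply: eq_bigr => k _; case: ltnP => // le.
by rewrite nth_default ?mul0r.
Qed.

Lemma opdD b c x : opd (b + c) x = opd b x + opd c x.
Proof.
pose n := maxn (size b) (size c).
rewrite (@opd_wide n b) ?leq_maxl // (@opd_wide n c) ?leq_maxr //.
rewrite (@opd_wide n (b + c)) ?size_polyD // -big_split.
by apply: eq_bigr => k _; rewrite coefD mulrDl.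
Qed.

Lemma opdZ a b x : opd (a *: b) x = a * opd b x.
Proof.
rewrite (@opd_wide (size b)) ?size_scale_leq // mulr_sumr.
by apply: eq_bigr => k _; rewrite coefZ mulrA.
Qed.

Lemma opd0 x : opd 0 x = 0.
Proof. by rewrite /opd size_poly0 big_ord0. Qed.

Lemma opd1 x : opd 1 x = x.
Proof. by rewrite /opd size_poly1 big_ord1 coef1 mul1r. Qed.

Lemma opd_at0 b : opd b 0 = 0.
Proof. by rewrite /opd big1 // => k _; rewrite (iter_der0 d_der) mulr0. Qed.

Lemma coef_dcomp b k :
  (dcomp b)`_k = d b`_k + (if k is k'.+1 then b`_k' else 0).
Proof.
rewrite coefD (coef_map_id0 _ _ (der0 d_der)) coefXM.
by case: k.
Qed.

Lemma size_dcomp_leq b : (size (dcomp b) <= (size b).+1)%N.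
Proof.
apply/leq_sizeP => -[|k] ltk //.
by rewrite coef_dcomp !nth_default ?(der0 d_der) ?addr0 // ltnW.
Qed.

Lemma opd_dcomp b x : opd (dcomp b) x = d (opd b x).
Proof.
rewrite (opd_wide _ (size_dcomp_leq b)) (der_sum d_der).
under [RHS]eq_bigr do rewrite (derM d_der).
under [LHS]eq_bigr do rewrite coef_dcomp mulrDl.
rewrite !big_split /=; congr (_ + _).
  by rewrite big_ord_recr /= nth_default // (der0 d_der) mul0r addr0.
by rewrite big_ord_recl /= mul0r add0r.
Qed.

Lemma opd_iter_dcomp j b x : opd (iter j dcomp b) x = iter j d (opd b x).
Proof. by elim: j => //= j IHj; rewrite opd_dcomp IHj. Qed.

Lemma dcomp_monic b : b \is monic ->
  dcomp b \is monic /\ size (dcomp b) = (size b).+1.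
Proof.
move=> mon; have szb : (0 < size b)%N by rewrite size_poly_gt0 monic_neq0.
have top : (dcomp b)`_(size b) = 1.
  rewrite coef_dcomp nth_default // (der0 d_der) add0r.
  by rewrite -[in LHS](prednK szb) -(monicP mon).
have sz : size (dcomp b) = (size b).+1.
  apply/eqP; rewrite eqn_leq size_dcomp_leq ltnNge; apply/negP => le.
  by move/eqP: top; rewrite nth_default // eq_sym oner_eq0.
by split; rewrite // monicE lead_coefE sz top.
Qed.

Lemma iter_dcomp_monic j b : b \is monic ->
  iter j dcomp b \is monic /\ size (iter j dcomp b) = (j + size b)%N.
Proof.
move=> mon; elim: j => //= j [monj szj].
by have [mon' ->] := dcomp_monic monj; rewrite szj.
Qed.

Hypothesis char0 : [pchar K] =i pred0.
Hypothesis d_closed : delta_closed d.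

(** A solution exists in K((t)) with the derivation d + d/dt: the coefficients of
    the companion system are found recursively from the first basis
    vector as initial value.  Differential closedness brings it down to K. *)
Lemma scalar_ode_solution (b : {poly K}) : b \is monic -> (1 < size b)%N ->
  exists2 y, y != 0 & opd b y = 0.
Proof.
move=> mon szb; set s := (size b).-1.
have szbE : size b = s.+1 by rewrite prednK // ltnW.
have s_gt0 : (0 < s)%N by rewrite -ltnS -szbE.
have bs : b`_s = 1 by rewrite -(monicP mon) lead_coefE.
pose A (u : nat -> K) i :=
  if (i.+1 < s)%N then u i.+1 else - \sum_(j < s) b`_j * u j.
pose Y := fix Y k := if k is k'.+1
  then fun i => (A (Y k') i - d (Y k' i)) / k'.+1%:R else fun i => (i == 0%N)%:R.
pose y i : powser K := fun k => Y k i.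
pose dR f := ps_coef_der d f + ps_dt f.
have dR_der : ring_derivation dR.
  exact: ring_derivationD (ps_coef_derivation d_der) (ps_dt_derivation K).
have dRy i : dR (y i) = (fun k => A (Y k) i).
  apply: ps_ext => k; rewrite /dR ps_addE /ps_coef_der /ps_dt /y /=.
  have divnK (z : K) : z / k.+1%:R *+ k.+1 = z.
    by rewrite -(mulr_natr (z / _)) divfK ?(proj1 (pcharf0P K) char0).
  by rewrite divnK addrC subrK.
have dRy_lt i : (i.+1 < s)%N -> dR (y i) = y i.+1.
  by move=> lti; rewrite dRy; apply: ps_ext => k; rewrite /A lti.
have dRy_top : dR (y s.-1) = - \sum_(j < s) ps_const b`_j * y j.
  rewrite dRy; apply: ps_ext => k; rewrite /A prednK // ltnn.
  have sumE (f : 'I_s -> powser K) : (- \sum_j f j) k = - \sum_j (f j k).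
    change (- ((\sum_j f j) k) = - \sum_j (f j k)); congr (- _).
    exact: (big_morph (fun g : powser K => g k) (fun g h => ps_addE g h k) (ps_zeroE K k)).
  by rewrite sumE; congr (- _); apply: eq_bigr => j _; rewrite ps_constM.
have [dE [dE_der dE_frac]] := fraction_derivation dR_der.
pose E : fieldType := {fraction (powser K)}.
pose frac : {rmorphism powser K -> E} := @FracField.tofrac (powser K).
pose iota : {rmorphism K -> E} := frac \o @ps_const K.
have ext : diff_ext d dE iota.
  split=> // c; rewrite /= dE_frac; congr (FracField.tofrac _).
  apply: ps_ext => k; rewrite /dR ps_addE /ps_coef_der /ps_dt /=.
  by rewrite mul0rn addr0; case: k => //=; rewrite (der0 d_der).
have iterE i : (i < s)%N -> iter i dE (frac (y 0%N)) = frac (y i).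
  elim: i => // i IHi lti; rewrite iterS IHi ?(ltnW lti) // /frac /= dE_frac.
  by rewrite dRy_lt.
have solE : \sum_(k < s.+1) iota b`_k * iter k dE (frac (y 0%N)) = 0.
  rewrite big_ord_recr /= bs rmorph1 mul1r.
  have -> : iter s dE (frac (y 0%N)) = dE (frac (y s.-1)).
    by rewrite -(prednK s_gt0) iterS iterE // prednK.
  rewrite dE_frac dRy_top rmorphN rmorph_sum /= -sumrB big1 // => k _.
  by rewrite iterE // rmorphM subrr.
have nzy : frac (y 0%N) != 0.
  rewrite tofrac_eq0; apply/eqP => /(congr1 (fun f : powser K => f 0%N))/eqP.
  by rewrite /y /= oner_eq0.
pose t (i : 'I_2) : dterm K 2 := if i == 0
  then TSum (index_iota 0 s.+1) (fun k => TMul (TConst b`_k) (iter k (@TDer K 2) (TVar 0)))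
  else TSub (TMul (TVar 0) (TVar 1)) (TConst 1).
have [|x Hx] := delta_closed_terms d_der d_closed (t := t).
  exists E, dE, iota, (fun i => if i == 0 then frac (y 0%N) else (frac (y 0%N))^-1).
  split=> // i; rewrite /t; case: ifP => _; last first.
    by rewrite teval_sub /= rmorph1 divff // subrr.
  rewrite teval_sum big_mkord -[RHS]solE; apply: eq_bigr => k _ /=.
  by rewrite teval_iter.
have := Hx 0; rewrite /t eqxx teval_sum big_mkord => H0.
have := Hx 1; rewrite /t /= => H1.
exists (x 0).
  apply/eqP => x0; move/eqP: H1; rewrite x0 mul0r add0r mulr1 oppr_eq0.
  by rewrite oner_eq0.
rewrite (@opd_wide s.+1) ?szbE // -[RHS]H0; apply: eq_bigr => k _ /=.
by rewrite teval_iter.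
Qed.

(** An element of minimal order generates the ideal, by division. *)
Lemma left_ideal_solution (J : {poly K} -> Prop) :
    (forall a b, J a -> J b -> J (a + b)) -> (forall c a, J a -> J (c *: a)) ->
    (forall a, J a -> J (dcomp a)) -> ~ J 1 ->
  exists2 y, y != 0 & forall b, J b -> opd b y = 0.
Proof.
move=> JD JZ Jd J1.
have [[b0 [Jb0 nzb0]]|all0] := classic (exists b, J b /\ b != 0); last first.
  exists 1 => [|b Jb]; first exact: oner_neq0.
  have [->|nzb] := eqVneq b 0; first exact: opd0.
  by case: all0; exists b.
have [b [Jb mon minb]] : exists b, [/\ J b, b \is monic &
    forall a, J a -> a != 0 -> (size b <= size a)%N].
  have [b [Jb nzb minb]] : exists b, [/\ J b, b != 0 &
      forall a, J a -> a != 0 -> (size b <= size a)%N].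
    have [n] := ubnP (size b0); elim: n b0 Jb0 nzb0 => // n IHn b Jb nzb ltb.
    have [[a [Ja nza lta]]|no] := classic (exists a, [/\ J a, a != 0 &
        (size a < size b)%N]).
      by apply: (IHn a) => //; apply: leq_trans lta _.
    exists b; split=> // a Ja nza; rewrite leqNgt; apply/negP => lta.
    by apply: no; exists a.
  have nzl : (lead_coef b)^-1 != 0 by rewrite invr_eq0 lead_coef_eq0.
  exists ((lead_coef b)^-1 *: b); split; first exact: (JZ).
    by rewrite monicE lead_coefZ mulVf // lead_coef_eq0.
  by move=> a Ja nza; rewrite size_scale // minb.
have Jiter j : J (iter j dcomp b) by elim: j => //= j IHj; apply: Jd.
have szb : (1 < size b)%N.
  rewrite ltnNge; apply/negP => le; apply: J1.
  have /eqP : size b == 1%N by rewrite eqn_leq le size_poly_gt0 monic_neq0.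
  move/eqP/size_poly1P => [c nzc bE].
  have -> : 1 = c^-1 *: b by rewrite bE -mul_polyC -polyCM mulVf.
  exact: JZ.
have [y nzy by0] := scalar_ode_solution mon szb; exists y => // a.
have [n] := ubnP (size a); elim: n a => // n IHn a lta Ja.
have [->|nza] := eqVneq a 0; first exact: opd0.
have leab := minb _ Ja nza.
pose j := (size a - size b)%N; pose c := iter j dcomp b.
have [monc szc] := iter_dcomp_monic j mon; rewrite -/c subnK // in monc szc.
have -> : a = (a - lead_coef a *: c) + lead_coef a *: c by rewrite subrK.
rewrite opdD opdZ opd_iter_dcomp by0 (iter_der0 d_der) mulr0 addr0.
apply: IHn; last by rewrite -scaleNr; apply: (JD) => //; apply: (JZ); apply: Jiter.
rewrite -ltnS; apply: leq_trans lta; rewrite ltnS.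
have sza : (0 < size a)%N by rewrite size_poly_gt0.
rewrite -(prednK sza) ltnS; apply/leq_sizeP => k lek.
rewrite coefB coefZ; have [->|nek] := eqVneq k (size a).-1.
  by rewrite -[X in c`_X.-1]szc -!lead_coefE (monicP monc) mulr1 subrr.
have ltk : (size a <= k)%N by rewrite -(prednK sza) ltn_neqAle eq_sym nek.
by rewrite !nth_default ?szc // mulr0 subrr.
Qed.

Definition oppair M (a : 'rV[{poly K}]_M) (X : 'rV[K]_M) : K :=
  \sum_i opd (a 0 i) (X 0 i).

Lemma oppairD M (a b : 'rV[{poly K}]_M) X :
  oppair (a + b) X = oppair a X + oppair b X.
Proof.
by rewrite /oppair -big_split; apply: eq_bigr => i _; rewrite mxE opdD.
Qed.

Lemma oppairZ M c (a : 'rV[{poly K}]_M) X :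
  oppair (c%:P *: a) X = c * oppair a X.
Proof.
by rewrite /oppair mulr_sumr; apply: eq_bigr => i _; rewrite mxE mul_polyC opdZ.
Qed.

Lemma oppair_dcomp M (a : 'rV[{poly K}]_M) X :
  oppair (map_mx dcomp a) X = d (oppair a X).
Proof.
by rewrite /oppair (der_sum d_der); apply: eq_bigr => i _; rewrite mxE opd_dcomp.
Qed.

Definition op_submodule M (N : 'rV[{poly K}]_M -> Prop) :=
  [/\ forall a b, N a -> N b -> N (a + b), forall c a, N a -> N (c%:P *: a) &
      forall a, N a -> N (map_mx dcomp a)].

(** Induction on M.  If some element of N has first component 1, the first unknown
    can be eliminated; otherwise the first components form a proper left ideal,
    whose solution is extended by zeros. *)
Theorem op_submodule_solution M (N : 'rV[{poly K}]_M -> Prop) i0 :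
    op_submodule N -> ~ N (delta_mx 0 i0) ->
  exists2 X : 'rV[K]_M, X != 0 & forall a, N a -> oppair a X = 0.
Proof.
elim: M N i0 => [|M IHM] N i0 [ND NZ Nd] Ni0; first by case: i0 Ni0.
pose J b := exists2 a, N a & a 0 0 = b.
have [|J1] := classic (J 1); last first.
  have [|||y nzy Hy] := left_ideal_solution _ _ _ J1.
  - move=> _ _ [a Na <-] [b Nb <-]; exists (a + b); rewrite ?mxE //.
    exact: (ND).
  - move=> c _ [a Na <-]; exists (c%:P *: a); rewrite ?mxE ?mul_polyC //.
    exact: (NZ).
  - move=> _ [a Na <-]; exists (map_mx dcomp a); rewrite ?mxE //.
    exact: (Nd).
  exists (y *: delta_mx 0 0).
    apply/eqP => /(congr1 (fun u : 'rV_M.+1 => u 0 0))/eqP.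
    by rewrite !mxE !eqxx mulr1 (negPf nzy).
  move=> a Na; rewrite /oppair big_ord_recl big1 ?addr0.
    by rewrite !mxE !eqxx mulr1; apply: Hy; exists a.
  by move=> i _; rewrite !mxE /= mulr0 opd_at0.
case=> s Ns s0.
pose ext (a : 'rV[{poly K}]_M) : 'rV[{poly K}]_(1 + M) := row_mx 0 a.
pose N1 a := N (ext a).
have hd0 : (0 : 'I_M.+1) = lshift M (0 : 'I_1) by apply: val_inj.
have extl a : ext a 0 0 = 0.
  by rewrite [X in ext a 0 X]hd0 row_mxEl mxE.
have extr a i : ext a 0 (lift ord0 i) = a 0 i.
  by rewrite -rshift1 row_mxEr.
have extD a b : ext (a + b) = ext a + ext b by rewrite /ext add_row_mx addr0.
have extZ c a : ext (c *: a) = c *: ext a by rewrite /ext scale_row_mx scaler0.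
have dcomp0 : dcomp 0 = 0.
  by apply/polyP => k; rewrite coef_dcomp !coef0 (der0 d_der) add0r; case: k => // k; rewrite coef0.
have extd a : ext (map_mx dcomp a) = map_mx dcomp (ext a).
  rewrite /ext map_row_mx; congr row_mx.
  by apply/rowP => i; rewrite !mxE dcomp0.
have N1_sub : op_submodule N1.
  split=> [a b|c a|a]; rewrite /N1 ?extD ?extZ ?extd; [exact: (ND)|exact: (NZ)|exact: (Nd)].
pose act (p : {poly K}) (a : 'rV[{poly K}]_M.+1) : 'rV[{poly K}]_M.+1 :=
  \sum_(k < size p) (p`_k)%:P *: iter k (map_mx dcomp) a.
have N0 : N 0 by rewrite -(scale0r s) -[0]polyC0; apply: (NZ).
have actN p a : N a -> N (act p a).
  move=> Na; apply: big_ind => // k _; apply: (NZ).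
  by elim: (k : nat) => //= j IHj; apply: (Nd).
have dcompXn k : dcomp 'X^k = 'X^(k.+1).
  apply/polyP => i; rewrite coef_dcomp !coefXn.
  have -> : d (i == k)%:R = 0 by case: eqP => _; rewrite ?(der0 d_der) ?(der1 d_der).
  by rewrite add0r; case: i => [|i]; rewrite ?coefXn.
have iter_coord k (a : 'rV[{poly K}]_M.+1) i :
    (iter k (map_mx dcomp) a) 0 i = iter k dcomp (a 0 i).
  by elim: k => //= k IHk; rewrite mxE IHk.
have iter1 k : iter k dcomp 1 = 'X^k.
  by elim: k => //= k ->.
have act1 p (a : 'rV[{poly K}]_M.+1) i : a 0 i = 1 -> act p a 0 i = p.
  move=> ai; rewrite /act summxE; under eq_bigr do rewrite mxE iter_coord ai iter1.
  by rewrite -[RHS]coefK poly_def; apply: eq_bigr => k _; rewrite mul_polyC.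
have act0 p (a : 'rV[{poly K}]_M.+1) i : a 0 i = 0 -> act p a 0 i = 0.
  move=> ai; rewrite /act summxE big1 // => k _; rewrite mxE iter_coord ai.
  have -> : iter k dcomp 0 = 0 by elim: (k : nat) => //= j ->.
  by rewrite mulr0.
have act_pair p a X : oppair (act p a) X = opd p (oppair a X).
  rewrite /act /opd.
  have pair0 : oppair (0 : 'rV[{poly K}]_M.+1) X = 0.
    by rewrite /oppair big1 // => i _; rewrite mxE opd0.
  rewrite (big_morph (fun b => oppair b X) (fun b c => oppairD b c X) pair0).
  apply: eq_bigr => k _; rewrite oppairZ; congr (_ * _).
  by elim: (k : nat) => //= j IHj; rewrite oppair_dcomp IHj.
have [X nzX HX] : exists2 X, X != 0 & forall a, N1 a -> oppair a X = 0.
  have [[j Nj]|no] := classic (exists j, ~ N1 (delta_mx 0 j)).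
    exact: IHM N1_sub Nj.
  exfalso; apply: Ni0.
  have Ne j : N (delta_mx 0 (lift ord0 j)).
    have : N1 (delta_mx 0 j) by apply: NNPP => Nj; apply: no; exists j.
    rewrite /N1; congr N; apply/rowP => i; case: (unliftP 0 i) => [l|] ->.
      by rewrite extr !mxE !eqxx /= (inj_eq lift_inj).
    by rewrite extl mxE.
  case: (unliftP 0 i0) => [j|] -> //.
  have -> : delta_mx 0 0 =
      s + \sum_j act (- s 0 (lift ord0 j)) (delta_mx 0 (lift ord0 j)).
    apply/rowP => i; rewrite !mxE summxE /=; case: (unliftP 0 i) => [l|] ->.
      rewrite (bigD1 l) //= act1 ?mxE ?eqxx // big1 ?addr0 ?subrr // => j ne.
      by apply: act0; rewrite mxE eqxx (inj_eq lift_inj) eq_sym (negPf ne).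
    by rewrite s0 big1 ?addr0 // => j _; apply: act0; rewrite mxE.
  by apply: (ND) => //; apply: big_ind => // j _; apply: actN.
pose X0 := - \sum_i opd (s 0 (lift ord0 i)) (X 0 i).
pose Y : 'rV[K]_(1 + M) := row_mx X0%:M X.
have Y0 : Y 0 0 = X0.
  by rewrite [X in Y 0 X]hd0 row_mxEl mxE eqxx.
have Yr i : Y 0 (lift ord0 i) = X 0 i by rewrite -rshift1 row_mxEr.
have pairY (a : 'rV[{poly K}]_M.+1) :
    oppair a Y = opd (a 0 0) X0 + \sum_i opd (a 0 (lift ord0 i)) (X 0 i).
  by rewrite /oppair big_ord_recl Y0; congr (_ + _); apply: eq_bigr => i _; rewrite Yr.
have sY : oppair s Y = 0.
  by rewrite pairY s0 opd1 addNr.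
exists Y.
  apply: contraNneq nzX => eqY; apply/eqP/rowP => i.
  by rewrite -Yr eqY !mxE.
move=> a Na; rewrite -[a](subrK (act (a 0 0) s)) oppairD act_pair sY opd_at0 addr0.
pose b := \row_i (a - act (a 0 0) s) 0 (lift ord0 i).
have eb : a - act (a 0 0) s = ext b.
  apply/rowP => i; case: (unliftP 0 i) => [l|] ->; first by rewrite extr !mxE.
  by rewrite extl !mxE act1 // subrr.
have Nb : N1 b.
  rewrite /N1 -eb -scaleN1r -(polyCN 1); apply: (ND) => //.
  by apply: (NZ); apply: actN.
rewrite eb pairY extl opd0 add0r -[RHS](HX b Nb).
by apply: eq_bigr => i _; rewrite extr.
Qed.

End LinearSystems.

(** * Spectra and interpolation *)

Section Spectrum.

Variable K : fieldType.
Hypothesis closedK : alg_closed K.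

Lemma trigonalizable_closed n (A : 'M[K]_n) :
  exists2 V : 'M[K]_n, V \in unitmx & is_trig_mx (V *m A *m invmx V).
Proof.
elim: n A => [|n IHn] A.
  by exists 1%:M; [exact: unitmx1|apply/is_trig_mxP => -[]].
have [|a] := closedK (p := char_poly A); first by rewrite size_char_poly.
rewrite -eigenvalue_root_char => /eigenvalueP[u uA nzu].
pose V : 'M[K]_(1 + n) := row_ebase u; have Vu : V \in unitmx by exact: row_ebase_unit.
have rku : \rank u = 1%N by apply/eqP; rewrite eqn_leq rank_leq_row lt0n mxrank_eq0.
pose c := col_ebase u 0 0.
have uV : u = c *: row 0 V.
  rewrite -[LHS]mulmx_ebase rku [col_ebase u]mx11_scalar -/c mul_scalar_mx -scalemxAl.
  by congr (_ *: _); apply/rowP => j; rewrite !mxE big_ord_recl big1 ?addr0 => [|i _];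
    rewrite !mxE ?mul1r ?mul0r.
have nzc : c != 0 by apply: contraNneq nzu => c0; rewrite uV c0 scale0r.
have VA : row 0 V *m A = a *: row 0 V.
  by apply: (scalerI nzc); rewrite scalemxAl -uV uA uV scalerA mulrC -scalerA.
pose B : 'M[K]_(1 + n) := V *m A *m invmx V.
have Bur : ursubmx B = 0.
  have B0 : row 0 B = a *: delta_mx 0 0.
    rewrite /B !row_mul VA -scalemxAl -row_mul mulmxV //.
    by rewrite row1.
  apply/rowP => j; have := congr1 (fun r : 'rV_(1 + n) => r 0 (rshift 1 j)) B0.
  rewrite !mxE; have -> : lshift n 0 = 0 :> 'I_(1 + n) by apply: val_inj.
  by move=> ->; rewrite mulr0.
have [V' V'u trigV'] := IHn (drsubmx B).
pose D : 'M[K]_(1 + n) := block_mx 1%:M 0 0 V'.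
have Du : D \in unitmx by rewrite unitmxE det_ublock det1 mul1r -unitmxE.
exists (D *m V); first by rewrite unitmx_mul Du Vu.
have invD : invmx D = block_mx 1%:M 0 0 (invmx V').
  rewrite -[RHS](mulKmx Du) mulmx_block.
  by rewrite !mul1mx !mul0mx !mulmx0 !add0r !addr0 mulmxV // -scalar_mx_block mulmx1.
have -> : D *m V *m A *m invmx (D *m V) = D *m B *m invmx D.
  rewrite /B; have -> : invmx (D *m V) = invmx V *m invmx D.
    have DVu : D *m V \in unitmx by rewrite unitmx_mul Du Vu.
    have E : D *m V *m (invmx V *m invmx D) = 1%:M.
      by rewrite mulmxA -(mulmxA D) mulmxV // mulmx1 mulmxV.
    by rewrite -[RHS](mulKmx DVu) E mulmx1.
  by rewrite !mulmxA.
rewrite -(submxK B) Bur invD !mulmx_block.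
rewrite !(mul1mx, mul0mx, mulmx0, mulmx1, add0r, addr0).
have /(_ erefl) trigE := @is_trig_block_mx K 1 n 1 n (ulsubmx B) 0
  (V' *m dlsubmx B) (V' *m drsubmx B *m invmx V').
by apply: etrans trigE _; rewrite eqxx mx11_is_trig.
Qed.

Lemma trig_mulmx n (A B : 'M[K]_n) : is_trig_mx A -> is_trig_mx B ->
  is_trig_mx (A *m B) /\ forall i, (A *m B) i i = A i i * B i i.
Proof.
move=> /is_trig_mxP tA /is_trig_mxP tB; split=> [|i].
  apply/is_trig_mxP => i j ltij; rewrite mxE big1 // => l _.
  have [ltil|leli] := ltnP i l; first by rewrite tA // mul0r.
  by rewrite tB ?mulr0 // (leq_ltn_trans leli).
rewrite mxE (bigD1 i) //= big1 ?addr0 // => l; rewrite -val_eqE /= => ne.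
have [ltil|leli] := ltnP i l; first by rewrite tA // mul0r.
by rewrite tB ?mulr0 // ltn_neqAle ne.
Qed.

Lemma trig_horner n (A : 'M[K]_n.+1) p : is_trig_mx A ->
  is_trig_mx (horner_mx A p) /\ forall i, (horner_mx A p) i i = p.[A i i].
Proof.
move=> tA; elim/poly_ind: p => [|p c [tp dp]].
  by rewrite rmorph0; split=> [|i]; [exact: mx0_is_trig|rewrite mxE horner0].
rewrite rmorphD rmorphM /= horner_mx_X horner_mx_C.
have [/is_trig_mxP tpA dpA] := trig_mulmx tp tA; split=> [|i].
  apply/is_trig_mxP => i j ltij; rewrite mxE tpA // add0r mxE -val_eqE.
  by rewrite ltn_eqF.
by rewrite mxE dpA dp mxE eqxx hornerMXaddC.
Qed.

(** Read off a triangular form; rs lists the eigenvalues with multiplicity. *)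
Lemma spectrum n (A : 'M[K]_n.+1) : exists rs : seq K,
  [/\ size rs = n.+1, forall p, \tr (horner_mx A p) = \sum_(r <- rs) p.[r],
      horner_mx A (\prod_(r <- rs) ('X - r%:P)) = 0 &
      forall p, horner_mx A p = 0 -> forall r, r \in rs -> root p r].
Proof.
have [V Vu trigA] := trigonalizable_closed A; set T := V *m A *m invmx V in trigA.
have hT p : horner_mx T p = V *m horner_mx A p *m invmx V by apply: horner_mx_uconj.
have hA p : horner_mx A p = invmx V *m horner_mx T p *m V.
  by rewrite hT !mulmxA mulVmx // mul1mx -mulmxA mulVmx // mulmx1.
exists [seq T i i | i <- enum 'I_n.+1]; split.
- by rewrite size_map size_enum_ord.
- move=> p; rewrite hA mxtrace_mulC mulmxA mulmxV // mul1mx big_map big_enum.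
  by apply: eq_bigr => i _; case: (trig_horner p trigA).
- rewrite big_map big_enum /= -(char_poly_trig trigA) hA.
  by rewrite Cayley_Hamilton mulmx0 mul0mx.
- move=> p pA _ /mapP[i _ ->]; have [_ dp] := trig_horner p trigA.
  by apply/rootP; rewrite -dp hT pA mulmx0 mul0mx mxE.
Qed.

Lemma nilpotent_trace0 n (A : 'M[K]_n.+1) m : A ^+ m = 0 -> \tr A = 0.
Proof.
move=> Am; have [rs [_ trA _ rootA]] := spectrum A.
rewrite -[A]horner_mx_X trA big_seq big1 // => r /rootA rr.
have /rr : horner_mx A 'X^m = 0 by rewrite rmorphXn /= horner_mx_X.
rewrite rootE hornerXn expf_eq0 => /andP[_ /eqP->].
by rewrite hornerX.
Qed.

Lemma interpolation (s : seq K) (tgt : K -> K) E : uniq s ->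
  exists Q, forall a, a \in s -> ('X - a%:P) ^+ E %| Q - (tgt a)%:P.
Proof.
elim: s => [|a s IHs] /=; first by exists 0.
case/andP=> nsa /IHs[Q HQ]; pose W := \prod_(b <- s) ('X - b%:P) ^+ E.
have cop : coprimep W (('X - a%:P) ^+ E).
  rewrite coprimep_expr // /W big_seq; apply: (big_ind (fun p => coprimep p _)).
  - exact: coprime1p.
  - by move=> p q cp cq; rewrite coprimepMl cp cq.
  - move=> b sb; rewrite coprimep_expl // coprimep_XsubC rootE !hornerE subr_eq0.
    by apply: contraNneq nsa => ->.
have [[u v] /= uv] := Bezout_eq1_coprimepP _ _ cop.
exists (Q + W * (u * ((tgt a)%:P - Q))) => b; rewrite inE => /orP[/eqP->|sb].
  have -> : Q + W * (u * ((tgt a)%:P - Q)) - (tgt a)%:P =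
      (u * W - 1) * ((tgt a)%:P - Q) by ring.
  by rewrite -uv opprD addrA subrr sub0r dvdp_mulr // dvdpNr dvdp_mull.
rewrite addrAC dvdp_addl ?HQ // dvdp_mulr // /W (big_rem b) //=.
by rewrite dvdp_mulr.
Qed.

Hypothesis char0 : [pchar K] =i pred0.

Lemma intr_eq0_char0 (n : int) : (n%:~R == 0 :> K) = (n == 0).
Proof.
case: n => n; first by rewrite -pmulrn (proj1 (pcharf0P K) char0).
by rewrite NegzE mulrNz !oppr_eq0 -pmulrn (proj1 (pcharf0P K) char0).
Qed.

(** The assignment ls_i |-> fs_i extends to a homomorphism from the additive group
    generated by ls to the integers. *)
Definition compatible (ls : seq K) (fs : nat -> int) :=
  forall ns : nat -> int, \sum_(i < size ls) ls`_i *~ ns i = 0 ->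
    \sum_(i < size ls) fs i * ns i = 0.

(** The subgroup of (K, +) generated by a and ls is free of finite rank, so that
    some homomorphism to the integers is nonzero at a.  It is built by extending
    one generator at a time, multiplying by an integer when the new generator is
    dependent on the previous ones. *)
Lemma compatible_head a ls : a != 0 ->
  exists2 fs, compatible (a :: ls) fs & fs 0%N != 0.
Proof.
move=> nza; elim/last_ind: ls => [|ls b [fs Hfs nzf]].
  exists (fun=> 1) => // ns; rewrite !big_ord1 /= mul1r.
  by rewrite -mulrzl => /eqP; rewrite mulf_eq0 (negPf nza) orbF intr_eq0_char0 => /eqP.
rewrite -rcons_cons; have l1_gt0 : (0 < size (a :: ls))%N by [].
move: (a :: ls) l1_gt0 Hfs => l1 l1_gt0 Hfs.
have sumE (ns : nat -> int) : \sum_(i < size (rcons l1 b)) (rcons l1 b)`_i *~ ns i =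
    \sum_(i < size l1) l1`_i *~ ns i + b *~ ns (size l1).
  rewrite size_rcons big_ord_recr /= nth_rcons ltnn eqxx; congr (_ + _).
  by apply: eq_bigr => i _; rewrite nth_rcons ltn_ord.
have [[N [ms [nzN HN]]]|indep] := classic (exists (N : int) (ms : nat -> int),
    N != 0 /\ b *~ N = \sum_(i < size l1) l1`_i *~ ms i); last first.
  exists (fun i => if (i < size l1)%N then fs i else 0); last by rewrite l1_gt0.
  move=> ns; rewrite sumE => Hns; rewrite size_rcons big_ord_recr /= ltnn mul0r addr0.
  have ns0 : ns (size l1) = 0.
    apply/eqP/negPn/negP => nzs; apply: indep; exists (ns (size l1)), (fun i => - ns i).
    split=> //; under eq_bigr do rewrite mulrNz.
    by apply/eqP; rewrite sumrN -addr_eq0 addrC Hns.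
  rewrite ns0 mulr0z addr0 in Hns; rewrite -[RHS](Hfs _ Hns).
  by apply: eq_bigr => i _; rewrite ltn_ord.
exists (fun i => if (i < size l1)%N then N * fs i
                 else \sum_(j < size l1) fs j * ms j); last by rewrite l1_gt0 mulf_neq0.
move=> ns; rewrite sumE => Hns; rewrite size_rcons big_ord_recr /= ltnn.
rewrite mulr_suml -big_split /= -[RHS](Hfs (fun i => N * ns i + ns (size l1) * ms i)).
  by apply: eq_bigr => i _; rewrite ltn_ord /=; ring.
under eq_bigr do rewrite mulrzDr.
rewrite big_split /=.
have -> : \sum_(i < size l1) l1`_i *~ (N * ns i) = (\sum_(i < size l1) l1`_i *~ ns i) *~ N.
  by rewrite mulrz_suml; apply: eq_bigr => i _; rewrite -mulrzA mulrC.
have -> : \sum_(i < size l1) l1`_i *~ (ns (size l1) * ms i) =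
    (\sum_(i < size l1) l1`_i *~ ms i) *~ ns (size l1).
  by rewrite mulrz_suml; apply: eq_bigr => i _; rewrite -mulrzA mulrC.
by rewrite -HN -mulrzA [N * _]mulrC mulrzA -mulrzDl Hns mul0rz.
Qed.

Lemma compatible_nonzero ls i0 : ls`_i0 != 0 -> (i0 < size ls)%N ->
  exists2 fs, compatible ls fs & fs i0 != 0.
Proof.
move=> nza lti0; have [fs Hfs nzf] := compatible_head ls nza.
have fs0 : fs 0%N = fs i0.+1.
  have := Hfs (fun i => (i == 0%N)%:R - (i == i0.+1)%:R).
  have E (R : zmodType) (g : nat -> int -> R) : (forall i, g i 0 = 0) ->
      (forall i, g i (-1) = - g i 1) ->
      \sum_(i < size (ls`_i0 :: ls)) g i ((i == 0%N :> nat)%:R - (i == i0.+1 :> nat)%:R) =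
      g 0%N 1 - g i0.+1 1.
    move=> g0 gN; rewrite big_ord_recl /= subr0; congr (_ + _).
    rewrite (bigD1 (Ordinal lti0)) //= /bump /= add1n eqxx sub0r gN big1 ?addr0 //.
    by move=> i; rewrite -val_eqE /= => /negPf ne; rewrite add1n eqSS ne subrr.
  rewrite (E _ (fun i n => (ls`_i0 :: ls)`_i *~ n)) => [|i|i]; last 2 first.
  - by rewrite mulr0z.
  - by rewrite mulrNz.
  rewrite (E _ (fun i n => fs i * n)) => [|i|i]; last 2 first.
  - by rewrite mulr0.
  - by rewrite mulrN.
  rewrite /= !mulr1z subrr !mulr1 => /(_ erefl)/eqP.
  by rewrite subr_eq0 => /eqP.
exists (fun i => fs i.+1); last by rewrite -fs0.
move=> ns Hns; have := Hfs (fun i => if i is i'.+1 then ns i' else 0).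
by rewrite !big_ord_recl /= mulr0z mulr0 !add0r => H; apply: H.
Qed.

End Spectrum.

(** * Engel's theorem and nondegeneracy of trace forms *)

Section Engel.

Variables (K : fieldType) (v : nat).
Local Notation mat := 'M[K]_v.
Implicit Types (L M : {vspace mat}) (u : 'rV[K]_v).

Fixpoint killed L (k : nat) (u : 'rV[K]_v) : Prop :=
  if k is k'.+1 then forall x, x \in L -> killed L k' (u *m x) else u = 0.

Arguments killed : simpl never.

Definition nilpotent_space L := exists k, forall u, killed L k u.

Definition bracket_closed L :=
  forall x y, x \in L -> y \in L -> x *m y - y *m x \in L.

Lemma killed0 L k : killed L k 0.
Proof. by elim: k => // k IHk x _; rewrite mul0mx. Qed.

Lemma killed_lin L k a u w : killed L k u -> killed L k w -> killed L k (a *: u + w).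
Proof.
elim: k u w => [|k IHk] u w; first by move=> -> ->; rewrite scaler0 addr0.
by move=> Hu Hw x Lx; rewrite mulmxDl -scalemxAl; apply: IHk; [apply: Hu|apply: Hw].
Qed.

Lemma killedB L k u w : killed L k u -> killed L k w -> killed L k (u - w).
Proof.
by move=> Hu Hw; rewrite addrC -scaleN1r; apply: killed_lin.
Qed.

Lemma killedS L k u : killed L k u -> killed L k.+1 u.
Proof.
elim: k u => [|k IHk] u; first by move=> -> x _; rewrite mul0mx.
by move=> Hu x Lx; apply: IHk; apply: Hu.
Qed.

Lemma killed_mono L k l u : (k <= l)%N -> killed L k u -> killed L l u.
Proof.
by move=> /subnK <-; elim: (l - k)%N => // j IHj /IHj /killedS.
Qed.

(** u Z x = (u x) Z - u [x, Z], where [x, Z] lies in L again, so that a normalizing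
    Z preserves the filtration by killed. *)
Lemma killed_normal L Z k u :
  (forall x, x \in L -> x *m Z - Z *m x \in L) -> killed L k u -> killed L k (u *m Z).
Proof.
move=> norm; elim: k u => [|k IHk] u; first by move=> ->; rewrite mul0mx.
move=> Hu x Lx; have -> : u *m Z *m x = (u *m x) *m Z - u *m (x *m Z - Z *m x).
  by rewrite mulmxBr !mulmxA opprB addrCA subrr addr0.
by apply: killedB; [apply: IHk; apply: Hu|apply: Hu; apply: norm].
Qed.

Section Extend.

Variables (L M : {vspace mat}).
Hypotheses (brL : bracket_closed L) (sML : (M <= L)%VS) (brM : bracket_closed M).
Hypothesis nilM : nilpotent_space M.
Hypothesis nilL : forall x, x \in L -> exists m, forall u, u *m iter m (mulmx x) 1%:M = 0.

(** Each bracket with an element of M lets Y move a row one step further down the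
    filtration by killed, so that an iterated bracket of length 2 k vanishes.
    Hence some iterated bracket outside M has all its brackets with M in M. *)
Lemma normalizer_escape Y : Y \in L -> Y \notin M ->
  exists Z, [/\ Z \in L, Z \notin M & forall x, x \in M -> x *m Z - Z *m x \in M].
Proof.
move=> LY MY; have [k Hk] := nilM; apply: NNPP => no.
have chain s : exists Z, [/\ Z \in L, Z \notin M &
    forall j u, killed M j u -> killed M (j + k - s) (u *m Z)].
  elim: s => [|s [Z [LZ MZ degZ]]].
    exists Y; split=> // j u _; rewrite subn0.
    by apply: killed_mono (Hk _); rewrite leq_addl.
  have [x [Mx MxZ]] : exists x, x \in M /\ x *m Z - Z *m x \notin M.
    apply: NNPP => nox; apply: no; exists Z; split=> // x Mx.
    by apply/negPn/negP => nin; apply: nox; exists x.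
  exists (x *m Z - Z *m x); split=> //.
    by apply: brL => //; apply: (subvP sML).
  move=> [|j] u Hu; first by rewrite Hu mul0mx; apply: killed0.
  rewrite mulmxBr !mulmxA; apply: killedB.
    by rewrite addSn subSS; apply: degZ; apply: Hu.
  have := degZ _ _ Hu; rewrite addSn subSS.
  have [les|lts] := leqP s (j + k); first by rewrite subSn // => H; apply: H.
  have -> : ((j + k).+1 - s = 0)%N by apply/eqP; rewrite subn_eq0.
  by move=> ->; rewrite mul0mx; apply: killed0.
have [Z [_ /negP MZ degZ]] := chain (k + k)%N; apply: MZ.
suff -> : Z = 0 by rewrite mem0v.
apply/row_matrixP => i; rewrite row0 rowE.
by have := degZ k _ (Hk (delta_mx 0 i)); rewrite subnn.
Qed.

(** The word length needed to kill a row is bounded by a double induction: elements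
    of M lower the level of the row for M, and Z preserves it but can be applied
    only q times. *)
Lemma nilpotent_extend Z : Z \in L ->
    (forall x, x \in M -> x *m Z - Z *m x \in M) ->
  nilpotent_space (M + <[Z]>)%VS /\ bracket_closed (M + <[Z]>)%VS.
Proof.
move=> LZ norm; split; last first.
  move=> _ _ /memv_addP[x Mx [_ /vlineP[a ->] ->]] /memv_addP[y My [_ /vlineP[b ->] ->]].
  apply: (subvP (addvSl M <[Z]>%VS)).
  have -> : (x + a *: Z) *m (y + b *: Z) - (y + b *: Z) *m (x + a *: Z) =
      (x *m y - y *m x) + b *: (x *m Z - Z *m x) - a *: (y *m Z - Z *m y).
    rewrite !mulmxDl !mulmxDr -!scalemxAl -!scalemxAr !scalerBr !scalerA [b * a]mulrC.
    move: (x *m y) (y *m x) (b *: _) (b *: _) (a *: _) (a *: _) ((a * b) *: _).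
    by move=> p q r s t w z; apply/matrixP => i j; rewrite !mxE; ring.
  apply: memvB; last by apply: memvZ; apply: norm.
  by apply: memvD; [apply: brM|apply: memvZ; apply: norm].
have [q Hq] := nilL LZ; have [k Hk] := nilM.
have Zpow i u : u *m Z *m iter i (mulmx Z) 1%:M = u *m iter i.+1 (mulmx Z) 1%:M.
  by rewrite -mulmxA.
have main j : forall i u, killed M j.+1 u -> u *m iter i (mulmx Z) 1%:M = 0 ->
    killed (M + <[Z]>)%VS (j * q + i) u.
  elim: j => [|j IHj]; elim=> [|i IHi] u Hu Hi.
  - by move: Hi; rewrite mulmx1 => ->; apply: killed0.
  - rewrite addnS => _ /memv_addP[x Mx [_ /vlineP[a ->] ->]].
    rewrite mulmxDr -scalemxAr addrC; apply: killed_lin.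
      by apply: IHi; [apply: killed_normal|rewrite Zpow].
    by rewrite (Hu x Mx : u *m x = 0); apply: killed0.
  - by move: Hi; rewrite mulmx1 => ->; apply: killed0.
  - rewrite addnS => _ /memv_addP[x Mx [_ /vlineP[a ->] ->]].
    rewrite mulmxDr -scalemxAr addrC; apply: killed_lin.
      by apply: IHi; [apply: killed_normal|rewrite Zpow].
    apply: (@killed_mono _ (j * q + q)); first by rewrite mulSn addnC leq_addr.
    by apply: IHj => //; apply: Hu.
by exists (k * q + q)%N => u; apply: main.
Qed.

End Extend.

(** A subspace of L that is closed under brackets, nilpotent and proper can be
    enlarged by one dimension. *)
Theorem engel L : bracket_closed L ->
    (forall x, x \in L -> exists m, forall u, u *m iter m (mulmx x) 1%:M = 0) ->
  nilpotent_space L.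
Proof.
move=> brL nilL.
have grow n : exists M, [/\ (M <= L)%VS, bracket_closed M, nilpotent_space M &
    (n <= \dim M)%N \/ M = L].
  elim: n => [|n [M [sML brM nilM]]].
    exists 0%VS; split; [exact: sub0v| |exists 1%N|by left].
      by move=> x y; rewrite !memv0 => /eqP-> /eqP->; rewrite mulmx0 subrr.
    by move=> u x; rewrite memv0 => /eqP->; rewrite mulmx0.
  case=> [leM|eqM]; last by exists M; split=> //; right.
  have [sLM|] := boolP (L <= M)%VS.
    by exists M; split=> //; right; apply/eqP; rewrite eqEsubv sML.
  case/subvPn => Y LY MY.
  have [Z [LZ MZ norm]] := normalizer_escape brL sML nilM LY MY.
  have [nil' br'] := nilpotent_extend brM nilM nilL LZ norm.
  exists (M + <[Z]>)%VS; split=> //.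
    by rewrite subv_add sML -memvE.
  left; apply: leq_ltn_trans leM _; rewrite ltnNge; apply: contra MZ => le.
  have /eqP-> : M == (M + <[Z]>)%VS by rewrite eqEdim addvSl.
  by apply: (subvP (addvSr _ _)); rewrite memv_line.
have [M [sML _ nilM [leM|<- //]]] := grow (\dim L).
by have /eqP<- : M == L by rewrite eqEdim sML.
Qed.

(** Apply elements of L to a nonzero row of C as long as the result is nonzero. *)
Lemma killed_vector L (C : 'M[K]_v) : nilpotent_space L ->
    (forall u x, (u <= C)%MS -> x \in L -> (u *m x <= C)%MS) -> C != 0 ->
  exists u, [/\ u != 0, (u <= C)%MS & forall x, x \in L -> u *m x = 0].
Proof.
move=> [k Hk] Cstab /rowV0Pn[u0 Cu0 nzu0].
move: (Hk u0) => {Hk}; elim: k u0 Cu0 nzu0 => [|k IHk] u Cu nzu.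
  by move=> u0; rewrite u0 eqxx in nzu.
move=> Hu; have [[x [Lx nzux]]|no] := classic (exists x, x \in L /\ u *m x != 0).
  by apply: (IHk (u *m x)); [exact: Cstab|exact: nzux|exact: Hu].
exists u; split=> // x Lx; apply/eqP/negPn/negP => nzux.
by apply: no; exists x.
Qed.

End Engel.

(** * Conjugation-stable spaces of matrices over a semisimple group *)

Section SemisimpleGroup.

Variables (K : fieldType) (v : nat).
Local Notation mat := 'M[K]_v.
Variable G : mat -> Prop.

Definition stable_row (U : mat) := forall g, G g -> (U *m g <= U)%MS.

Definition semisimple_rows := forall U : mat, stable_row U ->
  exists U' : mat, [/\ stable_row U', row_full (U + U')%MS & (U :&: U' = 0)%MS].

(** Membership in the linear span of G, by duality for the trace pairing. *)
Definition in_span (X : mat) :=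
  forall L : mat, (forall g, G g -> \tr (g *m L) = 0) -> \tr (X *m L) = 0.

Definition conj_stable (h : {vspace mat}) :=
  forall g X, G g -> X \in h -> invmx g *m X *m g \in h.

Lemma mxtrace_delta (X : mat) i j : \tr (X *m delta_mx j i) = X i j.
Proof.
rewrite mxtrace_mulC /mxtrace (bigD1 j) //= mxE (bigD1 i) //= mxE !eqxx mul1r.
rewrite !big1 ?addr0 // => [l /negPf ne|l /negPf ne].
  by rewrite mxE big1 // => m _; rewrite mxE ne mul0r.
by rewrite mxE eqxx ne mul0r.
Qed.

Lemma in_span_comm X P : in_span X -> (forall g, G g -> g *m P = P *m g) ->
  X *m P = P *m X.
Proof.
move=> spanX commP; apply/eqP; rewrite -subr_eq0; apply/eqP/matrixP => i j.
have trE Y : (Y *m P - P *m Y) i j =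
    \tr (Y *m (P *m delta_mx j i - delta_mx j i *m P)).
  rewrite mulmxBr linearB /= !mulmxA mxtrace_delta.
  by rewrite mxtrace_mulC mulmxA mxtrace_delta !mxE.
rewrite trE [RHS]mxE; apply: spanX => g Gg.
by rewrite -trE commP // subrr mxE.
Qed.

Lemma in_span_stable X (C : mat) : in_span X -> stable_row C -> (C *m X <= C)%MS.
Proof.
move=> spanX stC; rewrite submxE; apply/eqP/matrixP => i j.
have trE Y : (C *m Y *m cokermx C) i j =
    \tr (Y *m (cokermx C *m delta_mx j i *m C)).
  by rewrite -mxtrace_delta -!mulmxA mxtrace_mulC !mulmxA.
rewrite trE [RHS]mxE; apply: spanX => g Gg; rewrite -trE.
by have := stC g Gg; rewrite submxE => /eqP->; rewrite mxE.
Qed.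

Hypothesis G_unit : forall g, G g -> g \in unitmx.
Hypothesis G_inv : forall g, G g -> G (invmx g).
Hypothesis ss : semisimple_rows.

(** By Engel's theorem every nonzero submodule contains a nonzero vector killed by
    m.  The common kernel of m is a submodule, because m is stable under
    conjugation, and its complement must therefore vanish.  The projection P on a
    submodule allows the same for the restriction to a submodule. *)
Lemma nilpotent_ideal_zero (m : {vspace mat}) (P : mat) :
    P *m P = P -> (forall g, G g -> g *m P = P *m g) ->
    (forall Y, Y \in m -> exists2 X, in_span X & Y = P *m X) ->
    conj_stable m -> bracket_closed m ->
    (forall Y, Y \in m -> exists k, forall u : 'rV_v, u *m iter k (mulmx Y) 1%:M = 0) ->
  forall Y, Y \in m -> Y = 0.
Proof.
move=> PP commP mP conj_m br_m nil_m.
have nilm := engel br_m nil_m.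
have [|a u w Hu Hw|B BP] := @submx_of_pred _ _
    (fun u : 'rV[K]_v => forall Y, Y \in m -> u *m Y = 0).
- by move=> Y _; rewrite mul0mx.
- by move=> Y mY; rewrite mulmxDl -scalemxAl Hu // Hw // scaler0 addr0.
have rowsub (U W : mat) : (forall u : 'rV_v, (u <= U)%MS -> (u <= W)%MS) -> (U <= W)%MS.
  by move=> H; apply/row_subP => i; apply: H; apply: row_sub.
have stB : stable_row B.
  move=> g Gg; apply: rowsub => u /submxP[D ->]; rewrite mulmxA.
  have DB : (D *m B <= B)%MS by apply: submxMl.
  apply/BP => Y mY.
  have conjY : g *m Y *m invmx g \in m.
    by have := conj_m _ _ (G_inv Gg) mY; rewrite invmxK.
  move/BP: DB => /(_ _ conjY) /(congr1 (mulmx^~ g)).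
  by rewrite !mulmxA mul0mx mulmxKV ?G_unit.
have stP : stable_row P by move=> g Gg; rewrite -commP // submxMl.
have stI U W : stable_row U -> stable_row W -> stable_row (U :&: W)%MS.
  move=> stU stW g Gg; rewrite sub_capmx.
  by rewrite !(submx_trans _ (stU g Gg), submx_trans _ (stW g Gg)) // submxMr // (capmxSl, capmxSr).
have [C [stC fullC capC]] := ss (stI _ _ stB stP).
pose C' : mat := (C :&: P)%MS.
have Pid (u : 'rV_v) : (u <= P)%MS -> u *m P = u by case/submxP => D ->; rewrite -mulmxA PP.
have C'0 : C' = 0.
  apply/eqP/negPn/negP => nzC'.
  have [|u [nzu Cu Hu]] := killed_vector nilm _ nzC'.
    move=> u Y; rewrite sub_capmx => /andP[uC uP] mY.
    have [X spX ->] := mP Y mY; have XP := in_span_comm spX commP.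
    rewrite mulmxA Pid // sub_capmx.
    rewrite (submx_trans (submxMr X uC)) ?in_span_stable //=.
    by rewrite -[u in u *m X]Pid // -mulmxA -XP mulmxA submxMl.
  move: Cu; rewrite sub_capmx => /andP[uC uP].
  case/negP: nzu; rewrite -submx0 -capC !sub_capmx uP uC !andbT.
  by apply/BP.
have PB : (P <= B)%MS.
  have sW : (B :&: P <= P)%MS by exact: capmxSr.
  have modl := matrix_modl C sW; rewrite -/C' C'0 in modl.
  have : (P <= (B :&: P + C) :&: P)%MS by rewrite sub_capmx submx_refl submx_full // addsmxC.
  by rewrite -modl addsmx0 => /submx_trans; apply; apply: capmxSl.
move=> Y mY; have [X spX eY] := mP Y mY.
suff : P *m Y = 0 by rewrite eY mulmxA PP.
apply/row_matrixP => i; rewrite row_mul row0.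
by have /BP := submx_trans (row_sub i P) PB; apply.
Qed.

End SemisimpleGroup.

Section TraceForms.

Variables (K : fieldType) (v : nat).
Hypothesis closedK : alg_closed K.
Hypothesis char0 : [pchar K] =i pred0.
Local Notation mat := 'M[K]_v.+1.

(** The property of Lie algebras of algebraic groups on which Cartan's criterion
    rests: with X they contain the replicas of X, the polynomials in X that take
    on the eigenvalues the values of a homomorphism from the additive group these
    generate to the integers. *)
Definition replica_closed (h : {vspace mat}) :=
  forall X, X \in h -> exists ls : seq K,
    horner_mx X (\prod_(l <- ls) ('X - l%:P)) = 0 /\
    forall fs, compatible ls fs -> exists q : {poly K},
      (forall i, (i < size ls)%N -> q.[ls`_i] = (fs i)%:~R) /\ horner_mx X q \in h.

Lemma horner_mx_proj (P X : mat) p : P * P = P -> P * X = X * P ->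
  P * horner_mx (P * X) p = P * horner_mx X p.
Proof.
move=> PP PX; elim/poly_ind: p => [|p c IHp]; first by rewrite !rmorph0.
rewrite !rmorphD !rmorphM /= !horner_mx_X !horner_mx_C !mulrDr; congr (_ + _).
have comm_h : P * horner_mx X p = horner_mx X p * P.
  by apply: comm_mx_horner.
by rewrite mulrA IHp [in RHS]mulrA comm_h mulrA -(mulrA _ P P) PP.
Qed.

Lemma all_eigenvalues_zero (A : mat) (rs : seq K) :
    horner_mx A (\prod_(r <- rs) ('X - r%:P)) = 0 -> (forall r, r \in rs -> r = 0) ->
  A ^+ size rs = 0.
Proof.
move=> Ars rs0; rewrite -[RHS]Ars -[A in LHS]horner_mx_X -rmorphXn; congr (horner_mx A _).
rewrite big_seq (eq_bigr (fun=> 'X)) => [|r /rs0 ->]; last by rewrite subr0.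
by rewrite -big_seq big_const_seq count_predT iter_mulr mulr1.
Qed.

Lemma iter_mulmx_exp (A : mat) m : iter m (mulmx A) 1%:M = A ^+ m.
Proof. by elim: m => //= m ->; rewrite exprS. Qed.

(** Cartan's criterion.  If f is a homomorphism to the integers and X' the replica
    of X for f, then tr (P X X') = sum_r r f(r) over the eigenvalues r of P X
    vanishes; applying f gives sum_r f(r)^2 = 0.  So every f kills every r, and
    the eigenvalues are zero by compatible_nonzero. *)
Lemma cartan_nilpotent (h : {vspace mat}) (P X : mat) :
    replica_closed h -> P * P = P -> P * X = X * P -> X \in h ->
    (forall Y, Y \in h -> \tr (P *m X *m Y) = 0) ->
  exists m, (P * X) ^+ m = 0.
Proof.
move=> rep PP PX hX tr0; have [rs [_ trA rsA rootA]] := spectrum closedK (P * X).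
exists (size rs); apply: all_eigenvalues_zero => // r0 rs_r0.
apply/eqP/negPn/negP => nz_r0.
have [ls [lsX repX]] := rep X hX.
have mulX p : horner_mx (P * X) ('X * p) = X * (P * horner_mx X p).
  by rewrite rmorphM /= horner_mx_X [in X in X * _]PX -mulrA horner_mx_proj.
have rs_ls r : r \in rs -> r != 0 -> r \in ls.
  move=> rs_r nzr; have := rootA ('X * \prod_(l <- ls) ('X - l%:P)) _ r rs_r.
  rewrite rootM rootX (negPf nzr) root_prod_XsubC; apply.
  by rewrite mulX lsX !mulr0.
pose idx r := index r ls.
have lt_idx r : r \in rs -> r != 0 -> (idx r < size ls)%N.
  by move=> rs_r nzr; rewrite index_mem rs_ls.
have nth_idx r : r \in rs -> r != 0 -> ls`_(idx r) = r.
  by move=> rs_r nzr; rewrite nth_index ?rs_ls.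
have [|fs Hfs nzf] := @compatible_nonzero K char0 ls (idx r0) _ (lt_idx _ rs_r0 nz_r0).
  by rewrite nth_idx.
have [q [qE hq]] := repX fs Hfs.
have sum0 : \sum_(r <- rs | r != 0) r *~ fs (idx r) = 0.
  have := tr0 _ hq.
  have -> : P *m X *m horner_mx X q = horner_mx (P * X) ('X * q).
    by rewrite mulX mulrA -PX.
  rewrite trA (bigID (fun r => r != 0)) /= [X in _ + X]big1 ?addr0 => [tr|r]; last first.
    by rewrite negbK => /eqP->; rewrite hornerM hornerX mul0r.
  rewrite -[RHS]tr big_seq_cond [RHS]big_seq_cond; apply: eq_bigr => r /andP[rs_r nzr].
  have qr : q.[r] = (fs (idx r))%:~R by rewrite -qE ?lt_idx // nth_idx.
  by rewrite hornerM hornerX qr mulrzr.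
pose ns i := \sum_(r <- rs | (r != 0) && (idx r == i)) fs i.
have := Hfs ns.
have E (R : zmodType) (g : nat -> R) :
    \sum_(i < size ls) \sum_(r <- rs | (r != 0) && (idx r == i)) g i =
    \sum_(r <- rs | r != 0) g (idx r).
  rewrite (exchange_big_dep (fun r => r != 0)) /=; last by move=> i r _ /andP[].
  rewrite big_seq_cond [RHS]big_seq_cond; apply: eq_bigr => r /andP[rs_r nzr].
  rewrite (bigD1 (Ordinal (lt_idx _ rs_r nzr))) /= ?nzr ?eqxx // big1 ?addr0 //.
  move=> i /andP[/andP[_ /eqP eqi]]; rewrite -val_eqE /= eqi.
  by rewrite eqxx.
have -> : \sum_(i < size ls) ls`_i *~ ns i = 0.
  rewrite (eq_bigr (fun i : 'I__ =>
    \sum_(r <- rs | (r != 0) && (idx r == i)) ls`_i *~ fs i)); last first.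
    by move=> i _; rewrite mulrz_sumr.
  rewrite (E _ (fun i => ls`_i *~ fs i)) -[RHS]sum0 big_seq_cond [RHS]big_seq_cond.
  by apply: eq_bigr => r /andP[rs_r nzr]; rewrite nth_idx.
move=> /(_ erefl).
rewrite (eq_bigr (fun i : 'I__ =>
    \sum_(r <- rs | (r != 0) && (idx r == i)) fs i * fs i)); last first.
  by move=> i _; rewrite mulr_sumr.
rewrite (E _ (fun i => fs i * fs i)) => /eqP.
rewrite Num.Theory.psumr_eq0 => [|r _]; last by rewrite -expr2 Num.Theory.sqr_ge0.
by move/allP => /(_ _ rs_r0); rewrite nz_r0 /= mulf_eq0 orbb (negPf nzf).
Qed.

Variable G : mat -> Prop.
Hypothesis G_unit : forall g, G g -> g \in unitmx.
Hypothesis G_inv : forall g, G g -> G (invmx g).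
Hypothesis ss : semisimple_rows G.

(** The P-radical of the trace form on h is stable under conjugation and brackets,
    and by Cartan's criterion its elements are nilpotent on the image of P. *)
Theorem trace_form_nondegenerate (h : {vspace mat}) (P : mat) :
    P *m P = P -> (forall g, G g -> g *m P = P *m g) ->
    (forall X, X \in h -> in_span G X) -> conj_stable G h -> bracket_closed h ->
    replica_closed h ->
  forall X, X \in h -> (forall Y, Y \in h -> \tr (P *m X *m Y) = 0) -> P *m X = 0.
Proof.
move=> PP commP spanh conjh brh rep X hX tr0.
have PX Z : Z \in h -> P *m Z = Z *m P by move=> /spanh sZ; rewrite (in_span_comm sZ commP).
have [|a _ _ [Y [hY -> trY]] [Z [hZ -> trZ]]|m mP] := @vspace_of_pred_ex _ mat
    (fun Y => exists Z, [/\ Z \in h, Y = P *m Z &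
                          forall T, T \in h -> \tr (P *m Z *m T) = 0]).
- exists 0; split; rewrite ?mem0v ?mulmx0 // => T _.
  by rewrite mul0mx mxtrace0.
- exists (a *: Y + Z); split; first by rewrite memvD ?memvZ.
    by rewrite mulmxDr -scalemxAr.
  move=> T hT; rewrite mulmxDr -scalemxAr mulmxDl -scalemxAl linearP /=.
  by rewrite trY // trZ // mulr0 addr0.
apply: (nilpotent_ideal_zero G_unit G_inv ss PP commP (m := m)); last by apply/mP; exists X.
- by move=> _ /mP[Z [hZ -> _]]; exists Z => //; apply: spanh.
- move=> g _ Gg /mP[Z [hZ -> trZ]]; apply/mP; exists (invmx g *m Z *m g).
  have gP : invmx g *m P = P *m invmx g by apply: commP; apply: G_inv.
  split; [exact: conjh|by rewrite !mulmxA gP|move=> T hT].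
  have -> : P *m (invmx g *m Z *m g) *m T = invmx g *m (P *m Z *m g *m T).
    by rewrite !mulmxA gP.
  rewrite mxtrace_mulC; have -> : P *m Z *m g *m T *m invmx g =
      P *m Z *m (g *m T *m invmx g) by rewrite !mulmxA.
  by apply: trZ; have := conjh _ _ (G_inv Gg) hT; rewrite invmxK.
- move=> _ _ /mP[Y [hY -> trY]] /mP[Z [hZ -> trZ]]; apply/mP.
  exists (Y *m Z - Z *m Y); split; first exact: brh.
    rewrite mulmxBr; congr (_ - _).
      by rewrite PX // -mulmxA (mulmxA P) PP mulmxA -PX // mulmxA.
    by rewrite PX // -mulmxA (mulmxA P) PP mulmxA -PX // mulmxA.
  move=> T hT; have -> : P *m (Y *m Z - Z *m Y) *m T =
      P *m Y *m (Z *m T - T *m Z) + (P *m Y *m T *m Z - Z *m (P *m Y *m T)).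
    rewrite !mulmxBr mulmxBl !mulmxA -PX // addrA subrK.
    by [].
  rewrite linearD /= trY; last exact: brh.
  by rewrite add0r linearB /= mxtrace_mulC subrr.
- move=> _ /mP[Z [hZ -> trZ]].
  have [k Hk] := cartan_nilpotent rep PP (PX _ hZ) hZ trZ.
  by exists k => u; rewrite iter_mulmx_exp (Hk : (P *m Z) ^+ k = 0) mulmx0.
Qed.

End TraceForms.

(** * Replicas of linear fields *)

Section PartitionOfUnity.

Variable K : fieldType.

Lemma dvdp_prod_powers (s : seq K) E (p : {poly K}) : uniq s ->
  (forall a, a \in s -> ('X - a%:P) ^+ E %| p) ->
  \prod_(a <- s) ('X - a%:P) ^+ E %| p.
Proof.
elim: s => [|a s IHs] /=; first by rewrite big_nil dvd1p.
case/andP=> nsa us Hs; rewrite big_cons Gauss_dvdp.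
  rewrite Hs ?mem_head //=; apply: IHs => // b sb; apply: Hs.
  by rewrite inE sb orbT.
rewrite coprimep_sym big_seq; apply: (big_ind (fun p => coprimep p _)).
- exact: coprime1p.
- by move=> q r cq cr; rewrite coprimepMl cq cr.
- move=> b sb; rewrite coprimep_expl // coprimep_expr // coprimep_XsubC rootE !hornerE.
  by rewrite subr_eq0; apply: contraNneq nsa => ->.
Qed.

(** The spectral projections of A, by interpolation to high order. *)
Lemma partition_of_unity n (A : 'M[K]_n.+1) (ls : seq K) :
    horner_mx A (\prod_(l <- ls) ('X - l%:P)) = 0 ->
  exists e : K -> 'M[K]_n.+1,
    [/\ \sum_(a <- undup ls) e a = 1, forall a B, GRing.comm A B -> GRing.comm (e a) B,
        forall a, a \in ls -> (A - a%:M) ^+ size ls *m e a = 0 &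
        forall a, exists p, e a = horner_mx A p].
Proof.
move=> Als; set E := size ls.
have /functional_choice [q qP] : forall a, exists q : {poly K}, forall b, b \in undup ls ->
    ('X - b%:P) ^+ E %| q - (b == a)%:R%:P.
  by move=> a; apply: (interpolation (fun b => (b == a)%:R)); apply: undup_uniq.
have Adiv p : (forall a, a \in undup ls -> ('X - a%:P) ^+ E %| p) -> horner_mx A p = 0.
  move=> /(dvdp_prod_powers (undup_uniq ls)) /dvdpP[r ->].
  suff /dvdpP[t ->] : \prod_(l <- ls) ('X - l%:P) %| \prod_(a <- undup ls) ('X - a%:P) ^+ E.
    by rewrite !rmorphM /= Als !mulr0.
  rewrite -prodr_undup_exp_count; elim: (undup ls) => [|a s IHs].
    by rewrite !big_nil dvdpp.
  by rewrite !big_cons dvdp_mul // dvdp_exp2l // count_size.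
exists (fun a => horner_mx A (q a)); split.
- apply/eqP; rewrite -subr_eq0 -rmorph_sum /= -(rmorph1 (horner_mx A)) -rmorphB /=.
  rewrite Adiv // => b sb.
  rewrite (bigD1_seq b) ?undup_uniq //= addrAC dvdp_addl.
    by have := qP b b sb; rewrite eqxx polyC1.
  apply: (big_ind (fun p => ('X - b%:P) ^+ E %| p)) => [|x y dx dy|a nea].
  - exact: dvdp0.
  - exact: dvdp_add.
  - by have := qP a b sb; rewrite eq_sym (negPf nea) polyC0 subr0.
- by move=> a B cAB; apply: comm_horner_mx.
- move=> a lsa; have -> : A - a%:M = horner_mx A ('X - a%:P).
    by rewrite rmorphB /= horner_mx_X horner_mx_C.
  rewrite mulmxE -rmorphXn -rmorphM /=; apply: Adiv => b sb.
  have [->|ne] := eqVneq b a; first by rewrite dvdp_mulr.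
  by have := qP a b sb; rewrite (negPf ne) polyC0 subr0 => /dvdp_mull; apply.
- by move=> a; exists (q a).
Qed.

End PartitionOfUnity.

Section Replica.

Variables (K : fieldType) (M : nat).
Hypothesis char0 : [pchar K] =i pred0.
Local Notation R := {mpoly K[M.+1]}.
Variables (A : 'M[K]_M.+1) (ls : seq K) (fs : nat -> int) (q : {poly K}).
Hypothesis Als : horner_mx A (\prod_(l <- ls) ('X - l%:P)) = 0.
Hypothesis fsP : compatible ls fs.
Hypothesis qP : forall i, (i < size ls)%N ->
  ('X - (ls`_i)%:P) ^+ size ls %| q - ((fs i)%:~R)%:P.

Let D : R -> R := Dfield A.
Let D' : R -> R := Dfield (horner_mx A q).

Definition shiftD (a : K) (p : R) : R := D p - a *: p.

(** The graph of the homomorphism fs on the additive monoid generated by ls. *)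
Definition replica_graph (a b : K) := exists ns : nat -> nat,
  a = \sum_(i < size ls) ls`_i *+ ns i /\
  b = (\sum_(i < size ls) fs i * (ns i)%:Z)%:~R.

Lemma replica_graph_fun a b b' : replica_graph a b -> replica_graph a b' -> b = b'.
Proof.
move=> [ns [-> ->]] [ms [eqa ->]]; apply/eqP; rewrite -subr_eq0 -rmorphB /= -sumrB.
rewrite (eq_bigr (fun i : 'I__ => fs i * ((ns i)%:Z - (ms i)%:Z))) => [|i _].
  rewrite (fsP (ns := fun i => (ns i)%:Z - (ms i)%:Z)) //.
  under eq_bigr do rewrite mulrzBr -!pmulrn.
  by rewrite sumrB eqa subrr.
by rewrite mulrBr.
Qed.

Lemma replica_graph0 : replica_graph 0 0.
Proof.
exists (fun=> 0%N); split; first by rewrite big1.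
by rewrite big1 // => i _; rewrite mulr0.
Qed.

Lemma replica_graphD a b a' b' :
  replica_graph a b -> replica_graph a' b' -> replica_graph (a + a') (b + b').
Proof.
move=> [ns [-> ->]] [ms [-> ->]]; exists (fun i => ns i + ms i)%N; split.
  by rewrite -big_split; apply: eq_bigr => i _; rewrite mulrnDr.
rewrite -rmorphD -big_split; congr (_%:~R); apply: eq_bigr => i _.
by rewrite PoszD mulrDr.
Qed.

(** A generalized eigenvector of D for a on which D' acts by b, the value at a of
    the homomorphism. *)
Definition weight_vector (a b : K) (p : R) :=
  [/\ exists E, iter E (shiftD a) p = 0, D' p = b *: p & replica_graph a b].

Lemma shiftD0 a : shiftD a 0 = 0.
Proof. by rewrite /shiftD /D Dfield0 scaler0 subrr. Qed.

Lemma shiftDD a p p' : shiftD a (p + p') = shiftD a p + shiftD a p'.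
Proof. by rewrite /shiftD /D DfieldD scalerDr opprD addrACA. Qed.

Lemma iter_shiftDD a E p p' :
  iter E (shiftD a) (p + p') = iter E (shiftD a) p + iter E (shiftD a) p'.
Proof. by elim: E => //= E ->; rewrite shiftDD. Qed.

Lemma iter_shiftD0 a E : iter E (shiftD a) 0 = 0.
Proof. by elim: E => //= E ->; rewrite shiftD0. Qed.

Lemma iter_shiftD_mono a E E' p : (E <= E')%N ->
  iter E (shiftD a) p = 0 -> iter E' (shiftD a) p = 0.
Proof. by move=> /subnK <- H; rewrite iterD H iter_shiftD0. Qed.

Lemma shiftD_mul a b p r :
  shiftD (a + b) (p * r) = shiftD a p * r + p * shiftD b r.
Proof.
rewrite /shiftD /D DfieldM -!mul_mpolyC mpolyCD; ring.
Qed.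

Lemma iter_shiftD_mul a b E E' p r : iter E (shiftD a) p = 0 ->
  iter E' (shiftD b) r = 0 -> iter (E + E') (shiftD (a + b)) (p * r) = 0.
Proof.
have [n] := ubnP (E + E'); elim: n E E' p r => // n IHn [|E] [|E'] p r lt Hp Hr.
- by rewrite (Hp : p = 0) mul0r iter_shiftD0.
- by rewrite (Hp : p = 0) mul0r iter_shiftD0.
- by rewrite (Hr : r = 0) mulr0 iter_shiftD0.
rewrite addSn iterSr shiftD_mul iter_shiftDD.
rewrite IHn ?add0r; last 3 first.
- by rewrite -ltnS.
- by rewrite -iterSr.
- exact: Hr.
rewrite addnS -addSn; apply: IHn => //; last by rewrite -iterSr.
by move: lt; rewrite !addSn !addnS.
Qed.

Lemma weight_mul a b a' b' p p' : weight_vector a b p -> weight_vector a' b' p' ->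
  weight_vector (a + a') (b + b') (p * p').
Proof.
move=> [[E HE] Dp gr] [[E' HE'] Dp' gr']; split; last exact: replica_graphD.
  by exists (E + E')%N; apply: iter_shiftD_mul.
by rewrite /D' DfieldM -/D' Dp Dp' -!mul_mpolyC mpolyCD; ring.
Qed.

Definition weight_sum (p : R) := exists s : seq (K * K * R),
  (forall t, t \in s -> weight_vector t.1.1 t.1.2 t.2) /\ p = \sum_(t <- s) t.2.

Lemma weight_sumD p p' : weight_sum p -> weight_sum p' -> weight_sum (p + p').
Proof.
move=> [s [Hs ->]] [s' [Hs' ->]]; exists (s ++ s'); rewrite big_cat; split=> // t.
by rewrite mem_cat => /orP[/Hs|/Hs'].
Qed.

Lemma weight_sumM p p' : weight_sum p -> weight_sum p' -> weight_sum (p * p').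
Proof.
move=> [s [Hs ->]] [s' [Hs' ->]].
exists [seq (t.1.1 + t'.1.1, t.1.2 + t'.1.2, t.2 * t'.2) | t <- s, t' <- s']; split.
  by move=> _ /allpairsP[[t t'] /= [/Hs ws /Hs' ws' ->]]; apply: weight_mul.
rewrite big_allpairs_dep mulr_suml; apply: eq_bigr => t _.
by rewrite mulr_sumr.
Qed.

Lemma weight_sumC c : weight_sum c%:MP.
Proof.
exists [:: (0, 0, c%:MP)]; split; last by rewrite big_seq1.
move=> t; rewrite inE => /eqP-> /=; split; last exact: replica_graph0.
  by exists 1%N; rewrite /= /shiftD /D DfieldC scale0r subrr.
by rewrite /D' DfieldC scale0r.
Qed.

(** The spectral projections of A split a coordinate into generalized eigenvectors
    of the field, on which D' acts by the interpolated values. *)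
Lemma weight_sumX i : weight_sum 'X_i.
Proof.
have [e [sum_e comm_e e_nil e_pol]] := partition_of_unity Als.
have shift_lin a E (w : 'cV_M.+1) :
    iter E (shiftD a) (linform w) = linform ((A - a%:M) ^+ E *m w).
  elim: E w => [|E IHE] w; first by rewrite expr0 mul1mx.
  rewrite iterSr exprSr -[_ * _ *m w]mulmxA -IHE; congr iter.
  rewrite /shiftD /D Dfield_linform mulmxBl mul_scalar_mx /linform scaler_sumr -sumrB.
  by apply: eq_bigr => j _; rewrite !mxE scalerA -scalerBl.
pose w : 'cV[K]_M.+1 := delta_mx i 0.
have -> : 'X_i = \sum_(a <- undup ls) linform (e a *m w).
  have -> : \sum_(a <- undup ls) linform (e a *m w) =
      linform (\sum_(a <- undup ls) (e a *m w)).
    rewrite /linform exchange_big /=; apply: eq_bigr => j _.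
    by rewrite summxE scaler_suml.
  rewrite -mulmx_suml sum_e mul1mx /linform (bigD1 i) //= mxE !eqxx scale1r big1 ?addr0 //.
  by move=> j /negPf ne; rewrite mxE ne scale0r.
rewrite big_seq; apply: (big_ind weight_sum).
- by rewrite -mpolyC0; apply: weight_sumC.
- exact: weight_sumD.
move=> a; rewrite mem_undup => lsa; pose j := index a ls.
have ltj : (j < size ls)%N by rewrite index_mem.
have lsj : ls`_j = a by rewrite nth_index.
exists [:: (a, (fs j)%:~R, linform (e a *m w))]; split; last by rewrite big_seq1.
move=> t; rewrite inE => /eqP-> /=; split.
- exists (size ls); rewrite shift_lin mulmxA e_nil // mul0mx.
  by rewrite /linform big1 // => l _; rewrite mxE scale0r.
- rewrite /D' Dfield_linform mulmxA.
  suff -> : horner_mx A q *m e a = (fs j)%:~R *: e a.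
    by rewrite -scalemxAl /linform scaler_sumr; apply: eq_bigr => l _; rewrite mxE scalerA.
  have := qP ltj; rewrite lsj => /dvdpP[r eqr].
  rewrite -[q](subrK ((fs j)%:~R)%:P) eqr rmorphD rmorphM rmorphXn rmorphB /=.
  rewrite horner_mx_X !horner_mx_C mulmxDl mul_scalar_mx.
  by rewrite -[_ * _ *m e a]mulmxA e_nil // mulmx0 add0r.
- exists (fun l => (l == j)%N); split.
    rewrite (bigD1 (Ordinal ltj)) //= eqxx lsj big1 ?addr0 // => l.
    by rewrite -val_eqE /= => /negPf->.
  congr (_%:~R); rewrite (bigD1 (Ordinal ltj)) //= eqxx mulr1 big1 ?addr0 // => l.
  by rewrite -val_eqE /= => /negPf->; rewrite mulr0.
Qed.

Lemma weight_sum_all p : weight_sum p.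
Proof.
elim/mpoly_alg_ind: p => [c|i|p p'|p p'].
- exact: weight_sumC.
- exact: weight_sumX.
- exact: weight_sumD.
- exact: weight_sumM.
Qed.

Definition polyD (Q : {poly K}) (p : R) : R := \sum_(k < size Q) Q`_k *: iter k D p.

Lemma polyD_wide n (Q : {poly K}) p : (size Q <= n)%N -> polyD Q p = \sum_(k < n) Q`_k *: iter k D p.
Proof.
move=> leQ; rewrite /polyD (big_ord_widen n (fun k => Q`_k *: iter k D p)) //.
rewrite big_mkcond; apply: eq_bigr => k _; case: ltnP => // le.
by rewrite nth_default ?scale0r.
Qed.

Lemma polyDD (Q Q' : {poly K}) p : polyD (Q + Q') p = polyD Q p + polyD Q' p.
Proof.
pose n := maxn (size Q) (size Q').
rewrite (@polyD_wide n Q) ?leq_maxl // (@polyD_wide n Q') ?leq_maxr //.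
rewrite (@polyD_wide n (Q + Q')) ?size_polyD // -big_split.
by apply: eq_bigr => k _; rewrite coefD scalerDl.
Qed.

Lemma polyDC c p : polyD c%:P p = c *: p.
Proof. by rewrite (@polyD_wide 1) ?size_polyC_leq1 // big_ord1 coefC. Qed.

Lemma polyDZ c (Q : {poly K}) p : polyD (c *: Q) p = c *: polyD Q p.
Proof.
rewrite (@polyD_wide (size Q)) ?size_scale_leq // scaler_sumr.
by apply: eq_bigr => k _; rewrite coefZ scalerA.
Qed.

Lemma iterD_lin k c p p' : iter k D (c *: p + p') = c *: iter k D p + iter k D p'.
Proof. by elim: k => //= k ->; rewrite /D DfieldD DfieldZ. Qed.

Lemma polyD_lin Q c p p' : polyD Q (c *: p + p') = c *: polyD Q p + polyD Q p'.
Proof.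
rewrite /polyD scaler_sumr -big_split; apply: eq_bigr => k _ /=.
by rewrite iterD_lin scalerDr !scalerA [c * _]mulrC.
Qed.

Lemma polyD0 Q : polyD Q 0 = 0.
Proof.
rewrite /polyD big1 // => k _; have -> : iter k D 0 = 0.
  by elim: (k : nat) => //= j ->; rewrite /D Dfield0.
by rewrite scaler0.
Qed.

Lemma polyDMX (Q : {poly K}) p : polyD (Q * 'X) p = polyD Q (D p).
Proof.
have szQ : (size (Q * 'X)%R <= (size Q).+1)%N.
  by apply: leq_trans (size_polyMleq _ _) _; rewrite size_polyX addn2.
rewrite (polyD_wide _ szQ) big_ord_recl coefMX eqxx scale0r add0r.
by apply: eq_bigr => k _; rewrite coefMX /= -iterSr.
Qed.

Lemma polyD_XsubC (Q : {poly K}) a p : polyD (Q * ('X - a%:P)) p = polyD Q (shiftD a p).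
Proof.
rewrite mulrBr polyDD polyDMX -mulrN mulrC -polyCN mul_polyC polyDZ.
by rewrite /shiftD addrC -[in RHS]addrC -scaleNr polyD_lin.
Qed.

Lemma polyD_nil E (Q : {poly K}) a p : iter E (shiftD a) p = 0 -> ('X - a%:P) ^+ E %| Q -> polyD Q p = 0.
Proof.
move=> Hp /dvdpP[T ->]; elim: E T p Hp => [|E IHE] T p; first by move=> /= ->; rewrite polyD0.
by rewrite iterSr exprSr mulrA polyD_XsubC => /IHE.
Qed.

(** On each polynomial p the replica field acts as some polynomial in the field
    itself: p is a sum of generalized eigenvectors, whose eigenvalues lie in the
    monoid generated by ls, and interpolation at these finitely many eigenvalues
    applies. *)
Theorem replica_stable (I : R -> Prop) :
    I 0 -> (forall c p p', I p -> I p' -> I (c *: p + p')) ->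
    (forall p, I p -> I (Dfield A p)) ->
  forall p, I p -> I (Dfield (horner_mx A q) p).
Proof.
move=> I0 Ilin ID p Ip; have [s [Hs pE]] := weight_sum_all p.
have [E HE] : exists E, forall t, t \in s -> iter E (shiftD t.1.1) t.2 = 0.
  elim: s Hs {pE} => [|t s IHs] Hs; first by exists 0%N.
  have [|E HE] := IHs; first by move=> u su; apply: Hs; rewrite inE su orbT.
  have [[E' HE'] _ _] := Hs t (mem_head _ _).
  exists (maxn E E') => u; rewrite inE => /orP[/eqP->|su].
    by apply: iter_shiftD_mono HE'; rewrite leq_maxr.
  by apply: iter_shiftD_mono (HE u su); rewrite leq_maxl.
have /functional_choice [tgt tgtP] : forall a, exists b, forall b', replica_graph a b' -> b' = b.
  move=> a; have [[b gr]|no] := classic (exists b, replica_graph a b).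
    by exists b => b' gr'; apply: replica_graph_fun gr' gr.
  by exists 0 => b' gr'; case: no; exists b'.
have [Q HQ] := interpolation tgt E (undup_uniq [seq t.1.1 | t <- s]).
have QE t : t \in s -> polyD Q t.2 = Dfield (horner_mx A q) t.2.
  move=> st; have [_ D'E gr] := Hs t st.
  rewrite -/D' D'E (tgtP _ _ gr) -[Q](subrK (tgt t.1.1)%:P) polyDD polyDC.
  rewrite (polyD_nil (HE t st)) ?add0r //; apply: HQ.
  by rewrite mem_undup; apply/mapP; exists t.
have polyDD' u u' : polyD Q (u + u') = polyD Q u + polyD Q u'.
  by rewrite -[u]scale1r polyD_lin !scale1r.
have -> : Dfield (horner_mx A q) p = polyD Q p.
  rewrite pE Dfield_sum (big_morph (polyD Q) polyDD' (polyD0 Q)).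
  by rewrite big_seq [RHS]big_seq; apply: eq_bigr => t /QE.
rewrite /polyD; apply: (big_ind I) => // [u u' Iu Iu'|k _].
  by rewrite -[u]scale1r; apply: Ilin.
rewrite -[_ *: _]addr0; apply: (Ilin) => //.
by elim: (k : nat) => //= j IHj; apply: ID.
Qed.

End Replica.

(** * Jets of matrix groups *)

Definition linmx (K : fieldType) m n (f : 'rV[K]_m -> 'rV[K]_n) : 'M[K]_(m, n) :=
  \matrix_i f (delta_mx 0 i).

Lemma linmxE (K : fieldType) m n (f : 'rV[K]_m -> 'rV[K]_n) :
  (forall a u w, f (a *: u + w) = a *: f u + f w) -> forall u, u *m linmx f = f u.
Proof.
move=> flin u.
have f0 : f 0 = 0.
  by have := flin (-1) 0 0; rewrite scaler0 add0r scaleN1r addNr.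
have fD x y : f (x + y) = f x + f y by rewrite -[x]scale1r flin !scale1r.
rewrite mulmx_sum_row {2}[u]row_sum_delta (big_morph f fD f0).
by apply: eq_bigr => i _; rewrite rowK -[_ *: delta_mx 0 i]addr0 flin f0 addr0.
Qed.

Section TangentGeneral.

Variables (K : fieldType) (m : nat) (S : 'rV[K]_m -> Prop) (e : 'rV[K]_m).
Hypothesis Se : S e.

(** The commutator of two linear derivations is the derivation of the commutator. *)
Lemma tangent_bracket (A B : 'M[K]_m) :
    (forall p, vanish S p -> vanish S (Dfield A p)) ->
    (forall p, vanish S p -> vanish S (Dfield B p)) ->
  tangent S e (e *m (A *m B - B *m A)).
Proof.
move=> HA HB p Ip.
have comm (C : 'M[K]_m) (C' : 'M[K]_m) r : Dfield C (Dfield C' r) - Dfield C' (Dfield C r)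
    = Dfield (C *m C' - C' *m C) r.
  have linB (w w' : 'cV[K]_m) : linform (w - w') = linform w - linform w'.
    by rewrite /linform -sumrB; apply: eq_bigr => j _; rewrite !mxE scalerBl.
  elim/mpoly_alg_ind: r => [c|i|p1 p2 IH1 IH2|p1 p2 IH1 IH2].
  - by rewrite !(DfieldC, Dfield0) subrr.
  - rewrite !DfieldX !Dfield_linform -linB; congr linform.
    by rewrite !colE mulmxBl !mulmxA.
  - by rewrite !DfieldD -IH1 -IH2; ring.
  - by rewrite !(DfieldM, DfieldD) -IH1 -IH2; ring.
rewrite -DfieldE -comm mevalB.
by rewrite (HA _ (HB _ Ip)) // (HB _ (HA _ Ip)) // subrr.
Qed.

Hypothesis closedK : alg_closed K.

Lemma horner_mx_act n (A : 'M[K]_n.+1) k (u : 'M[K]_(k, n.+1)) (p : {poly K}) :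
  u *m horner_mx A p = \sum_(j < size p) p`_j *: iter j (mulmx^~ A) u.
Proof.
rewrite -{1}[p]coefK poly_def rmorph_sum /= mulmx_sumr; apply: eq_bigr => j _.
rewrite linearZ /= rmorphXn /= horner_mx_X -scalemxAr.
congr (_ *: _); elim: (j : nat) => [|i IHi]; first by rewrite expr0 mulmx1.
by rewrite exprSr mulmxA IHi.
Qed.

(** The replicas of a field that preserves the ideal of S preserve it too, by
    replica_stable, and a field that preserves the ideal is tangent to S. *)
Lemma tangent_replica (A : 'M[K]_m) : (0 < m)%N ->
    (forall p, vanish S p -> vanish S (Dfield A p)) ->
  exists ls : seq K,
    (let p := \prod_(l <- ls) ('X - l%:P) in
     \sum_(k < size p) p`_k *: iter k (mulmx^~ A) e = 0) /\
    forall fs, compatible ls fs -> exists q : {poly K},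
      (forall i, (i < size ls)%N -> q.[ls`_i] = (fs i)%:~R) /\
      tangent S e (\sum_(k < size q) q`_k *: iter k (mulmx^~ A) e).
Proof.
move: A; case: m S e Se => // n S1 e1 Se1 A _ HA.
have [ls [_ _ Als _]] := spectrum closedK A; exists ls; split.
  by rewrite /= -(horner_mx_act A e1) Als mulmx0.
move=> fs Hfs.
have tgt_ex : exists tgt : K -> K, forall i, (i < size ls)%N -> tgt ls`_i = (fs i)%:~R.
  exists (fun a => (fs (index a ls))%:~R) => i lti; congr (_%:~R).
  set j := index _ _; have ltj : (j < size ls)%N by rewrite index_mem mem_nth.
  have lsj : ls`_j = ls`_i by rewrite nth_index ?mem_nth.
  have := Hfs (fun l => (l == j)%:R - (l == i)%:R).
  have E (R : zmodType) (g : nat -> int -> R) : (forall l, g l 0 = 0) ->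
      (forall l a b, g l (a - b) = g l a - g l b) ->
      \sum_(l < size ls) g l ((l == j :> nat)%:R - (l == i :> nat)%:R) = g j 1 - g i 1.
    move=> g0 gB; under eq_bigr do rewrite gB.
    rewrite sumrB (bigD1 (Ordinal ltj)) //= eqxx big1 ?addr0 => [|l].
      rewrite (bigD1 (Ordinal lti)) //= eqxx big1 ?addr0 // => l.
      by rewrite -val_eqE /= => /negPf->.
    by rewrite -val_eqE /= => /negPf->.
  rewrite (E _ (fun l n => ls`_l *~ n)) => [|l|l a b]; last 2 first.
  - by rewrite mulr0z.
  - by rewrite mulrzBr.
  rewrite (E _ (fun l n => fs l * n)) => [|l|l a b]; last 2 first.
  - by rewrite mulr0.
  - by rewrite mulrBr.
  by rewrite lsj subrr !mulr1 => /(_ erefl)/eqP; rewrite subr_eq0 => /eqP.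
have [tgt tgtP] := tgt_ex.
have [q Hq] := interpolation tgt (size ls) (undup_uniq ls).
have qP i : (i < size ls)%N -> ('X - (ls`_i)%:P) ^+ size ls %| q - ((fs i)%:~R)%:P.
  by move=> lti; rewrite -tgtP //; apply: Hq; rewrite mem_undup mem_nth.
exists q; split=> [i lti|].
  have szls : (0 < size ls)%N by apply: leq_ltn_trans lti.
  have /dvdpP[r /(congr1 (horner^~ ls`_i))] := qP i lti.
  rewrite !hornerE subrr expr0n eqn0Ngt szls mulr0.
  by move/eqP; rewrite subr_eq0 => /eqP.
rewrite -(horner_mx_act A e1) => p Ip; rewrite -DfieldE.
apply: (replica_stable Als Hfs qP (I := vanish S1)) => //.
  by case: (vanish_ideal S1).
move=> c p1 p2 I1 I2; rewrite -mul_mpolyC.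
by case: (vanish_ideal S1) => _ VD VM; apply: (VD) => //; apply: (VM).
Qed.

End TangentGeneral.

Section JetGroups.

Variables (K : fieldType) (d : K -> K).
Hypothesis d_der : is_derivation d.

Section OneGroup.

Variables (n : nat).
Local Notation mat := 'M[K]_n.

Definition menc r (Y : nat -> mat) : 'rV[K]_(n * n * r) := enc r (fun k => mxvec (Y k)).
Definition mcomp r (z : 'rV[K]_(n * n * r)) k : mat := vec_mx (dec z k).

(** The sequences Y and Z stand for formal families sum_k Y_k s^k / k!; jmul is
    their product, and the jet of a product of matrices is the product of jets. *)
Definition jmul (Y Z : nat -> mat) k : mat :=
  \sum_(a < k.+1) (Y a *m Z (k - a)%N) *+ 'C(k, a).

Definition jseq (A : mat) k : mat := map_mx (iter k d) A.

Lemma mcompK r z : menc r (mcomp z) = z.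
Proof. by rewrite /menc -[RHS]decK; apply: enc_ext => k _; rewrite vec_mxK. Qed.

Lemma mencK r Y k : (k < r)%N -> mcomp (menc r Y) k = Y k.
Proof. by move=> ltk; rewrite /mcomp encK // mxvecK. Qed.

Lemma mcomp_lin r a y z k :
  mcomp (a *: y + z : 'rV_(n * n * r)) k = a *: mcomp y k + mcomp z k.
Proof. by rewrite /mcomp dec_lin linearP. Qed.

Lemma menc_lin r a Y Z :
  menc r (fun k => a *: Y k + Z k) = a *: menc r Y + menc r Z.
Proof. by rewrite -enc_lin; apply: enc_ext => k _; rewrite linearP. Qed.

Lemma menc_ext r Y Z : (forall k, (k < r)%N -> Y k = Z k) -> menc r Y = menc r Z.
Proof. by move=> YZ; apply: enc_ext => k ltk; rewrite YZ. Qed.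

Lemma jet_menc r A : jet d r (mxvec A) = menc r (jseq A).
Proof.
rewrite jet_enc; apply: enc_ext => k _; apply/rowP => i.
by case/mxvec_indexP: i => i j; rewrite mxE !mxvecE mxE.
Qed.

Lemma jseqM A B k : jseq (A *m B) k = jmul (jseq A) (jseq B) k.
Proof.
apply/matrixP => i j; rewrite !mxE summxE (iter_der_sum d_der).
rewrite (eq_bigr (fun l => \sum_(a < k.+1)
  (iter a d (A i l) * iter (k - a) d (B l j)) *+ 'C(k, a))); last first.
  by move=> l _; rewrite (leibniz d_der).
rewrite exchange_big; apply: eq_bigr => a _ /=; rewrite sumrMnl mulmxnE mxE; congr (_ *+ _).
by apply: eq_bigr => l _; rewrite !mxE.
Qed.

Lemma jmul_linl a (Y Y' Z : nat -> mat) k :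
  jmul (fun l => a *: Y l + Y' l) Z k = a *: jmul Y Z k + jmul Y' Z k.
Proof.
rewrite /jmul scaler_sumr -big_split; apply: eq_bigr => b _ /=.
by rewrite mulmxDl -scalemxAl mulrnDl scalerMnr.
Qed.

Lemma jmul_linr a (Y Y' Z : nat -> mat) k :
  jmul Z (fun l => a *: Y l + Y' l) k = a *: jmul Z Y k + jmul Z Y' k.
Proof.
rewrite /jmul scaler_sumr -big_split; apply: eq_bigr => b _ /=.
by rewrite mulmxDr -scalemxAr mulrnDl scalerMnr.
Qed.

Lemma jmul_ext (Y Y' Z Z' : nat -> mat) k :
    (forall l, (l <= k)%N -> Y l = Y' l) -> (forall l, (l <= k)%N -> Z l = Z' l) ->
  jmul Y Z k = jmul Y' Z' k.
Proof.
move=> YY ZZ; apply: eq_bigr => a _; rewrite YY ?ZZ ?leq_subr //.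
by rewrite -ltnS.
Qed.

Lemma jseq1 k : jseq 1%:M k = if k is 0 then 1%:M else 0.
Proof.
case: k => [|k]; apply/matrixP => i j; first by rewrite !mxE.
rewrite !mxE iterSr; suff -> : d (i == j)%:R = 0 by rewrite (iter_der0 d_der).
by rewrite (der_nat d_der).
Qed.

Lemma jmul1 (Y : nat -> mat) k : jmul Y (jseq 1%:M) k = Y k.
Proof.
rewrite /jmul big_ord_recr /= subnn jseq1 mulmx1 binn mulr1n big1 ?add0r // => a _.
rewrite jseq1; case E: (k - a)%N => [|l]; last by rewrite mulmx0 mul0rn.
by move: E (ltn_ord a) => /eqP; rewrite subn_eq0 leqNgt => /negPf->.
Qed.

Lemma jmul_at0 (Y Z : nat -> mat) : jmul Y Z 0 = Y 0 *m Z 0.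
Proof. by rewrite /jmul big_ord_recl big_ord0 addr0 subnn bin0. Qed.

Lemma jmul_first (Y Z : nat -> mat) i : (forall l, (l < i)%N -> Y l = 0) ->
  jmul Y Z i = Y i *m Z 0 /\ jmul Z Y i = Z 0 *m Y i.
Proof.
move=> Y0; rewrite /jmul; split.
  rewrite big_ord_recr /= subnn binn mulr1n big1 ?add0r // => a _.
  by rewrite Y0 ?mul0mx ?mul0rn.
rewrite big_ord_recl /= subn0 bin0 mulr1n big1 ?addr0 // => a _.
by rewrite [Y _]Y0 ?mulmx0 ?mul0rn // /bump add1n ltn_subrL (leq_ltn_trans _ (ltn_ord a)).
Qed.

Variable G : mat -> Prop.
Hypothesis G1 : G 1%:M.
Hypothesis G_mul : forall A B, G A -> G B -> G (A *m B).
Hypothesis G_unit : forall A, G A -> A \in unitmx.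
Hypothesis G_inv : forall A, G A -> G (invmx A).

Definition jset r (x : 'rV[K]_(n * n * r.+1)) : Prop :=
  exists2 A, G A & x = jet d r.+1 (mxvec A).

Definition jid r : 'rV[K]_(n * n * r.+1) := jet d r.+1 (mxvec 1%:M).

Definition jtan r := tangent (@jset r) (jid r).

Definition jfield r (z : 'rV[K]_(n * n * r.+1)) : 'M[K]_(n * n * r.+1) :=
  linmx (fun x => menc r.+1 (jmul (mcomp z) (mcomp x))).

Lemma jset1 r : jset (jid r).
Proof. by exists 1%:M. Qed.

Lemma menc_jmul_linr r (Z : nat -> mat) a (x y : 'rV[K]_(n * n * r)) :
  menc r (jmul Z (mcomp (a *: x + y))) =
  a *: menc r (jmul Z (mcomp x)) + menc r (jmul Z (mcomp y)).
Proof.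
rewrite -menc_lin; apply: menc_ext => k _; rewrite -jmul_linr.
by apply: jmul_ext => l _ //; rewrite mcomp_lin.
Qed.

Lemma menc_jmul_linl r (Z : nat -> mat) a (x y : 'rV[K]_(n * n * r)) :
  menc r (jmul (mcomp (a *: x + y)) Z) =
  a *: menc r (jmul (mcomp x) Z) + menc r (jmul (mcomp y) Z).
Proof.
rewrite -menc_lin; apply: menc_ext => k _; rewrite -jmul_linl.
by apply: jmul_ext => l _ //; rewrite mcomp_lin.
Qed.

Lemma jfieldE r (z x : 'rV[K]_(n * n * r.+1)) :
  x *m jfield z = menc r.+1 (jmul (mcomp z) (mcomp x)).
Proof. by rewrite /jfield linmxE // => a u w; apply: menc_jmul_linr. Qed.

Lemma mcomp_jet r A k : (k < r)%N -> mcomp (jet d r (mxvec A)) k = jseq A k.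
Proof. by move=> ltk; rewrite jet_menc mencK. Qed.

Lemma jid_field r (z : 'rV[K]_(n * n * r.+1)) : jid r *m jfield z = z.
Proof.
rewrite jfieldE -[RHS]mcompK; apply: menc_ext => k ltk; rewrite -[RHS]jmul1.
by apply: jmul_ext => l lel //; rewrite mcomp_jet // (leq_ltn_trans lel).
Qed.

Lemma jet_mulr r A B :
  menc r.+1 (jmul (mcomp (jet d r.+1 (mxvec A))) (jseq B)) = jet d r.+1 (mxvec (A *m B)).
Proof.
rewrite [RHS]jet_menc; apply: menc_ext => k ltk; rewrite jseqM.
by apply: jmul_ext => l lel //; rewrite mcomp_jet // (leq_ltn_trans lel).
Qed.

Lemma jet_mull r A B :
  menc r.+1 (jmul (jseq A) (mcomp (jet d r.+1 (mxvec B)))) = jet d r.+1 (mxvec (A *m B)).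
Proof.
rewrite [RHS]jet_menc; apply: menc_ext => k ltk; rewrite jseqM.
by apply: jmul_ext => l lel //; rewrite mcomp_jet // (leq_ltn_trans lel).
Qed.

Lemma tangent_mul N M (S : 'rV[K]_N -> Prop) (S' : 'rV[K]_M -> Prop) e (B : 'M[K]_(N, M)) z :
  (forall x, S x -> S' (x *m B)) -> tangent S e z -> tangent S' (e *m B) (z *m B).
Proof.
move=> SB Tz p Ip; rewrite -dd_linsub; apply: Tz => x Sx.
by rewrite linsubE; apply: Ip; apply: SB.
Qed.

(** The field of z maps the jet x of A to the product of z and x; it is the
    translate of the tangent vector z by A, and right translations preserve the
    group. *)
Lemma jfield_stable r z : @jtan r z -> forall p, vanish (@jset r) p ->
  vanish (@jset r) (Dfield (jfield z) p).
Proof.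
move=> Tz p Ip _ [A GA ->]; rewrite DfieldE jfieldE.
pose R := linmx (fun x : 'rV[K]_(n * n * r.+1) => menc r.+1 (jmul (mcomp x) (jseq A))).
have RE x : x *m R = menc r.+1 (jmul (mcomp x) (jseq A)).
  by apply: linmxE => a u w; apply: menc_jmul_linl.
have -> : jet d r.+1 (mxvec A) = jid r *m R by rewrite RE jet_mulr mul1mx.
have -> : menc r.+1 (jmul (mcomp z) (mcomp (jid r *m R))) = z *m R.
  rewrite !RE jet_mulr mul1mx; apply: menc_ext => k ltk.
  by apply: jmul_ext => l lel //; rewrite mcomp_jet // (leq_ltn_trans lel).
apply: (tangent_mul (S := @jset r)) Ip => // _ [B GB ->].
by exists (B *m A); [apply: G_mul|rewrite RE jet_mulr].
Qed.

Definition jconj r A (z : 'rV[K]_(n * n * r.+1)) : 'rV[K]_(n * n * r.+1) :=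
  menc r.+1 (jmul (mcomp (menc r.+1 (jmul (jseq (invmx A)) (mcomp z)))) (jseq A)).

Lemma jtan_conj r A z : G A -> @jtan r z -> @jtan r (jconj A z).
Proof.
move=> GA Tz.
pose R := linmx (fun x : 'rV[K]_(n * n * r.+1) => jconj A x).
have RE x : x *m R = jconj A x.
  apply: linmxE => a u w; rewrite /jconj -menc_jmul_linl; congr menc.
  apply: functional_extensionality => k; congr (jmul (mcomp _) _ _).
  by rewrite -menc_jmul_linr.
have RJ B : jet d r.+1 (mxvec B) *m R = jet d r.+1 (mxvec (invmx A *m B *m A)).
  by rewrite RE /jconj jet_mull jet_mulr.
rewrite -RE /jtan.
have -> : jid r = jid r *m R by rewrite RJ mulmx1 mulVmx ?G_unit.
apply: (tangent_mul (S := @jset r)) Tz => // _ [B GB ->].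
by exists (invmx A *m B *m A); [do 2!apply: (G_mul) => //; apply: G_inv|rewrite RJ].
Qed.

Lemma jconj_comp r A (z : 'rV[K]_(n * n * r.+1)) k : (k < r.+1)%N ->
  mcomp (jconj A z) k = jmul (jmul (jseq (invmx A)) (mcomp z)) (jseq A) k.
Proof.
move=> ltk; rewrite /jconj mencK //; apply: jmul_ext => l lel //.
by rewrite mencK // (leq_ltn_trans lel).
Qed.

Lemma jtan_bracket r z z' : @jtan r z -> @jtan r z' ->
  exists2 z'', @jtan r z'' &
    mcomp z'' 0 = mcomp z' 0 *m mcomp z 0 - mcomp z 0 *m mcomp z' 0.
Proof.
move=> Tz Tz'.
exists (jid r *m (jfield z *m jfield z' - jfield z' *m jfield z)).
  by apply: tangent_bracket; [apply: jset1| |]; apply: jfield_stable.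
rewrite mulmxBr !mulmxA !jid_field !jfieldE.
rewrite addrC -scaleN1r mcomp_lin scaleN1r addrC.
by rewrite !mencK // !jmul_at0.
Qed.

Lemma mcomp_sum r I (s : seq I) (c : I -> K) (z : I -> 'rV[K]_(n * n * r)) k :
  mcomp (\sum_(i <- s) c i *: z i) k = \sum_(i <- s) c i *: mcomp (z i) k.
Proof.
elim: s => [|i s IHs]; first by rewrite !big_nil /mcomp dec0 linear0.
by rewrite !big_cons mcomp_lin IHs.
Qed.

Lemma jtan_replica r z : alg_closed K -> (0 < n)%N -> @jtan r z ->
  exists ls : seq K,
    (let p := \prod_(l <- ls) ('X - l%:P) in
     \sum_(k < size p) p`_k *: iter k (mulmx (mcomp z 0)) 1%:M = 0) /\
    forall fs, compatible ls fs -> exists q : {poly K},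
      (forall i, (i < size ls)%N -> q.[ls`_i] = (fs i)%:~R) /\
      exists2 z', @jtan r z' &
        mcomp z' 0 = \sum_(k < size q) q`_k *: iter k (mulmx (mcomp z 0)) 1%:M.
Proof.
move=> closedK n0 Tz.
have comp0 k : mcomp (iter k (mulmx^~ (jfield z)) (jid r)) 0
    = iter k (mulmx (mcomp z 0)) 1%:M.
  elim: k => [|k IHk]; first by rewrite /= mcomp_jet // jseq1.
  by rewrite /= jfieldE mencK // jmul_at0 IHk.
have n1 : (0 < n * n * r.+1)%N by rewrite !muln_gt0 n0.
have [ls [Hls Hfs]] := tangent_replica (jset1 r) closedK n1 (jfield_stable Tz).
exists ls; split.
  move: Hls; set p := \prod_(l <- ls) _ => /= /(congr1 (fun x => mcomp x 0)).
  rewrite mcomp_sum {2}/mcomp dec0 linear0 => E; rewrite -[RHS]E.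
  by apply: eq_bigr => k _; rewrite comp0.
move=> fs /Hfs[q [qls Tq]]; exists q; split=> //; exists (\sum_(k < size q) q`_k *: iter k (mulmx^~ (jfield z)) (jid r)) => //.
by rewrite mcomp_sum; apply: eq_bigr => k _; rewrite comp0.
Qed.

Definition trform r k (L : mat) : 'cV[K]_(n * n * r) :=
  linmx (fun x : 'rV[K]_(n * n * r) => dec x k) *m (mxvec L^T)^T.

Lemma trformE r k L (x : 'rV[K]_(n * n * r)) :
  (x *m trform r k L) 0 0 = \tr (mcomp x k *m L).
Proof.
have trE (X : mat) : (mxvec X *m (mxvec L^T)^T) 0 0 = \tr (X *m L).
  rewrite mxE (reindex _ (curry_mxvec_bij n n)) /= /mxtrace.
  rewrite (eq_bigr (fun i => \sum_j X i j * L j i)) => [|i _]; last by rewrite mxE.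
  rewrite pair_big; apply: eq_bigr => -[i j] _ /=.
  by rewrite !mxE !mxvecE !mxE.
by rewrite mulmxA linmxE => [|a u v]; rewrite ?dec_lin // -{1}[dec x k]vec_mxK trE.
Qed.

Lemma jtan_trace r k (L : mat) c z : (k < r.+1)%N ->
  (forall A, G A -> \tr (jseq A k *m L) = c) ->
  @jtan r z -> \tr (mcomp z k *m L) = 0.
Proof.
move=> ltk GL Tz; rewrite -trformE.
apply: (@tangent_linform _ _ (@jset r) (jid r) _ c) => // _ [A GA ->].
by rewrite trformE mcomp_jet // GL.
Qed.

Lemma jseq0 A : jseq A 0 = A.
Proof. by apply/matrixP => i j; rewrite mxE. Qed.

(** The form in which flat_family_vanish is used: the functions
    A |-> tr (A L_i) - c_i vanish at 1 and their derivatives along the fields of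
    the group are combinations of them with coefficients C. *)
Lemma constant_traces r s (L : 'I_s -> mat) (c : 'I_s -> K) :
    [pchar K] =i pred0 ->
    (forall p q, vanish (@jset r) (p * q) -> vanish (@jset r) p \/ vanish (@jset r) q) ->
    (forall i, \tr (L i) = c i) ->
    (forall z, @jtan r z -> exists C : 'M[K]_s, forall A i, G A ->
       \tr (mcomp z 0 *m A *m L i) = \sum_j C i j * (\tr (A *m L j) - c j)) ->
  forall A i, G A -> \tr (A *m L i) = c i.
Proof.
move=> char0 prime L1 HC A i GA.
pose h i := linform (trform r.+1 0 (L i)) - (c i)%:MP.
have hE B j : (h j).@[jet d r.+1 (mxvec B) 0] = \tr (B *m L j) - c j.
  by rewrite /h mevalB mevalC linformE trformE mcomp_jet // jseq0.
suff : vanish (@jset r) (h i).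
  have SA : jset (jet d r.+1 (mxvec A)) by exists A.
  by move=> /(_ _ SA); rewrite hE => /eqP; rewrite subr_eq0 => /eqP.
apply: (flat_family_vanish (e := jid r) (fld := @jfield r)) => // {i A GA}.
- exact: jset1.
- by move=> v Tv; split; [apply: jid_field|apply: jfield_stable].
- by move=> i; rewrite hE mul1mx L1 subrr.
move=> v i /HC[C HCi]; exists (fun j => (C i j)%:MP) => _ [A GA ->].
have -> : Dfield (jfield v) (h i) = linform (jfield v *m trform r.+1 0 (L i)).
  by rewrite /h DfieldB DfieldC subr0 Dfield_linform.
rewrite mevalB linformE (big_morph _ (mevalD _) (meval0 _)) mulmxA jfieldE trformE.
rewrite mencK // jmul_at0 mcomp_jet // jseq0 HCi //; apply/eqP; rewrite subr_eq0; apply/eqP.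
by apply: eq_bigr => j _; rewrite mevalM mevalC hE.
Qed.

End OneGroup.

End JetGroups.

(** * Points of differentially finitely generated algebras *)


Section Transfer.

Variables (K : fieldType) (d : K -> K).
Hypothesis d_der : is_derivation d.
Hypothesis d_closed : delta_closed d.
Variables (E : fieldType) (dE : E -> E) (iota : {rmorphism K -> E}).
Hypothesis ext : diff_ext d dE iota.
Variables (M : nat) (x : 'I_M -> E) (g : 'I_M -> {mpoly K[M]}).
Hypothesis xg : forall l, dE (x l) = (map_mpoly iota (g l)).@[x].

(** The algebra generated by the x l is stable under the derivation, by xg. *)
Lemma mpoly_derivative (Q : {mpoly K[M]}) : exists Q' : {mpoly K[M]},
  forall (E1 : fieldType) (dE1 : E1 -> E1) (iota1 : {rmorphism K -> E1}) (y : 'I_M -> E1),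
    diff_ext d dE1 iota1 -> (forall l, dE1 (y l) = (map_mpoly iota1 (g l)).@[y]) ->
  dE1 (map_mpoly iota1 Q).@[y] = (map_mpoly iota1 Q').@[y].
Proof.
elim/mpoly_alg_ind: Q => [c|i|p q [p' Hp] [q' Hq]|p q [p' Hp] [q' Hq]].
- exists (d c)%:MP => E1 dE1 iota1 y [_ di] _.
  by rewrite !map_mpolyC !mevalC di.
- by exists (g i) => E1 dE1 iota1 y _ Hy; rewrite map_mpolyX mevalXU.
- exists (p' + q') => E1 dE1 iota1 y Ex Hy; case: (Ex) => dd1 _.
  by rewrite !rmorphD /= (derD dd1) (Hp _ _ _ _ Ex) // (Hq _ _ _ _ Ex).
- exists (p' * q + p * q') => E1 dE1 iota1 y Ex Hy; case: (Ex) => dd1 _.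
  by rewrite !(rmorphD, rmorphM) /= (derM dd1) (Hp _ _ _ _ Ex) // (Hq _ _ _ _ Ex).
Qed.

Lemma dterm_value n (W : 'I_n -> {mpoly K[M]}) (t : dterm K n) : exists Q : {mpoly K[M]},
  forall (E1 : fieldType) (dE1 : E1 -> E1) (iota1 : {rmorphism K -> E1}) (y : 'I_M -> E1),
    diff_ext d dE1 iota1 -> (forall l, dE1 (y l) = (map_mpoly iota1 (g l)).@[y]) ->
  teval dE1 iota1 (fun i => (map_mpoly iota1 (W i)).@[y]) t = (map_mpoly iota1 Q).@[y].
Proof.
elim: t => [c|i|a [Qa Ha] b [Qb Hb]|a [Qa Ha] b [Qb Hb]|a [Qa Ha]].
- by exists c%:MP => E1 dE1 iota1 y _ _; rewrite map_mpolyC mevalC.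
- by exists (W i).
- exists (Qa + Qb) => E1 dE1 iota1 y Ex Hy.
  by rewrite /= !rmorphD /= (Ha _ _ _ _ Ex) // (Hb _ _ _ _ Ex).
- exists (Qa * Qb) => E1 dE1 iota1 y Ex Hy.
  by rewrite /= !rmorphM /= (Ha _ _ _ _ Ex) // (Hb _ _ _ _ Ex).
- have [Q' HQ'] := mpoly_derivative Qa; exists Q' => E1 dE1 iota1 y Ex Hy.
  by rewrite /= (Ha _ _ _ _ Ex) // (HQ' _ _ _ _ Ex).
Qed.

(** The polynomial relations between the x l form an ideal with a finite basis, and
    every differential relation reduces to a polynomial one by means of xg.  So
    finitely many equations, together with xg and the inequation for b (through
    an extra unknown inverse to b), carry all relations from E to K. *)
Lemma differential_point (b : {mpoly K[M]}) : (map_mpoly iota b).@[x] != 0 ->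
  exists y : 'I_M -> K, b.@[y] != 0 /\
    forall n (W : 'I_n -> {mpoly K[M]}) r (p : {mpoly K[n * r]}),
      dev dE iota p (\row_i (map_mpoly iota (W i)).@[x]) = 0 ->
      deval d p (\row_i (W i).@[y]) = 0.
Proof.
move=> bx.
pose R (Q : {mpoly K[M]}) := (map_mpoly iota Q).@[x] = 0.
have idR : is_ideal R.
  split=> [|p q Rp Rq|c p Rp]; rewrite /R ?rmorph0 //.
    by rewrite !rmorphD /= Rp Rq addr0.
  by rewrite !rmorphM /= Rp mulr0.
have [gens Rgens Hgens] := hilbert_basis idR.
pose s := size gens; pose h (j : 'I_s) := gens`_j.
have Rh j : R (h j) by apply: Rgens; apply: mem_nth.
have d_id : diff_ext d d idfun by [].
pose V (l : 'I_M) : dterm K (M + 1) := TVar (lshift 1 l).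
have PT (Q : {mpoly K[M]}) := mpoly_of_poly_term Q V.
have /functional_choice [T HT] := PT.
pose t (i : 'I_(s + (M + 1))) : dterm K (M + 1) :=
  match split i with
  | inl j => T (h j)
  | inr k => match split k with
             | inl l => TSub (TDer (V l)) (T (g l))
             | inr _ => TSub (TMul (T b) (TVar (rshift M ord0))) (TConst 1)
             end
  end.
have [|y Hy] := @delta_closed_terms _ _ d_der d_closed _ _ t.
  exists E, dE, iota.
  exists (fun i => match split i with inl l => x l | inr _ => (map_mpoly iota b).@[x]^-1 end).
  set X := fun i => _.
  have XV l : teval dE iota X (V l) = x l by rewrite /= /X (unsplitK (inl l)).
  have TX Q : teval dE iota X (T Q) = (map_mpoly iota Q).@[x].
    by rewrite HT; apply: meval_eq => l; rewrite XV.
  split=> // i; rewrite /t; case: (split i) => [j|k]; first by rewrite TX Rh.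
  case: (split k) => [l|_]; rewrite teval_sub /=.
    by have := XV l; rewrite TX -xg /= => ->; rewrite subrr.
  by rewrite TX /X (unsplitK (inr _)) mulfV // rmorph1 subrr.
pose z l := y (lshift 1 l).
have TZ Q : teval d idfun y (T Q) = Q.@[z].
  by rewrite (HT Q _ d (idfun : {rmorphism K -> K})) map_mpoly_idfun.
have Rz Q : R Q -> Q.@[z] = 0.
  move=> /Hgens; apply: (ideal_span_sub (J := fun Q : {mpoly K[M]} => Q.@[z] = 0)).
    split=> [|p q Ip Iq|c p Ip]; first exact: meval0.
      by rewrite mevalD Ip Iq addr0.
    by rewrite mevalM Ip mulr0.
  move=> q /(nthP 0)[j ltj <-]; rewrite -TZ.
  by have := Hy (lshift _ (Ordinal ltj)); rewrite /t (unsplitK (inl _)).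
have zg l : d (z l) = (map_mpoly idfun (g l)).@[z].
  have := Hy (rshift s (lshift 1 l)); rewrite /t (unsplitK (inr _)) (unsplitK (inl l)).
  rewrite (teval_sub d (idfun : {rmorphism K -> K})) TZ map_mpoly_idfun.
  by move/eqP; rewrite subr_eq0 => /eqP.
exists z; split=> [|n W r p].
  have := Hy (rshift s (rshift M ord0)); rewrite /t !(unsplitK (inr _)).
  rewrite (teval_sub d (idfun : {rmorphism K -> K})) /= TZ => /eqP.
  by rewrite subr_eq0; apply: contraTneq => ->; rewrite mul0r eq_sym oner_eq0.
have [tp Htp] := dterm_of_mpoly p; have [Q HQ] := dterm_value W tp.
rewrite -Htp => Wx.
have {}Wx : R Q.
  rewrite /R -(HQ _ _ _ _ ext) // -[RHS]Wx; apply: teval_ext => i.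
  by rewrite mxE.
have := Rz _ Wx; have := HQ K d (idfun : {rmorphism K -> K}) z d_id zg.
rewrite map_mpoly_idfun => <- <-.
have <- : dev d (idfun : {rmorphism K -> K}) p (\row_i (W i).@[z]) = deval d p (\row_i (W i).@[z]).
  by rewrite /dev map_mpoly_idfun.
by rewrite -Htp; apply: teval_ext => i; rewrite mxE map_mpoly_idfun.
Qed.

End Transfer.

(** * One-parameter subgroups *)

Lemma map_meval_comp (K : fieldType) (R S : comNzRingType) (f : {rmorphism R -> S})
    (g : {rmorphism K -> R}) (h : {rmorphism K -> S}) M (p : {mpoly K[M]}) (x : 'I_M -> R) :
    (forall a, h a = f (g a)) ->
  (map_mpoly h p).@[fun i => f (x i)] = f (map_mpoly g p).@[x].
Proof.
move=> hE; elim/mpoly_alg_ind: p => [c|i|p q IHp IHq|p q IHp IHq].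
- by rewrite !map_mpolyC !mevalC; apply: hE.
- by rewrite (map_mpolyX h) (map_mpolyX g) !mevalXU.
- by rewrite !rmorphD /= IHp IHq.
- by rewrite !rmorphM /= IHp IHq.
Qed.

Section Flow.

Variables (K : fieldType) (M : nat) (N : 'M[K]_M) (u : nat -> 'rV[K]_M).
Hypothesis char0 : [pchar K] =i pred0.
Hypothesis uN : forall m, u m *m N = u m.+1 *+ m.+1.

(** The expansion of p along the curve sum_m u_m t^m.  It is locked because
    conversion would otherwise unfold the ring structure of power series. *)
Fact flow_key : unit. Proof. exact tt. Qed.

Definition flow_eval : {mpoly K[M]} -> powser K := locked_with flow_key
  (fun p => (map_mpoly (@ps_const K) p).@[fun i => (fun m => u m 0 i) : powser K]).

Lemma flow_evalE p : flow_eval p =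
  (map_mpoly (@ps_const K) p).@[fun i => (fun m => u m 0 i) : powser K].
Proof. by rewrite /flow_eval unlock. Qed.

Lemma flow_evalD p q : flow_eval (p + q) = flow_eval p + flow_eval q.
Proof. by rewrite !flow_evalE rmorphD mevalD. Qed.

Lemma flow_evalM p q : flow_eval (p * q) = flow_eval p * flow_eval q.
Proof. by rewrite !flow_evalE rmorphM mevalM. Qed.

Lemma flow_evalC c : flow_eval c%:MP = ps_const c.
Proof. by rewrite flow_evalE map_mpolyC mevalC. Qed.

Lemma flow_evalX i : flow_eval 'X_i = (fun m => u m 0 i).
Proof. by rewrite flow_evalE map_mpolyX mevalXU. Qed.

Lemma flow_eval_at0 p : flow_eval p 0 = p.@[u 0%N 0].
Proof.
elim/mpoly_alg_ind: p => [c|i|p q IHp IHq|p q IHp IHq].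
- by rewrite flow_evalC mevalC.
- by rewrite flow_evalX mevalXU.
- by rewrite flow_evalD mevalD ps_addE IHp IHq.
- by rewrite flow_evalM mevalM ps_mulE big_ord1 IHp IHq.
Qed.

Lemma ps_sumE I (s : seq I) (f : I -> powser K) k :
  (\sum_(i <- s) f i) k = \sum_(i <- s) f i k.
Proof. by elim: s => [|i s IHs]; rewrite ?big_nil // !big_cons ps_addE IHs. Qed.

Lemma flow_eval_linform w m : flow_eval (linform w) m = (u m *m w) 0 0.
Proof.
have F0 : flow_eval 0 = 0 by rewrite flow_evalE rmorph0 meval0.
rewrite (big_morph _ flow_evalD F0) ps_sumE mxE; apply: eq_bigr => j _.
by rewrite -mul_mpolyC flow_evalM flow_evalC flow_evalX ps_constM mulrC.
Qed.

Lemma flow_derivative p : ps_dt (flow_eval p) = flow_eval (Dfield N p).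
Proof.
have [dtD dtM] := ps_dt_derivation K.
elim/mpoly_alg_ind: p => [c|i|p q IHp IHq|p q IHp IHq].
- rewrite DfieldC -mpolyC0 !flow_evalC.
  by apply: ps_ext => -[|k]; rewrite /ps_dt /= mul0rn.
- rewrite DfieldX; apply: ps_ext => m; rewrite flow_eval_linform flow_evalX /ps_dt.
  have := congr1 (fun x : 'rV_M => x 0 i) (uN m); rewrite mulmxnE => <-.
  by rewrite !mxE; apply: eq_bigr => j _; rewrite mxE.
- rewrite DfieldD.
  rewrite (flow_evalD p q).
  rewrite (flow_evalD (Dfield N p)).
  rewrite -IHp -IHq.
  exact: dtD.
- rewrite DfieldM.
  rewrite (flow_evalM p q).
  rewrite (flow_evalD (Dfield N p * q)).
  rewrite (flow_evalM (Dfield N p)) (flow_evalM p).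
  rewrite -IHp -IHq.
  exact: dtM.
Qed.

(** All derivatives of p along the integral curve of N vanish at its origin, so
    the expansion of p along the curve is zero in characteristic 0. *)
Lemma flow_vanish (S : 'rV[K]_M -> Prop) p : S (u 0%N) ->
    (forall p, vanish S p -> vanish S (Dfield N p)) ->
  vanish S p -> flow_eval p = 0.
Proof.
move=> Su SN Sp.
have dt_coef (f : powser K) k : iter k (@ps_dt K) f 0%N = f k *+ k`!.
  have H j : iter j (@ps_dt K) f = fun i => f (i + j)%N *+ ((i + j) ^_ j).
    elim: j => [|j IHj]; first by apply: ps_ext => i; rewrite addn0 ffactn0.
    rewrite /= IHj; apply: ps_ext => i; rewrite /ps_dt addSnnS -mulrnA; congr (_ *+ _).
    by rewrite -addSnnS ffactnSr addSn -addSn addnK.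
  by rewrite H add0n ffactnn.
apply: ps_ext => k; rewrite ps_zeroE.
have kf0 : k`!%:R != 0 :> K by rewrite (proj1 (pcharf0P K) char0) -lt0n fact_gt0.
apply: (mulIf kf0); rewrite mul0r mulr_natr -dt_coef.
have -> : iter k (@ps_dt K) (flow_eval p) = flow_eval (iter k (Dfield N) p).
  elim: k {kf0} => [|k IHk]; first by [].
  by rewrite !iterS IHk flow_derivative.
rewrite flow_eval_at0.
suff : vanish S (iter k (Dfield N) p) by apply.
elim: k {kf0} => [|k IHk]; first by [].
by rewrite iterS; apply: SN.
Qed.

End Flow.

Section Exponential.

Variables (K : fieldType) (d : K -> K).
Hypothesis d_der : is_derivation d.
Hypothesis d_closed : delta_closed d.
Hypothesis char0 : [pchar K] =i pred0.

Variable n : nat.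
Local Notation mat := 'M[K]_n.+1.

Definition exp_coef (X : mat) m : mat := (m`!%:R)^-1 *: X ^+ m.

Lemma fact_neq0 m : m`!%:R != 0 :> K.
Proof. by rewrite (proj1 (pcharf0P K) char0) -lt0n fact_gt0. Qed.

Lemma exp_coefS X m : X *m exp_coef X m = exp_coef X m.+1 *+ m.+1.
Proof.
rewrite /exp_coef -scalemxAr -[X *m _]exprS scalerMnl; congr (_ *: _).
have S0 : m.+1%:R != 0 :> K by rewrite (proj1 (pcharf0P K) char0).
by rewrite -[RHS]mulr_natr factS natrM invfM mulrAC mulVf ?mul1r.
Qed.

(** The exponential of tX is a polynomial in t and finitely many exponentials
    exp(at), where a is an eigenvalue of X: on the generalized eigenspace of a
    only finitely many powers of X - a are nonzero. *)
Lemma exp_coef_spectral X (ls : seq K) (e : K -> mat) :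
    \sum_(a <- ls) e a = 1 -> (forall a, a \in ls -> exists N, (X - a%:M) ^+ N *m e a = 0) ->
  exists N, forall m, exp_coef X m = \sum_(a <- ls) \sum_(j < N)
    (if (j <= m)%N then a ^+ (m - j) / (m - j)`!%:R else 0) *:
      ((j`!%:R)^-1 *: ((X - a%:M) ^+ j *m e a)).
Proof.
move=> sum_e He.
have [N HN] : exists N, forall a, a \in ls -> (X - a%:M) ^+ N *m e a = 0.
  elim: ls He {sum_e} => [|a ls IHls] He; first by exists 0%N.
  have [N1 HN1] := He a (mem_head _ _).
  have [|N2 HN2] := IHls; first by move=> b lb; apply: He; rewrite inE lb orbT.
  exists (N1 + N2)%N => b; rewrite inE => /orP[/eqP->|/HN2 H].
    by rewrite addnC exprD -[_ * _]/(_ *m _) -mulmxA HN1 mulmx0.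
  by rewrite exprD -[_ * _]/(_ *m _) -mulmxA H mulmx0.
exists N => m; rewrite -[LHS]mulr1 -sum_e mulr_sumr big_seq [RHS]big_seq.
apply: eq_bigr => a la.
pose T j := if (j <= m)%N then (a ^+ (m - j) / (m - j)`!%:R) *:
      ((j`!%:R)^-1 *: ((X - a%:M) ^+ j *m e a)) else 0.
have T0 j : (N <= j)%N -> T j = 0.
  move=> leNj; rewrite /T; case: ifP => // _.
  have -> : (X - a%:M) ^+ j *m e a = 0.
    by rewrite -(subnK leNj) exprD -[_ * _]/(_ *m _) -mulmxA HN // mulmx0.
  by rewrite !scaler0.
have Tsum n1 n2 : (forall j, (n1 <= j)%N -> T j = 0) ->
    \sum_(j < n1 + n2) T j = \sum_(j < n1) T j.
  move=> H; rewrite big_split_ord /= [Y in _ + Y = _]big1 ?addr0 // => j _.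
  by rewrite H ?leq_addr.
transitivity (\sum_(j < N) T j); last first.
  by apply: eq_bigr => j _; rewrite /T; case: ifP; rewrite ?scale0r.
rewrite -(Tsum _ m.+1 T0) addnC Tsum => [|j ltmj]; last by rewrite /T leqNgt ltmj.
clear T0 Tsum.
have XE : exp_coef X m = (m`!%:R)^-1 *: (a%:M + (X - a%:M)) ^+ m.
  by rewrite [a%:M + _]addrC subrK.
have aX : GRing.comm (a%:M : mat) (X - a%:M) by exact: (esym (scalar_mxC _ _)).
rewrite XE (exprDn_comm _ aX).
rewrite -scalerAl mulr_suml scaler_sumr; apply: eq_bigr => j _.
have jm : (j <= m)%N by rewrite -ltnS.
rewrite /T jm -(rmorphXn (@scalar_mx K n.+1)) /= -[_%:M * _]/(_%:M *m _).
rewrite mul_scalar_mx -scaler_nat.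
rewrite -!scalerAl !scalerA.
congr (_ *: _); rewrite -(bin_fact jm) !natrM !invfM.
have C0 : 'C(m, j)%:R != 0 :> K by rewrite (proj1 (pcharf0P K) char0) -lt0n bin_gt0.
by field; rewrite C0 !fact_neq0.
Qed.

Lemma iter_derMn j (x : K) k : iter j d (x *+ k) = iter j d x *+ k.
Proof. by elim: j => // j IHj; rewrite !iterS IHj (derMn d_der). Qed.

(** The jets of the coefficients of exp(tX) form an integral curve of the field of
    the jet of X. *)
Lemma jet_exp_coef r X m :
  jet d r.+1 (mxvec (exp_coef X m)) *m jfield (jet d r.+1 (mxvec X)) =
  jet d r.+1 (mxvec (exp_coef X m.+1)) *+ m.+1.
Proof.
rewrite jfieldE.
transitivity (jet d r.+1 (mxvec (X *m exp_coef X m))); last first.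
  rewrite exp_coefS; apply/rowP => l; rewrite mulmxnE.
  case/mxvec_indexP: l => i j; rewrite !jetE.
  by case/mxvec_indexP: i => a b; rewrite !mxvecE mulmxnE iter_derMn.
rewrite -(jet_mulr d_der); apply: menc_ext => k ltk.
by apply: jmul_ext => l lel //; rewrite mcomp_jet // (leq_ltn_trans lel).
Qed.

Lemma ps_mul_shift (t f : powser K) k : (forall i, t i = (i == 1%N)%:R) ->
  (t * f) k = if k is k'.+1 then f k' else 0.
Proof.
move=> tE; rewrite ps_mulE; case: k => [|k]; first by rewrite big_ord1 tE mul0r.
rewrite big_ord_recl big_ord_recl tE mul0r add0r tE mul1r big1 ?addr0 => [|i _].
  by rewrite /bump /= subSS subn0.
by rewrite tE mul0r.
Qed.

(** The matrix exp(tX) satisfies the equations of G over K[[t]] with the derivation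
    acting on coefficients, by flow_vanish applied to jets of all orders.  It
    lies in a finitely generated algebra stable under the derivation, because d
    maps exp(at) to d(a) t exp(at) and t to 0; differential_point specializes it
    to K while keeping one entry different from that of 1. *)
Theorem exponential_point (G : mat -> Prop) (X : mat) : G 1%:M -> X != 0 ->
    (forall r p, vanish (@jset K d _ G r) p ->
       vanish (@jset K d _ G r) (Dfield (jfield (jet d r.+1 (mxvec X))) p)) ->
  exists A : mat, [/\ A != 1%:M,
    forall r p, vanish (@jset K d _ G r) p -> deval d p (mxvec A) = 0 &
    forall (L : mat) c,
      (forall m, \tr (exp_coef X m *m L) = if m is 0 then c else 0) -> \tr (A *m L) = c].
Proof.
move=> G1 nzX GX.
have closedK := delta_closed_alg_closed d_der char0 d_closed.
have [ls [_ _ Xls _]] := spectrum closedK X.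
have [e [sum_e _ ekill _]] := partition_of_unity Xls.
have [|N HN] := @exp_coef_spectral X (undup ls) e sum_e.
  by move=> a; rewrite mem_undup => /ekill; exists (size ls).
set l := undup ls in HN; pose m := size l.
pose u k : 'rV[K]_(m + 1) := \row_i
  match split i with inl i => l`_i ^+ k / k`!%:R | inr _ => (k == 1%N)%:R end.
pose T : {mpoly K[m + 1]} := 'X_(rshift m ord0).
pose Y (i : 'I_m) : {mpoly K[m + 1]} := 'X_(lshift 1 i).
pose ev := flow_eval u.
have evT k : ev T k = (k == 1%N)%:R.
  by rewrite /ev flow_evalX /u mxE (unsplitK (inr _)).
have evY i k : ev (Y i) k = l`_i ^+ k / k`!%:R.
  by rewrite /ev flow_evalX /u mxE (unsplitK (inl _)).
have evYT i j k : ev (Y i * T ^+ j) k =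
    if (j <= k)%N then l`_i ^+ (k - j) / (k - j)`!%:R else 0.
  elim: j k => [|j IHj] k; first by rewrite mulr1 evY subn0.
  rewrite exprS mulrCA /ev flow_evalM (ps_mul_shift _ _ evT).
  by case: k => // k; rewrite -/ev IHj subSS.
pose c (i : 'I_m) (j : 'I_N) : mat := (j`!%:R)^-1 *: ((X - (l`_i)%:M) ^+ j *m e l`_i).
pose W : 'M[{mpoly K[m + 1]}]_n.+1 := \matrix_(a, b)
  \sum_i \sum_(j < N) (c i j a b)%:MP * (Y i * T ^+ j).
have ev0 : ev 0 = 0 by rewrite /ev -mpolyC0 flow_evalC; apply: ps_ext => -[].
have evD : {morph ev : p q / p + q} by apply: flow_evalD.
have evW a b k : ev (W a b) k = exp_coef X k a b.
  rewrite mxE (big_morph ev evD ev0) ps_sumE HN (big_nth 0) big_mkord summxE.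
  apply: eq_bigr => i _; rewrite (big_morph ev evD ev0) ps_sumE summxE.
  apply: eq_bigr => j _; rewrite /ev flow_evalM flow_evalC ps_constM -/ev evYT.
  by rewrite [RHS]mxE mulrC.
pose PS := powser K; pose E := {fraction PS}.
have [dE [dE_der dE_frac]] := fraction_derivation (ps_coef_derivation d_der).
pose fr : {rmorphism PS -> E} := @FracField.tofrac PS.
pose iota : {rmorphism K -> E} := fr \o (@ps_const K).
have ext : diff_ext d dE iota.
  split=> // a; rewrite /iota /= /fr /= dE_frac; congr FracField.tofrac.
  by apply: ps_ext => -[|k] //; rewrite /ps_coef_der /= (der0 d_der).
pose x i := fr (ev 'X_i).
have xE M (u' : nat -> 'rV[K]_M) (Q : {mpoly K[M]}) :
    (map_mpoly iota Q).@[fun i => fr (flow_eval u' 'X_i)] = fr (flow_eval u' Q).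
  rewrite flow_evalE -(map_meval_comp (h := iota)) //; apply: meval_eq => i.
  by rewrite flow_evalX.
pose g (i : 'I_(m + 1)) : {mpoly K[m + 1]} :=
  match split i with inl i => (d l`_i)%:MP * (Y i * T ^+ 1) | inr _ => 0 end.
have xg i : dE (x i) = (map_mpoly iota (g i)).@[x].
  rewrite /x xE /fr /= dE_frac; congr FracField.tofrac; apply: ps_ext => k.
  rewrite /ps_coef_der /g -[in LHS](splitK i); case: (split i) => j /=.
    rewrite -/(Y j) evY flow_evalM flow_evalC ps_constM -/ev evYT.
    have dnat q : d (q%:R)^-1 = 0.
      have [->|nzq] := eqVneq (q%:R : K) 0; first by rewrite invr0 (der0 d_der).
      apply: (mulfI nzq); rewrite mulr0; have := derM d_der q%:R (q%:R)^-1.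
      by rewrite mulfV // (der1 d_der) (der_nat d_der) mul0r add0r.
    have dexp q : d (l`_j ^+ q) = d l`_j * (l`_j ^+ q.-1 *+ q).
      elim: q => [|q IHq]; first by rewrite (der1 d_der) mulr0.
      rewrite exprS (derM d_der) IHq; case: q {IHq} => [|q] /=; first by rewrite expr0 !mulr1n !mulr0 addr0.
      by rewrite exprS mulrSr mulrDr -mulrnAr; ring.
    rewrite (derM d_der) dnat mulr0 addr0 dexp.
    case: k => [|k] /=; first by rewrite !mulr0n !mulr0 mul0r.
    rewrite subSS subn0 factS natrM invfM -mulrA; congr (_ * _).
    have S0 : k.+1%:R != 0 :> K by rewrite (proj1 (pcharf0P K) char0).
    by rewrite -mulr_natr -mulrA [X in _ * X]mulrA mulfV // mul1r.
  rewrite [j]ord1 -/T evT -/ev ev0 ps_zeroE.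
  by case: eqP => _; rewrite ?(der1 d_der) ?(der0 d_der).
have [a0 [b0 Xab]] : exists a b, X a b != 0.
  apply: NNPP => no; case/eqP: nzX; apply/matrixP => a b; rewrite mxE.
  by apply/eqP/negPn/negP => H; apply: no; exists a, b.
pose b := W a0 b0 - ((1%:M : mat) a0 b0)%:MP.
have bx : (map_mpoly iota b).@[x] != 0.
  rewrite xE /fr /= tofrac_eq0; apply/eqP => /(congr1 (fun f : PS => f 1%N)).
  rewrite /b -mpolyCN -/ev evD ps_addE evW /ev flow_evalC addr0 /exp_coef factS fact0 muln1 invr1 scale1r expr1.
  by move/eqP; rewrite ps_zeroE (negPf Xab).
have [y [by0 yP]] := differential_point d_der d_closed ext xg bx.
pose A : mat := \matrix_(a, b) (W a b).@[y]; exists A; split.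
- apply: contraNneq by0 => A1; rewrite /b mevalB mevalC.
  by have := congr1 (fun B : mat => B a0 b0) A1; rewrite mxE => ->; rewrite subrr.
- move=> r p Ip.
  have := yP _ (fun i => mxvec W 0 i) _ p.
  have -> : \row_i (mxvec W 0 i).@[y] = mxvec A.
    by apply/rowP => i; rewrite [LHS]mxE; case/mxvec_indexP: i => i j; rewrite !mxvecE [RHS]mxE.
  apply; rewrite /dev.
  pose u' k := jet d r.+1 (mxvec (exp_coef X k)).
  transitivity (fr (flow_eval u' p)); last first.
    rewrite (flow_vanish char0 (jet_exp_coef r X) _ (GX r) Ip) ?rmorph0 //.
    by exists 1%:M => //; rewrite /u' /exp_coef fact0 invr1 scale1r expr0.
  rewrite -xE; apply: meval_eq => i; rewrite flow_evalX.
  case/mxvec_indexP: i => i j; rewrite jetE mxE xE /=.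
  have iterE q (f : PS) : iter q dE (fr f) = fr (fun k => iter q d (f k)).
    by elim: q => // q IHq; rewrite iterS IHq /fr /= dE_frac.
  rewrite iterE; apply: (congr1 fr); apply: ps_ext => k.
  rewrite /u' jetE; congr (iter _ _ _).
  by case/mxvec_indexP: i => i i'; rewrite !mxvecE -/ev evW.
move=> L q HL.
pose Q : {mpoly K[m + 1]} := \sum_a \sum_b (L b a)%:MP * W a b - q%:MP.
have evQ : ev Q = 0.
  apply: ps_ext => k; rewrite /Q -mpolyCN evD ps_addE /ev flow_evalC -/ev ps_zeroE.
  have -> : ev (\sum_a \sum_b (L b a)%:MP * W a b) k = \tr (exp_coef X k *m L).
    rewrite (big_morph ev evD ev0) ps_sumE; apply: eq_bigr => a _.
    rewrite (big_morph ev evD ev0) ps_sumE mxE; apply: eq_bigr => a' _.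
    by rewrite /ev flow_evalM flow_evalC ps_constM -/ev evW mulrC.
  by rewrite HL; case: k => [|k]; rewrite ?addr0 //= subrr.
have := yP 1%N (fun=> Q) 1%N 'X_(mxvec_index ord0 ord0).
rewrite devX mxE xE -/ev evQ rmorph0 => /(_ erefl).
rewrite /deval mevalXU jetE mxE /= /Q mevalB mevalC => /eqP; rewrite subr_eq0 => /eqP <-.
rewrite (big_morph _ (mevalD _) (meval0 _)); apply: eq_bigr => a _.
rewrite (big_morph _ (mevalD _) (meval0 _)) mxE; apply: eq_bigr => a' _.
by rewrite mevalM mevalC mxE mulrC.
Qed.

End Exponential.

(** * Jets of a representation of a matrix group *)

Lemma trace_entry (K : fieldType) n a b (B : 'M[K]_(a, n)) Z (C : 'M[K]_(n, b)) i j :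
  (B *m Z *m C) i j = \tr (Z *m (C *m delta_mx j i *m B)).
Proof.
rewrite !mulmxA mxtrace_mulC !mulmxA; move: (B *m Z *m C) => X.
rewrite /mxtrace (bigD1 i) //= mxE (bigD1 j) //= mxE !eqxx mulr1.
rewrite big1 => [|k /negPf nk]; last by rewrite mxE nk mulr0.
rewrite big1 ?addr0 // => k /negPf nk.
by rewrite mxE big1 // => l _; rewrite mxE nk andbF mulr0.
Qed.

Corollary exponential_kernel_point (K : fieldType) (d : K -> K) (n : nat)
    (G : 'M[K]_n -> Prop) (X : 'M[K]_n) :
    is_derivation d -> delta_closed d -> [pchar K] =i pred0 ->
    G 1%:M -> X != 0 ->
    (forall r p, vanish (@jset K d _ G r) p ->
       vanish (@jset K d _ G r) (Dfield (jfield (jet d r.+1 (mxvec X))) p)) ->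
  exists A : 'M[K]_n, [/\ A != 1%:M,
    forall r p, vanish (@jset K d _ G r) p -> deval d p (mxvec A) = 0 &
    forall a (B : 'M[K]_(a, n)), B *m X = 0 -> B *m A = B].
Proof.
move=> d_der d_closed char0; case: n G X => [|n] G X G1 nzX GX.
  by case/eqP: nzX; apply/matrixP => -[].
have [A [nA GA LA]] := exponential_point d_der d_closed char0 G1 nzX GX.
exists A; split=> // a B BX; apply/matrixP => i j.
have E Y : (B *m Y) i j = \tr (Y *m (1%:M *m delta_mx j i *m B)).
  by rewrite -trace_entry mulmx1.
rewrite E; apply: LA => m; rewrite -E /exp_coef -scalemxAr.
case: m => [|m].
  rewrite fact0 invr1 scale1r expr0.
  exact: (congr1 (fun M : 'M_(a, n.+1) => M i j) (mulmx1 B)).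
by rewrite exprS -[_ * _]/(_ *m _) mulmxA BX mul0mx scaler0 mxE.
Qed.

Section ConstantMatrices.

Variables (K : fieldType) (d : K -> K).
Hypothesis d_der : is_derivation d.

Lemma derM_mx a b c (B : 'M[K]_(a, b)) (C : 'M[K]_(b, c)) :
  map_mx d (B *m C) = map_mx d B *m C + B *m map_mx d C.
Proof.
apply/matrixP => i j; rewrite !mxE (der_sum d_der) -big_split.
by apply: eq_bigr => k _; rewrite (derM d_der) !mxE.
Qed.

Lemma derD_mx a b (B C : 'M[K]_(a, b)) : map_mx d (B + C) = map_mx d B + map_mx d C.
Proof. by apply/matrixP => i j; rewrite !mxE (derD d_der). Qed.

Lemma der0_mx a b : map_mx d (0 : 'M[K]_(a, b)) = 0.
Proof. by apply/matrixP => i j; rewrite !mxE (der0 d_der). Qed.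

Lemma der_delta_mx a b i j : map_mx d (delta_mx i j : 'M[K]_(a, b)) = 0.
Proof. by apply/matrixP => i' j'; rewrite !mxE (der_nat d_der). Qed.

Lemma der_scalar_mx a : map_mx d (1%:M : 'M[K]_a) = 0.
Proof. by apply/matrixP => i' j'; rewrite !mxE (der_nat d_der). Qed.

Lemma iter_map_mx a b k (B : 'M[K]_(a, b)) :
  map_mx (iter k d) B = iter k (map_mx d) B.
Proof. by elim: k => [|k IHk]; apply/matrixP => i j; rewrite ?iterS -?IHk !mxE. Qed.

Lemma const_mull a b c (B : 'M[K]_(a, b)) (C : 'M[K]_(b, c)) k : map_mx d B = 0 ->
  map_mx (iter k d) (B *m C) = B *m map_mx (iter k d) C.
Proof.
by move=> B0; rewrite !iter_map_mx; elim: k => //= k ->; rewrite derM_mx B0 mul0mx add0r.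
Qed.

Lemma const_mulr a b c (B : 'M[K]_(a, b)) (C : 'M[K]_(b, c)) k : map_mx d C = 0 ->
  map_mx (iter k d) (B *m C) = map_mx (iter k d) B *m C.
Proof.
by move=> C0; rewrite !iter_map_mx; elim: k => //= k ->; rewrite derM_mx C0 mulmx0 addr0.
Qed.

Lemma deval_dev n r (p : {mpoly K[n * r]}) x :
  dev d (idfun : {rmorphism K -> K}) p x = deval d p x.
Proof. by rewrite /dev map_mpoly_idfun. Qed.

Lemma dd_jets n r (p : {mpoly K[n * r]}) x z :
  dd p (jet d r x) z = \sum_(k < r) (dec z k *m (dgrad d p x k)^T) 0 0.
Proof.
rewrite /dd (reindex _ (curry_mxvec_bij n r)) /=.
transitivity (\sum_(i < n) \sum_(k < r)
    (p^`M(mxvec_index i k)).@[jet d r x 0] * z 0 (mxvec_index i k)).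
  by rewrite pair_bigA; apply: eq_bigr => -[i k] _.
rewrite exchange_big; apply: eq_bigr => k _ /=; rewrite mxE; apply: eq_bigr => i _.
by rewrite dec_index [_^T _ _]mxE /dgrad dec_index mxE mulrC.
Qed.

End ConstantMatrices.

Section Representation.

Variables (K : fieldType) (d : K -> K).
Hypothesis d_der : is_derivation d.
Variables (q v : nat) (G : 'M[K]_q -> Prop).
Hypothesis G1 : G 1%:M.
Hypothesis G_mul : forall A B, G A -> G B -> G (A *m B).
Hypothesis G_unit : forall A, G A -> A \in unitmx.
Hypothesis G_inv : forall A, G A -> G (invmx A).

Lemma tan_rel r k a b (B : 'M[K]_(a, q)) (C : 'M[K]_(q, b)) D z :
    map_mx d B = 0 -> map_mx d C = 0 -> (forall A, G A -> B *m A *m C = D) ->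
    (k < r.+1)%N -> @jtan K d q G r z ->
  B *m mcomp z k *m C = 0.
Proof.
move=> B0 C0 BAC ltk Tz; apply/matrixP => i j; rewrite trace_entry [RHS]mxE.
apply: (jtan_trace (G := G) (c := iter k d (D i j))) Tz => // A GA.
rewrite -trace_entry -(BAC A GA) /jseq -(const_mull d_der) // -(const_mulr d_der) //.
by rewrite mxE.
Qed.

Lemma tan_rel0 r a b (B : 'M[K]_(a, q)) (C : 'M[K]_(q, b)) D z :
    (forall A, G A -> B *m A *m C = D) -> @jtan K d q G r z ->
  B *m mcomp z 0 *m C = 0.
Proof.
move=> BAC Tz; apply/matrixP => i j; rewrite trace_entry [RHS]mxE.
apply: (jtan_trace (G := G) (c := D i j)) Tz => // A GA.
by rewrite jseq0 -trace_entry (BAC A GA).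
Qed.

Variables (iV : 'M[K]_(v, q)) (pV : 'M[K]_(q, v)).
Hypothesis iVd : map_mx d iV = 0.
Hypothesis pVd : map_mx d pV = 0.
Hypothesis iVpV : iV *m pV = 1%:M.

Definition vb (Z : 'M[K]_q) : 'M[K]_v := iV *m Z *m pV.

Hypothesis rep : forall A, G A -> iV *m A = vb A *m iV.

Definition image_group (g : 'M[K]_v) := exists2 A, G A & vb A = g.

Lemma vb1 : vb 1%:M = 1%:M.
Proof. by rewrite /vb mulmx1. Qed.

Lemma vb_mul X Y : iV *m X = vb X *m iV -> vb (X *m Y) = vb X *m vb Y.
Proof. by move=> EX; rewrite {1}/vb mulmxA EX /vb !mulmxA. Qed.

Lemma vb_lin a X Y : vb (a *: X + Y) = a *: vb X + vb Y.
Proof. by rewrite /vb mulmxDr mulmxDl -scalemxAr -scalemxAl. Qed.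

Lemma vb0 : vb 0 = 0.
Proof. by rewrite /vb mulmx0 mul0mx. Qed.

Lemma vbZ a X : vb (a *: X) = a *: vb X.
Proof. by rewrite -[a *: X]addr0 vb_lin vb0 addr0. Qed.

Lemma vb_sum I (s : seq I) (P : pred I) F :
  vb (\sum_(i <- s | P i) F i) = \sum_(i <- s | P i) vb (F i).
Proof.
apply: (big_morph vb _ vb0) => X Y.
by rewrite -[X]scale1r vb_lin !scale1r.
Qed.

Lemma vb_jseq A k : vb (jseq d A k) = jseq d (vb A) k.
Proof. by rewrite /jseq /vb (const_mulr d_der) // (const_mull d_der). Qed.

Lemma jseq_stable A k : G A -> iV *m jseq d A k = vb (jseq d A k) *m iV.
Proof.
by move=> GA; rewrite vb_jseq /jseq -(const_mull d_der) // rep // (const_mulr d_der).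
Qed.

Lemma tan_stable r z k : @jtan K d q G r z -> (k < r.+1)%N ->
  iV *m mcomp z k = vb (mcomp z k) *m iV.
Proof.
move=> Tz ltk; apply/eqP; rewrite -subr_eq0 /vb -mulmxA -{1}[iV *m _]mulmx1 -mulmxBr.
apply/eqP; apply: (tan_rel (D := 0)) Tz => // [|A GA].
  rewrite -scaleN1r (derD_mx d_der) (der_scalar_mx d_der) add0r -mul_scalar_mx.
  rewrite !(derM_mx d_der) iVd pVd mul0mx mulmx0 addr0 mulmx0 addr0.
  suff -> : map_mx d ((-1)%:M : 'M[K]_q) = 0 by rewrite mul0mx.
  by apply/matrixP => i j; rewrite !mxE (derMn d_der) (derN d_der) (der1 d_der) oppr0 mul0rn.
by rewrite mulmxBr mulmx1 !mulmxA -/(vb A) -rep // subrr.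
Qed.

Lemma image_group1 : image_group 1%:M.
Proof. by exists 1%:M => //; apply: vb1. Qed.

Lemma image_group_mul g h : image_group g -> image_group h -> image_group (g *m h).
Proof.
case=> [A GA <-] [B GB <-]; exists (A *m B); first exact: G_mul.
by rewrite vb_mul // rep.
Qed.

Lemma vb_inv A : G A -> vb A \in unitmx /\ vb (invmx A) = invmx (vb A).
Proof.
move=> GA; have E : vb A *m vb (invmx A) = 1%:M.
  by rewrite -vb_mul ?rep // mulmxV ?vb1 // G_unit.
have [U _] := mulmx1_unit E; split=> //.
by rewrite -[RHS]mulmx1 -E mulKmx.
Qed.

Lemma image_group_unit g : image_group g -> g \in unitmx.
Proof. by case=> A /vb_inv[U _] <-. Qed.

Lemma image_group_inv g : image_group g -> image_group (invmx g).
Proof.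
by case=> A GA <-; exists (invmx A); [apply: G_inv|case: (vb_inv GA)].
Qed.

Definition image_lie r (h : {vspace 'M[K]_v}) := forall X, X \in h <->
  exists2 z, @jtan K d q G r z & vb (mcomp z 0) = X.

Lemma image_lie_ex r : exists h, image_lie r h.
Proof.
apply: vspace_of_pred_ex => [|a _ _ [z Tz <-] [z' Tz' <-]].
  by exists 0; [apply: tangent0|rewrite /mcomp dec0 linear0 vb0].
by exists (a *: z + z'); [apply: tangent_lin|rewrite mcomp_lin vb_lin].
Qed.

Section ImageLie.

Variables (r : nat) (h : {vspace 'M[K]_v}).
Hypothesis hP : image_lie r h.

Lemma image_in_span X : X \in h -> in_span image_group X.
Proof.
move=> /hP[z Tz <-] L HL.
have trE Z : \tr (vb Z *m L) = \tr (Z *m (pV *m L *m iV)).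
  by rewrite /vb -2!mulmxA mxtrace_mulC !mulmxA.
rewrite trE; apply: (jtan_trace (G := G) (c := 0)) Tz => // A GA.
by rewrite jseq0 -trE HL //; exists A.
Qed.

Lemma image_conj : conj_stable image_group h.
Proof.
move=> _ X [A GA <-] /hP[z Tz <-]; apply/hP.
exists (jconj d A z); first exact: jtan_conj.
rewrite jconj_comp // !jmul_at0 !jseq0; have [_ <-] := vb_inv GA.
have GA' := G_inv GA; have sz := tan_stable Tz (ltn0Sn r).
have E : vb (invmx A *m mcomp z 0) = vb (invmx A) *m vb (mcomp z 0).
  by rewrite vb_mul // rep.
have sE : iV *m (invmx A *m mcomp z 0) = vb (invmx A *m mcomp z 0) *m iV.
  by rewrite E mulmxA rep // -mulmxA sz mulmxA.
by rewrite (vb_mul _ sE) E.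
Qed.

Lemma image_bracket : bracket_closed h.
Proof.
move=> _ _ /hP[z Tz <-] /hP[z' Tz' <-]; apply/hP.
have [y Ty Ey] := jtan_bracket d_der G1 G_mul Tz' Tz; exists y => //.
rewrite Ey addrC -scaleN1r vb_lin scaleN1r addrC.
by rewrite !vb_mul //; [apply: (tan_stable Tz')|apply: (tan_stable Tz)].
Qed.

End ImageLie.

(** The relations that hold on tangent jets with trivial image, at all orders
    together, form a submodule over the ring of linear differential operators.
    If it contained no relation z_0 = 0 for some coordinate, then by
    op_submodule_solution some nonzero X with trivial image would have all its
    jets tangent, and its exponential would be a nontrivial point of the kernel of
    the representation.  Otherwise finitely many relations of bounded order give
    the claim. *)
Theorem faithful_jets : delta_closed d -> [pchar K] =i pred0 ->
    (forall A, (forall r p, vanish (@jset K d _ G r) p -> deval d p (mxvec A) = 0) -> G A) ->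
    (forall A, G A -> vb A = 1%:M -> A = 1%:M) ->
  exists r, forall z, @jtan K d q G r z ->
    (forall k, (k < r.+1)%N -> vb (mcomp z k) = 0) -> mcomp z 0 = 0.
Proof.
move=> d_closed char0 G_closed faithful.
pose Bv : 'M[K]_(q * q, v * v) := linmx (fun x : 'rV[K]_(q * q) => mxvec (vb (vec_mx x))).
have BvE x : x *m Bv = mxvec (vb (vec_mx x)).
  by apply: linmxE => a u w; rewrite linearP /= vb_lin linearP.
have Bvd : map_mx d Bv = 0.
  apply/row_matrixP => i; rewrite -map_row row0 /Bv rowK map_mxvec.
  suff -> : map_mx d (vb (vec_mx (delta_mx 0 i))) = 0 by rewrite linear0.
  case/mxvec_indexP: i => i j; rewrite vec_mx_delta /vb !(derM_mx d_der) iVd pVd.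
  by rewrite (der_delta_mx d_der) !(mul0mx, mulmx0, addr0).
have BvTd : map_mx d Bv^T = 0 by rewrite -map_trmx Bvd trmx0.
pose one := mxvec (1%:M : 'M[K]_q).
pose cf (a : 'rV[{poly K}]_(q * q)) k : 'rV[K]_(q * q) := \row_i (a 0 i)`_k.
(* On a tangent jet z with trivial image the row a of operators annihilates z:
   the b k are multipliers of the equations vb (mcomp z k) = 0. *)
pose N a := exists r (p : {mpoly K[q * q * r.+1]}) (b : nat -> 'rV[K]_(v * v)),
  vanish (@jset K d _ G r) p /\ forall k, cf a k = dgrad d p one k + b k *m Bv^T.
have dev_vanish r (p : {mpoly K[q * q * r.+1]}) : vanish (@jset K d _ G r) p <->
    forall A, G A -> deval d p (mxvec A) = 0.
  split=> [Ip A GA|H _ [A GA ->]]; last exact: H.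
  by apply: Ip; exists A.
have lift r r' (p : {mpoly K[q * q * r.+1]}) : (r <= r')%N -> vanish (@jset K d _ G r) p ->
    exists2 p' : {mpoly K[q * q * r'.+1]}, vanish (@jset K d _ G r') p' &
      forall k, dgrad d p' one k = dgrad d p one k.
  move=> ler Ip; have [p' [Ep' Gp']] := lift_order d p (ler : (r.+1 <= r'.+1)%N).
  exists p' => //; apply/dev_vanish => A GA.
  by rewrite -deval_dev Ep' deval_dev; apply: (dev_vanish _ _).1.
have opN : op_submodule d N.
  split.
  - move=> a a' [r [p [b [Ip Ep]]]] [r' [p' [b' [Ip' Ep']]]].
    have [p1 Ip1 E1] := lift _ _ _ (leq_maxl r r') Ip.
    have [p2 Ip2 E2] := lift _ _ _ (leq_maxr r r') Ip'.
    exists (maxn r r'), (p1 + p2), (fun k => b k + b' k); split.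
      by case: (vanish_ideal (@jset K d _ G (maxn r r'))) => _ H _; apply: H.
    move=> k; rewrite dgradD E1 E2 mulmxDl addrACA -Ep -Ep'.
    by apply/rowP => i; rewrite !mxE coefD.
  - move=> c a [r [p [b [Ip Ep]]]]; exists r, (c%:MP * p), (fun k => c *: b k); split.
      by case: (vanish_ideal (@jset K d _ G r)) => _ _ H; apply: H.
    move=> k; rewrite dgradM dgradC scaler0 add0r /deval mevalC -scalemxAl -scalerDr -Ep.
    by apply/rowP => i; rewrite !mxE mul_polyC coefZ.
  move=> a [r [p [b [Ip Ep]]]]; have [p' [Ep' Gp']] := total_derivative d_der p.
  exists r.+1, p', (fun k => map_mx d (b k) + if k is k'.+1 then b k' else 0); split.
    apply/dev_vanish => A GA; rewrite -deval_dev Ep' // deval_dev.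
    by rewrite (dev_vanish _ _).1 // (der0 d_der).
  move=> k; have -> : cf (map_mx (dcomp d) a) k =
      map_mx d (cf a k) + if k is k'.+1 then cf a k' else 0.
    by apply/rowP => i; rewrite !mxE (coef_dcomp d_der); case: k => [|k]; rewrite !mxE.
  rewrite Gp' mulmxDl addrACA Ep (derD_mx d_der) (derM_mx d_der) BvTd mulmx0 addr0.
  case: k => [|k]; last by rewrite Ep.
  by rewrite mul0mx !addr0.
have [allN|[i0 Ni0]] : (forall i, N (delta_mx 0 i)) \/ exists i, ~ N (delta_mx 0 i).
  have [|no] := classic (exists i, ~ N (delta_mx 0 i)); [by right|left=> i].
  by apply: NNPP => H; apply: no; exists i.
- have /functional_choice[rr Hrr] := allN.
  exists (\max_i rr i)%N => z Tz vz; apply: (can_inj mxvecK); rewrite linear0.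
  apply/rowP => i; rewrite [RHS]mxE.
  have [p [b [Ip Ep]]] := Hrr i.
  have [p' Ip' E'] := lift _ _ _ (leq_bigmax i) Ip.
  have := Tz p' Ip'; rewrite /jid dd_jets.
  rewrite (eq_bigr (fun k : 'I_(_.+1) => if k == ord0 then dec z 0 0 i else 0)); last first.
    move=> k _; rewrite E' (_ : dgrad d p one k = cf (delta_mx 0 i) k - b k *m Bv^T); last first.
      by rewrite Ep addrK.
    rewrite linearB /= mulmxBr trmx_mul trmxK mulmxA BvE -/(mcomp z k) vz //.
    rewrite linear0 mul0mx subr0.
    have -> : cf (delta_mx 0 i) k = if k == ord0 then delta_mx 0 i else 0.
      apply/rowP => j; case: eqP => [->|/eqP nk]; rewrite !mxE eqxx.
        by case: (j == i); rewrite ?coef1 ?coef0.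
      have /negPf nk0 : (k != 0 :> nat)%N by [].
      by case: (j == i); rewrite ?coef1 ?coef0 ?nk0.
    case: eqP => [->|_]; last by rewrite trmx0 mulmx0 mxE.
    by rewrite trmx_delta -colE [LHS]mxE.
  rewrite -big_mkcond big_pred1_eq /mcomp => {1}<-.
  by rewrite vec_mxK.
have [X nzX NX] := op_submodule_solution d_der char0 d_closed opN Ni0.
have opE' (a : 'rV[{poly K}]_(q * q)) (Y : 'rV[K]_(q * q)) n : (forall i, (size (a ord0 i) <= n)%N) ->
    oppair d a Y = \sum_(k < n) (map_mx (iter k d) Y *m (cf a k)^T) 0 0.
  move=> sz; under [RHS]eq_bigr do rewrite mxE.
  rewrite exchange_big; apply: eq_bigr => i _ /=.
  rewrite (opd_wide _ _ (sz i)); apply: eq_bigr => k _.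
  by rewrite !mxE mulrC.
have TX r : @jtan K d q G r (jet d r.+1 X).
  move=> p Ip; rewrite /jid dd_jets.
  pose a : 'rV[{poly K}]_(q * q) := \row_i \poly_(k < r.+1) dgrad d p one k 0 i.
  have cfa k : cf a k = dgrad d p one k.
    apply/rowP => i; rewrite [LHS]mxE [a _ _]mxE coef_poly; case: ltnP => // lek.
    by rewrite /dgrad dec_out // mxE.
  have Na : N a by exists r, p, (fun=> 0); split=> // k; rewrite mul0mx addr0; apply: cfa.
  have sa i : (size (a ord0 i) <= r.+1)%N by rewrite mxE size_poly.
  rewrite -[RHS](NX a Na) (opE' a X r.+1 sa).
  apply: eq_bigr => k _; rewrite cfa jet_enc encK //.
have vX : vb (vec_mx X) = 0.
  apply: (can_inj mxvecK); rewrite linear0 -BvE; apply/rowP => j; rewrite [RHS]mxE.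
  pose a : 'rV[{poly K}]_(q * q) := \row_i (Bv i j)%:P.
  have cfa k : cf a k = if k is 0 then (delta_mx 0 j) *m Bv^T else 0.
    apply/rowP => i; rewrite !mxE coefC; case: k => [|k] /=; last by rewrite mxE.
    by rewrite -rowE !mxE.
  have <- : oppair d a X = 0.
    apply: NX; exists 0%N, 0, (fun k => if k is 0 then delta_mx 0 j else 0); split.
      by case: (vanish_ideal (@jset K d _ G 0)).
    move=> k; rewrite cfa -mpolyC0 dgradC add0r.
    by case: k => // k; rewrite mul0mx.
  rewrite (opE' a X 1%N) => [|i]; last by rewrite mxE size_polyC_leq1.
  rewrite big_ord1 cfa !mxE; apply: eq_bigr => i _.
  by rewrite -rowE !mxE.
have [||A [nA HA BA]] := @exponential_kernel_point _ d _ G (vec_mx X) d_der d_closed char0 G1.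
- by apply: contraNneq nzX => H; rewrite -[X]vec_mxK H linear0.
- by move=> r p Ip; rewrite vec_mxK; apply: jfield_stable.
case/eqP: nA; apply: faithful; first exact: G_closed.
have iX : iV *m vec_mx X = 0.
  have := tan_stable (TX 0%N) (ltn0Sn 0).
  have -> : mcomp (jet d 1 X) 0 = vec_mx X.
    by rewrite /mcomp jet_enc encK //; congr vec_mx; apply/rowP => i; rewrite mxE.
  by rewrite vX mul0mx.
by rewrite /vb BA.
Qed.

End Representation.

(** * Stable subspaces of the Lie algebra of a reductive group *)

Lemma linear_of_relation (K : fieldType) (U : vectType K) (V : lmodType K)
    (R : U -> V -> Prop) (h : {vspace U}) :
    R 0 0 -> (forall a x y u w, R x u -> R y w -> R (a *: x + y) (a *: u + w)) ->
    (forall u, R 0 u -> u = 0) -> (forall x, x \in h -> exists u, R x u) ->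
  exists f : U -> V, (forall a x y, f (a *: x + y) = a *: f x + f y) /\
    forall x u, x \in h -> R x u -> f x = u.
Proof.
move=> R0 Rlin Rfun Rex.
have [|u Ru] := functional_choice (fun (i : 'I_(\dim h)) => R (vbasis h)`_i).
  by move=> i; apply: Rex; apply: vbasis_mem; rewrite mem_nth // size_tuple.
exists (fun x => \sum_i coord (vbasis h) i x *: u i); split=> [a x y|x w hx Rxw].
  rewrite scaler_sumr -big_split; apply: eq_bigr => i _.
  by rewrite linearP /= scalerDl scalerA.
have RS I (s : seq I) c (X : I -> U) (Y : I -> V) : (forall i, R (X i) (Y i)) ->
    R (\sum_(i <- s) c i *: X i) (\sum_(i <- s) c i *: Y i).
  by move=> RXY; elim: s => [|i s IHs]; rewrite ?big_nil ?big_cons //; apply: Rlin.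
have := RS _ (index_enum 'I_(\dim h)) (fun i => coord (vbasis h) i x) _ _ Ru.
rewrite -(coord_vbasis hx) => /(Rlin (-1) _ _ _ _ Rxw); rewrite scaleN1r addNr.
by move=> /Rfun/eqP; rewrite scaleN1r addrC subr_eq0 => /eqP.
Qed.

Section TraceForm.

Variables (K : fieldType) (v : nat).
Local Notation mat := 'M[K]_v.
Implicit Types (h : {vspace mat}) (P : mat).

Lemma mxtrace_bracket (X Y W : mat) :
  \tr ((X *m Y - Y *m X) *m W) = \tr (X *m (Y *m W - W *m Y)).
Proof.
rewrite mulmxBl mulmxBr !linearB /=; congr (_ - _); first by rewrite mulmxA.
by rewrite -mulmxA mxtrace_mulC !mulmxA.
Qed.

(** The matrix of the form tr (P X Y) in a basis of h. *)
Definition gram h P : 'M[K]_(\dim h) :=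
  \matrix_(i, j) \tr (P *m (vbasis h)`_i *m (vbasis h)`_j).

Lemma vbasis_in h (i : 'I_(\dim h)) : (vbasis h)`_i \in h.
Proof. by apply: vbasis_mem; rewrite mem_nth // size_tuple. Qed.

Lemma gram_comb h P (a : 'rV_(\dim h)) (j : 'I_(\dim h)) :
  \tr (P *m (\sum_i a 0 i *: (vbasis h)`_i) *m (vbasis h)`_j) = (a *m gram h P) 0 j.
Proof.
rewrite mulmx_sumr mulmx_suml linear_sum mxE; apply: eq_bigr => i _.
by rewrite -scalemxAr -scalemxAl linearZ /= mxE.
Qed.

Lemma trace_basis h (X : mat) : (forall j : 'I_(\dim h), \tr (X *m (vbasis h)`_j) = 0) ->
  forall Y, Y \in h -> \tr (X *m Y) = 0.
Proof.
move=> H Y hY; rewrite (coord_vbasis hY) mulmx_sumr linear_sum big1 // => j _.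
by rewrite -scalemxAr linearZ /= H mulr0.
Qed.

Lemma gram_unit h P :
    (forall X, X \in h -> (forall Y, Y \in h -> \tr (P *m X *m Y) = 0) -> X = 0) ->
  gram h P \in unitmx.
Proof.
move=> nondeg; rewrite -row_free_unit -kermx_eq0; apply/rowV0P => a /sub_kermxP ag.
have X0 : \sum_i a 0 i *: (vbasis h)`_i = 0.
  apply: nondeg; first by apply: memv_suml => i _; apply: memvZ; apply: vbasis_in.
  by apply: trace_basis => j; rewrite gram_comb ag mxE.
apply/rowP => i; rewrite mxE.
by have /freeP/(_ (fun i => a 0 i) X0 i) := basis_free (vbasisP h).
Qed.

Lemma gram_decomp h X : gram h 1%:M \in unitmx ->
  exists2 Y, Y \in h & forall Z, Z \in h -> \tr ((X - Y) *m Z) = 0.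
Proof.
move=> gU; pose t : 'rV_(\dim h) := \row_j \tr (X *m (vbasis h)`_j).
pose a := t *m invmx (gram h 1%:M).
exists (\sum_i a 0 i *: (vbasis h)`_i).
  by apply: memv_suml => i _; apply: memvZ; apply: vbasis_in.
apply: trace_basis => j; rewrite mulmxBl linearB /=.
have := gram_comb 1%:M a j; rewrite mul1mx => ->.
by rewrite /a mulmxKV // mxE subrr.
Qed.

(** In matrix terms: S g S^T = g implies S^T g^-1 S = g^-1. *)
Lemma gram_inv_invariant h P (sigma : mat -> mat) (V : lmodType K) (beta : mat -> mat -> V) :
    gram h P \in unitmx ->
    (forall a X Y, sigma (a *: X + Y) = a *: sigma X + sigma Y) ->
    (forall X, X \in h -> sigma X \in h) ->
    (forall X Y, X \in h -> Y \in h ->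
       \tr (P *m sigma X *m sigma Y) = \tr (P *m X *m Y)) ->
    (forall a X X' Y, beta (a *: X + X') Y = a *: beta X Y + beta X' Y) ->
    (forall a X Y Y', beta X (a *: Y + Y') = a *: beta X Y + beta X Y') ->
  \sum_i \sum_j invmx (gram h P) i j *: beta (sigma (vbasis h)`_i) (sigma (vbasis h)`_j) =
  \sum_i \sum_j invmx (gram h P) i j *: beta (vbasis h)`_i (vbasis h)`_j.
Proof.
move=> gU slin sh str bl br.
have lin0 (U1 U2 : lmodType K) (f : U1 -> U2) :
    (forall a x y, f (a *: x + y) = a *: f x + f y) ->
    forall I (s : seq I) c F, f (\sum_(i <- s) c i *: F i) = \sum_(i <- s) c i *: f (F i).
  move=> flin I s c F; have f0 : f 0 = 0.
    by have := flin (-1) 0 0; rewrite scaler0 add0r scaleN1r addNr.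
  by elim: s => [|i s IHs]; rewrite ?big_nil ?big_cons // flin IHs.
pose S : 'M[K]_(\dim h) := \matrix_(i, k) coord (vbasis h) k (sigma (vbasis h)`_i).
have sE (i : 'I_(\dim h)) : sigma (vbasis h)`_i = \sum_k S i k *: (vbasis h)`_k.
  rewrite {1}(coord_vbasis (sh _ (vbasis_in i))); apply: eq_bigr => k _.
  by rewrite mxE.
have SgS : S *m gram h P *m S^T = gram h P.
  apply/matrixP => i j; rewrite [RHS]mxE -str ?vbasis_in // [in RHS](sE i) [in RHS](sE j).
  rewrite mulmx_sumr linear_sum mxE; apply: eq_bigr => k _ /=.
  have -> : \sum_k0 S i k0 *: (vbasis h)`_k0 = \sum_k0 (row i S) 0 k0 *: (vbasis h)`_k0.
    by apply: eq_bigr => k0 _; rewrite [row i S 0 k0]mxE.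
  by rewrite -scalemxAr linearZ /= gram_comb -row_mul !mxE mulrC.
have [SU _] : S \in unitmx /\ gram h P *m S^T \in unitmx.
  by apply/andP; rewrite -unitmx_mul mulmxA SgS.
have SBS : S^T *m invmx (gram h P) *m S = invmx (gram h P).
  have STU : S^T \in unitmx by rewrite unitmx_tr.
  have := congr1 (fun M => S^T *m invmx M *m S) SgS.
  rewrite /= => <-; set g := gram h P in gU *.
  have E : (S *m g *m S^T) *m (invmx (S^T) *m invmx g *m invmx S) = 1%:M.
    rewrite !mulmxA -[_ *m S^T *m _]mulmxA mulmxV // mulmx1.
    by rewrite -[_ *m g *m _]mulmxA mulmxV // mulmx1 mulmxV.
  have [U1 _] := mulmx1_unit E.
  have -> : invmx (S *m g *m S^T) = invmx S^T *m invmx g *m invmx S.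
    by rewrite -[LHS]mulmx1 -E mulKmx.
  by rewrite !mulmxA mulmxV // mul1mx -mulmxA mulVmx // mulmx1.
under eq_bigr => i _ do under eq_bigr => j _ do
  rewrite (sE i) (sE j) (lin0 _ _ (fun X => beta X _) (fun a X X' => bl a X X' _)).
under eq_bigr => i _ do under eq_bigr => j _ do
  under eq_bigr => k _ do rewrite (lin0 _ _ (beta (vbasis h)`_k) (fun a X X' => br a _ X X')).
transitivity (\sum_k \sum_l (\sum_i \sum_j S i k * invmx (gram h P) i j * S j l) *:
    beta (vbasis h)`_k (vbasis h)`_l).
  under [LHS]eq_bigr => i _.
    under eq_bigr => j _.
      rewrite scaler_sumr; under eq_bigr => k _ do rewrite scalerA scaler_sumr.
      over.
    rewrite exchange_big /=.
    over.
  rewrite exchange_big /=; apply: eq_bigr => k _.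
  under [RHS]eq_bigr => l _.
    rewrite scaler_suml; under eq_bigr => i _ do rewrite scaler_suml.
    over.
  rewrite [RHS]exchange_big; apply: eq_bigr => i _ /=.
  rewrite [RHS]exchange_big; apply: eq_bigr => j _ /=.
  by apply: eq_bigr => l _; rewrite scalerA (mulrC (S i k)).
apply: eq_bigr => k _; apply: eq_bigr => l _; congr (_ *: _).
rewrite -[in RHS]SBS [RHS]mxE [LHS]exchange_big; apply: eq_bigr => j _ /=.
rewrite [(_ *m _) _ _]mxE mulr_suml; apply: eq_bigr => i _.
by rewrite [S^T _ _]mxE.
Qed.

Lemma memv_trace h Z :
  (forall L, (forall Y, Y \in h -> \tr (Y *m L) = 0) -> \tr (Z *m L) = 0) -> Z \in h.
Proof.
move=> H; suff /eqP : Z - projv h Z = 0 by rewrite subr_eq0 => /eqP->; apply: memv_proj.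
apply/matrixP => i j.
pose f : 'End(mat) := (\1 - projv h)%VF.
have fE X : f X = X - projv h X by rewrite add_lfunE opp_lfunE id_lfunE.
pose L : mat := \matrix_(b, a) f (delta_mx a b) i j.
have LE X : \tr (X *m L) = (X - projv h X) i j.
  rewrite -fE {2}[X]matrix_sum_delta linear_sum summxE.
  apply: eq_bigr => a _; rewrite mxE linear_sum summxE.
  by apply: eq_bigr => b _; rewrite linearZ /= !mxE.
by rewrite -LE mxE; apply: H => Y hY; rewrite LE projv_id // subrr mxE.
Qed.

End TraceForm.

(** If an eigenvalue a were nonzero, a polynomial equal to 1 at a and to 0 at 0 and
    at the other eigenvalues would have as trace the multiplicity of a. *)
Lemma nilpotent_of_traces (K : fieldType) v (Y : 'M[K]_v.+1) :
    alg_closed K -> [pchar K] =i pred0 ->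
  (forall k, \tr (Y ^+ k.+1) = 0) -> exists m, Y ^+ m = 0.
Proof.
move=> closedK char0 trY.
have [ls [_ trp Yls _]] := spectrum closedK Y.
exists (size ls); apply: all_eigenvalues_zero Yls _ => a la.
apply/eqP/negPn/negP => nza.
have [Q HQ] := interpolation (fun b => (b == a)%:R) 1 (undup_uniq (0 :: ls)).
have QE b : b \in 0 :: ls -> Q.[b] = (b == a)%:R.
  move=> lb; have := HQ b; rewrite mem_undup => /(_ lb); rewrite expr1 dvdp_XsubCl.
  by rewrite /root !hornerE subr_eq0 => /eqP.
have := trp Q; have -> : \tr (horner_mx Y Q) = 0.
  have Q0 : Q`_0 = 0.
    have := QE 0; rewrite horner_coef0 mem_head => /(_ isT) ->.
    by rewrite eq_sym (negPf nza).
  rewrite -[Q]coefK poly_def rmorph_sum /= linear_sum big1 // => -[k ltk] _ /=.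
  rewrite linearZ /= linearZ /= rmorphXn /= horner_mx_X.
  by case: k ltk => [|k] _; rewrite ?Q0 ?mul0r // trY mulr0.
rewrite big_seq (eq_bigr (fun b => (b == a)%:R)) => [|b lb]; last first.
  by rewrite QE // inE lb orbT.
rewrite -big_seq -natr_sum => /esym/eqP; rewrite (proj1 (pcharf0P K) char0).
have -> : (\sum_(b <- ls) (b == a))%N = count_mem a ls.
  by elim: (ls) => [|b l IHl]; rewrite ?big_nil ?big_cons ?IHl.
by rewrite eqn0Ngt -has_count has_pred1 la.
Qed.

Section ImageReplica.

Variables (K : fieldType) (d : K -> K).
Hypothesis d_der : is_derivation d.
Variables (q v : nat) (G : 'M[K]_q -> Prop).
Hypothesis G1 : G 1%:M.
Hypothesis G_mul : forall A B, G A -> G B -> G (A *m B).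
Variables (iV : 'M[K]_(v.+1, q)) (pV : 'M[K]_(q, v.+1)).
Hypothesis iVd : map_mx d iV = 0.
Hypothesis pVd : map_mx d pV = 0.
Hypothesis iVpV : iV *m pV = 1%:M.
Hypothesis rep : forall A, G A -> iV *m A = vb iV pV A *m iV.

Lemma image_replica r h : alg_closed K -> image_lie d G iV pV r h -> replica_closed h.
Proof.
move=> closedK hP _ /hP[z Tz <-].
have q0 : (0 < q)%N.
  rewrite lt0n; apply/eqP => q0; have : (v.+1 <= q)%N.
    rewrite -(mxrank1 K v.+1) -iVpV; apply: leq_trans (mxrankM_maxl _ _) _.
    exact: rank_leq_col.
  by rewrite q0.
have sz := tan_stable d_der iVd pVd rep Tz (ltn0Sn r).
have vbX k : vb iV pV (iter k (mulmx (mcomp z 0)) 1%:M) =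
    iter k (mulmx^~ (vb iV pV (mcomp z 0))) 1%:M.
  have -> : iter k (mulmx^~ (vb iV pV (mcomp z 0))) 1%:M = iter k (mulmx (vb iV pV (mcomp z 0))) 1%:M.
    elim: k => // k IHk; rewrite !iterS IHk; elim: k {IHk} => [|k IHk]; first by rewrite mulmx1 mul1mx.
    by rewrite !iterS -mulmxA IHk.
  elim: k => [|k IHk]; first by rewrite /vb mulmx1.
  by rewrite !iterS vb_mul // IHk.
have hornerE p : horner_mx (vb iV pV (mcomp z 0)) p =
    vb iV pV (\sum_(k < size p) p`_k *: iter k (mulmx (mcomp z 0)) 1%:M).
  rewrite -[LHS]mul1mx (horner_mx_act _ (1%:M : 'M_v.+1)) vb_sum; apply: eq_bigr => k _.
  by rewrite -vbX vbZ.
have [ls [Hls Hfs]] := jtan_replica d_der G1 G_mul closedK q0 Tz.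
exists ls; split; first by rewrite hornerE Hls vb0.
move=> fs /Hfs[p [pls [z' Tz' Ez']]]; exists p; split=> //.
by apply/hP; exists z' => //; rewrite Ez' hornerE.
Qed.

End ImageReplica.

Section Reductive.

Variables (K : fieldType) (d : K -> K).
Hypothesis d_der : is_derivation d.
Hypothesis closedK : alg_closed K.
Hypothesis char0 : [pchar K] =i pred0.
Variable v : nat.
Local Notation mat := 'M[K]_v.+1.
Variable G : mat -> Prop.
Hypothesis G1 : G 1%:M.
Hypothesis G_mul : forall A B, G A -> G B -> G (A *m B).
Hypothesis G_unit : forall A, G A -> A \in unitmx.
Hypothesis G_inv : forall A, G A -> G (invmx A).
Hypothesis irr : forall p q : {mpoly K[v.+1 * v.+1 * 1]},
  vanish (@jset K d _ G 0) (p * q) ->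
  vanish (@jset K d _ G 0) p \/ vanish (@jset K d _ G 0) q.
Hypothesis ss : semisimple_rows G.
Variable g : {vspace mat}.
Hypothesis gP : forall X, X \in g <-> exists2 z, @jtan K d _ G 0 z & mcomp z 0 = X.

Let vb_id (X : mat) : vb 1%:M 1%:M X = X. Proof. by rewrite /vb mul1mx mulmx1. Qed.
Let G_id : image_group G 1%:M 1%:M = G.
Proof.
apply: functional_extensionality => A; apply: boolp.propext; split=> [[B GB <-]|GA].
  by rewrite vb_id.
by exists A.
Qed.
Let gI : image_lie d G 1%:M 1%:M 0 g.
Proof.
by move=> X; rewrite gP; split=> -[z Tz <-]; exists z.
Qed.
Let rep A : G A -> 1%:M *m A = vb 1%:M 1%:M A *m 1%:M.
Proof. by rewrite vb_id mul1mx mulmx1. Qed.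
Let d1 : map_mx d (1%:M : mat) = 0 := der_scalar_mx d_der v.+1.

Lemma lie_in_span X : X \in g -> in_span G X.
Proof. by rewrite -[X in in_span X]G_id; apply: (image_in_span gI). Qed.

Lemma lie_conj : conj_stable G g.
Proof.
rewrite -[X in conj_stable X]G_id; apply: (image_conj d_der G_mul G_unit G_inv d1 d1 _ rep gI).
by rewrite mulmx1.
Qed.

Lemma lie_bracket : bracket_closed g.
Proof. exact: (image_bracket d_der G1 G_mul d1 d1 rep gI). Qed.

Lemma lie_replica : replica_closed g.
Proof.
by apply: (image_replica d_der G1 G_mul d1 d1 _ rep closedK gI); rewrite mulmx1.
Qed.

Lemma generic_value (A : mat) (M : 'M[{mpoly K[v.+1 * v.+1 * 1]}]_v.+1) :
    (forall i j, M i j = 'X_(mxvec_index (mxvec_index i j) ord0)) ->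
  map_mx (meval (jet d 1 (mxvec A) 0)) M = A.
Proof.
by move=> ME; apply/matrixP => i j; rewrite mxE ME mevalXU jetE mxvecE.
Qed.

(** Stability under conjugation is expressed by the polynomial functions
    det(g) tr(g^-1 X g L) on the group, with L orthogonal to h; their differential
    at 1 in the direction W is tr ((X W - W X) L). *)
Lemma ad_stable (h : {vspace mat}) X W : conj_stable G h -> X \in h -> W \in g ->
  X *m W - W *m X \in h.
Proof.
move=> hG hX /gP[z Tz <-]; apply: memv_trace => L HL.
pose R := {mpoly K[v.+1 * v.+1 * 1]}.
pose Xg : 'M[R]_v.+1 := \matrix_(i, j) 'X_(mxvec_index (mxvec_index i j) ord0).
pose C (Y : mat) : 'M[R]_v.+1 := map_mx (@mpolyC _ K) Y.
have evXg A : map_mx (meval (jet d 1 (mxvec A) 0)) Xg = A.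
  by apply: generic_value => i j; rewrite mxE.
have evC A Y : map_mx (meval (jet d 1 (mxvec A) 0)) (C Y) = Y.
  by apply/matrixP => i j; rewrite !mxE mevalC.
pose M := \adj Xg *m C X *m Xg *m C L.
have Itr : vanish (@jset K d _ G 0) (\tr M).
  move=> _ [A GA ->]; rewrite -trace_map_mx !map_mxM map_mx_adj !evC !evXg.
  have -> : \adj A = \det A *: invmx A.
    rewrite /invmx G_unit // scalerA mulfV ?scale1r //.
    by move: (G_unit GA); rewrite unitmxE unitfE.
  by rewrite -!scalemxAl linearZ /= HL ?mulr0 //; apply: hG.
pose e := jid d v.+1 0; pose D (Y : 'M[R]_v.+1) : mat := map_mx (fun p => dd p e z) Y.
have dd0 : dd (0 : R) e z = 0 by rewrite -mpolyC0 ddC.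
have DM Y Z : D (Y *m Z) = D Y *m map_mx (meval (e 0)) Z + map_mx (meval (e 0)) Y *m D Z.
  apply/matrixP => i j; rewrite !mxE (big_morph (fun p => dd p e z) (fun p q => ddD p q e z) dd0).
  rewrite -big_split; apply: eq_bigr => k _ /=.
  by rewrite ddM !mxE; ring.
have DC Y : D (C Y) = 0 by apply/matrixP => i j; rewrite !mxE ddC.
have DX : D Xg = mcomp z 0.
  apply/matrixP => i j; rewrite mxE [Xg _ _]mxE ddX [RHS]mxE.
  exact: (esym (dec_index z (mxvec_index i j) ord0)).
have adj1 : map_mx (meval (e 0)) (\adj Xg) = 1%:M.
  rewrite map_mx_adj evXg; have := mul_adj_mx (1%:M : mat).
  by rewrite mulmx1 det1 => ->.
have Dadj : D (\adj Xg) = (dd (\det Xg) e z)%:M - mcomp z 0.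
  have := congr1 D (mul_adj_mx Xg); rewrite DM evXg mulmx1 adj1 mul1mx DX.
  have -> : D (\det Xg)%:M = (dd (\det Xg) e z)%:M.
    by apply/matrixP => i j; rewrite !mxE; case: eqP; rewrite ?mulr1n ?mulr0n ?dd0.
  by move=> <-; rewrite addrK.
have := Tz _ Itr; have -> : dd (\tr M) (jid d v.+1 0) z = \tr (D M).
  rewrite (big_morph (fun p => dd p e z) (fun p q => ddD p q e z) dd0).
  by apply: eq_bigr => i _; rewrite [RHS]mxE.
rewrite !DM !DC !map_mxM adj1 !evC evXg mulmx0 addr0 mul1mx mulmx1.
rewrite mulmx0 addr0 Dadj DX.
have -> : (((dd (\det Xg) e z)%:M - mcomp z 0) *m X + X *m mcomp z 0) *m L =
    dd (\det Xg) e z *: (X *m L) + (X *m mcomp z 0 - mcomp z 0 *m X) *m L.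
  by rewrite mulmxDl !mulmxBl mul_scalar_mx -scalemxAl -addrA; congr (_ + _); rewrite addrC.
by rewrite mxtraceD mxtraceZ (HL X hX) mulr0 add0r.
Qed.

(** The entries of X A - A X, as functions of A, satisfy a linear system along the
    fields of the group as soon as X commutes with the Lie algebra. *)
Lemma centralizer X : (forall W, W \in g -> X *m W = W *m X) ->
  forall A, G A -> X *m A = A *m X.
Proof.
move=> HX A GA.
pose l (E : mat) : mat := E^T *m X - X *m E^T.
have lE i j : l (delta_mx i j) = delta_mx j i *m X - X *m delta_mx j i.
  by rewrite /l trmx_delta.
have trl B i j : \tr (B *m l (delta_mx i j)) = (X *m B - B *m X) i j.
  rewrite lE mulmxBr linearB /= [RHS]mxE [Y in _ = _ + Y]mxE; congr (_ - _).
    by rewrite -[X *m B]mulmx1 trace_entry mul1mx.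
  by rewrite -[in RHS](mul1mx B) trace_entry mulmx1.
have lsum (u : 'rV[K]_(v.+1 * v.+1)) : l (vec_mx u) = \sum_j u 0 j *: l (vec_mx (delta_mx 0 j)).
  have lP a E F : l (a *: E + F) = a *: l E + l F.
    rewrite /l linearP /= mulmxDl mulmxDr -scalemxAl -scalemxAr scalerBr.
    by rewrite opprD addrACA.
  have l0 : l 0 = 0 by rewrite /l trmx0 mul0mx mulmx0 subrr.
  have lD E F : l (E + F) = l E + l F by rewrite -[E]scale1r lP !scale1r.
  rewrite {1}[u]row_sum_delta linear_sum /= (big_morph l lD l0).
  by apply: eq_bigr => j _; rewrite linearZ /= -[_ *: _]addr0 lP l0 addr0.
have key := @constant_traces _ _ d_der _ _ G1 G_mul 0 _
  (fun i => l (vec_mx (delta_mx 0 i))) (fun=> 0) char0 irr.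
apply/eqP; rewrite -subr_eq0; apply/eqP/matrixP => i j; rewrite -trl [RHS]mxE.
rewrite -vec_mx_delta; apply: key => // {i j A GA}.
  move=> i; case/mxvec_indexP: i => i j.
  by rewrite vec_mx_delta -[l _]mul1mx trl mulmx1 mul1mx subrr mxE.
move=> z Tz; exists (\matrix_i mxvec ((mcomp z 0)^T *m vec_mx (delta_mx 0 i))) => A i GA.
have XZ : X *m mcomp z 0 = mcomp z 0 *m X by apply: HX; apply/gP; exists z.
under eq_bigr => j _ do rewrite subr0 mxE -linearZ /= scalemxAr.
rewrite -linear_sum -mulmx_sumr -lsum mxvecK -mulmxA mxtrace_mulC -mulmxA.
congr (\tr (_ *m _)); rewrite /l mulmxBl trmx_mul trmxK; congr (_ - _).
  by rewrite -!mulmxA XZ.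
by rewrite mulmxA.
Qed.

Lemma conjE A X Y : G A -> \tr (invmx A *m X *m A *m Y) = \tr (X *m (A *m Y *m invmx A)).
Proof. by move=> GA; rewrite -!mulmxA mxtrace_mulC !mulmxA. Qed.

Lemma conj_stableV h A X : conj_stable G h -> G A -> X \in h -> A *m X *m invmx A \in h.
Proof. by move=> hG GA hX; have := hG _ _ (G_inv GA) hX; rewrite invmxK. Qed.

Lemma conj_fixed A X : G A -> X *m A = A *m X -> invmx A *m X *m A = X.
Proof. by move=> GA XA; rewrite -mulmxA XA mulKmx ?G_unit. Qed.

Lemma conj_stableD h h' : conj_stable G h -> conj_stable G h' -> conj_stable G (h + h').
Proof.
move=> hG hG' A _ GA /memv_addP[X hX [Y hY ->]].
by rewrite mulmxDr mulmxDl; apply: memv_add; [apply: hG|apply: hG'].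
Qed.

Let nondegenerate (h : {vspace mat}) : (h <= g)%VS -> conj_stable G h -> bracket_closed h ->
  replica_closed h -> forall X, X \in h -> (forall Y, Y \in h -> \tr (X *m Y) = 0) -> X = 0.
Proof.
move=> hg hG hbr hrep X hX XY; rewrite -[X]mul1mx.
apply: (trace_form_nondegenerate closedK char0 G_unit G_inv ss _ _ _ hG) => //.
- by rewrite mulmx1.
- by move=> A _; rewrite mulmx1 mul1mx.
- by move=> Y hY; apply: lie_in_span; apply: (subvP hg).
by move=> Y hY; rewrite mul1mx; apply: XY.
Qed.

(** Add to k the centralizer zz of the group in g; call the result k1, let m be its
    orthogonal in g for the trace form, and n the intersection of both.  The
    nondegeneracy of the form on g makes n commute with k1.  The part of n that is
    orthogonal to the commutant of n consists of nilpotent matrices, hence is 0 by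
    nilpotent_ideal_zero; it contains the brackets of n with g, so n is central.
    The form being nondegenerate on the centre too, n = 0.  Thus m is a complement
    of k1, and zz contains a complement of k in k1. *)
Theorem stable_complement (k : {vspace mat}) : (k <= g)%VS -> conj_stable G k ->
  exists k' : {vspace mat},
    [/\ (k' <= g)%VS, conj_stable G k', (g <= k + k')%VS &
        forall X, X \in k -> X \in k' -> X = 0].
Proof.
move=> kg kG.
have [|a X Y [gX CX] [gY CY]|zz zzP] := @vspace_of_pred_ex _ _
    (fun X => X \in g /\ forall A, G A -> X *m A = A *m X).
- by split=> [|A _]; rewrite ?mem0v // mul0mx mulmx0.
- split=> [|A GA]; first by rewrite memvD ?memvZ.
  by rewrite mulmxDl mulmxDr -scalemxAl -scalemxAr CX // CY.
have zzg : (zz <= g)%VS by apply/subvP => X /zzP[].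
have zzG : conj_stable G zz.
  by move=> A X GA zX; case/zzP: (zX) => _ /(_ _ GA) XA; rewrite conj_fixed.
pose k1 := (k + zz)%VS; have k1g : (k1 <= g)%VS by rewrite subv_add kg.
have k1G : conj_stable G k1 by apply: conj_stableD.
have [|a X Y [gX CX] [gY CY]|m mP] := @vspace_of_pred_ex _ _
    (fun X => X \in g /\ forall Y, Y \in k1 -> \tr (X *m Y) = 0).
- by split=> [|A _]; rewrite ?mem0v // mul0mx linear0.
- split=> [|Z kZ]; first by rewrite memvD ?memvZ.
  by rewrite mulmxDl -scalemxAl linearD linearZ /= CX // CY // mulr0 addr0.
have mg : (m <= g)%VS by apply/subvP => X /mP[].
have mG : conj_stable G m.
  move=> A X GA /mP[gX HX]; apply/mP; split; first exact: lie_conj.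
  by move=> Y kY; rewrite conjE // HX //; apply: conj_stableV.
pose n := (k1 :&: m)%VS.
have nP X : X \in n -> X \in k1 /\ X \in m by rewrite memv_cap => /andP[].
have nG : conj_stable G n.
  by move=> A X GA /nP[kX mX]; rewrite memv_cap k1G // mG.
have ng : (n <= g)%VS by apply: subv_trans k1g; apply: capvSl.
have nk1 X Y : X \in n -> Y \in k1 -> X *m Y = Y *m X.
  move=> /nP[kX mX] kY; apply/eqP; rewrite -subr_eq0; apply/eqP.
  have gX := subvP k1g _ kX; have gY := subvP k1g _ kY.
  apply: (nondegenerate (subvv g) lie_conj lie_bracket lie_replica); first exact: lie_bracket.
  move=> W gW; rewrite mxtrace_bracket; case/mP: mX => _; apply.
  exact: ad_stable.
have nn X Y : X \in n -> Y \in n -> X *m Y = Y *m X by move=> nX /nP[kY _]; apply: nk1.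
(* L consists of nilpotent matrices: all powers of Y in L commute with n, so the
   traces of its positive powers vanish. *)
have ncent X W : X \in n -> W \in g -> X *m W = W *m X.
  have [|a X1 Y1 [gX CX] [gY CY]|L LP] := @vspace_of_pred_ex _ _
    (fun Y => Y \in n /\ forall Z : mat, (forall X, X \in n -> X *m Z = Z *m X) -> \tr (Y *m Z) = 0).
  - by split=> [|A _]; rewrite ?mem0v // mul0mx linear0.
  - split=> [|Z kZ]; first by rewrite memvD ?memvZ.
    by rewrite mulmxDl -scalemxAl linearD linearZ /= CX // CY // mulr0 addr0.
  move=> nX gW; apply/eqP; rewrite -subr_eq0; apply/eqP.
  have Ln Y : Y \in L -> Y \in n by case/LP.
  apply: (nilpotent_ideal_zero G_unit G_inv ss (m := L) (P := 1%:M)).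
  - by rewrite mulmx1.
  - by move=> A _; rewrite mulmx1 mul1mx.
  - move=> Y LY; exists Y; last by rewrite mul1mx.
    by apply: lie_in_span; apply: (subvP ng); apply: Ln.
  - move=> A Y GA /LP[nY HY]; apply/LP; split; first exact: nG.
    move=> Z HZ; rewrite conjE //; apply: HY => X1 nX1.
    have UA := G_unit GA; have := HZ _ (nG _ _ GA nX1) => /(congr1 (fun M => A *m M *m invmx A)).
    rewrite /= !mulmxA mulmxV // mul1mx => E.
    by rewrite E -!mulmxA mulmxV // mulmx1.
  - by move=> Y Y' LY LY'; rewrite nn ?Ln // subrr mem0v.
  - move=> Y LY; have [|m0 Ym] := nilpotent_of_traces (Y := Y) closedK char0.
      move=> j; case/LP: LY => nY; rewrite exprS => H; apply: H => X1 nX1.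
      have cX : GRing.comm X1 Y by apply: nn.
      exact: commrX.
    by exists m0 => u; rewrite iter_mulmx_exp Ym mulmx0.
  apply/LP; split; first exact: ad_stable.
  move=> Z HZ; rewrite -opprB mulNmx linearN /= mxtrace_bracket HZ // subrr mulmx0.
  by rewrite linear0 oppr0.
have n0 X : X \in n -> X = 0.
  move=> nX; have zX : X \in zz.
    apply/zzP; split; first exact: (subvP ng).
    by apply: centralizer => W gW; apply: ncent.
  apply: (nondegenerate zzg zzG) => //.
  - move=> Y Y' /zzP[gY CY] /zzP[gY' CY']; apply/zzP; split; first exact: lie_bracket.
    have comm3 (X1 X2 B : mat) : X1 *m B = B *m X1 -> X2 *m B = B *m X2 ->
        X1 *m X2 *m B = B *m (X1 *m X2).
      by move=> E1 E2; rewrite -mulmxA E2 mulmxA E1 mulmxA.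
    by move=> A GA; rewrite mulmxBl mulmxBr !comm3 //; first [exact: (CY _ GA)|exact: (CY' _ GA)].
  - move=> Y zY; case/zzP: (zY) => gY CY; have [ls [Hls Hfs]] := lie_replica gY.
    exists ls; split=> // fs /Hfs[q [qls gq]]; exists q; split=> //; apply/zzP; split=> // A GA.
    by apply: comm_horner_mx; apply: CY.
  by move=> Y /zzP zY; case/nP: nX => _ /mP[_]; apply; apply: (subvP (addvSr _ _)); apply/zzP.
have gU : gram k1 1%:M \in unitmx.
  apply: gram_unit => X kX HX; apply: n0; rewrite memv_cap kX; apply/mP; split.
    exact: (subvP k1g).
  by move=> Y kY; rewrite -[X]mul1mx HX.
exists ((zz :\: k) + m)%VS; split.
- by rewrite subv_add mg andbT (subv_trans _ zzg) // diffvSl.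
- apply: conj_stableD mG => A X GA zX; have zX' := subvP (diffvSl _ _) _ zX.
  by case/zzP: zX' => _ /(_ _ GA) XA; rewrite conj_fixed.
- apply/subvP => X gX; have [Y kY HY] := gram_decomp X gU.
  rewrite addvA [(k + _)%VS]addvC addv_diff -[X](subrK Y) addrC memv_add //.
    by rewrite addvC.
  by apply/mP; split; [rewrite memvB // (subvP k1g)|].
move=> X kX /memv_addP[Z zZ [Y mY XE]].
have Y0 : Y = 0.
  apply: n0; rewrite memv_cap mY andbT -[Y](addKr Z) -XE addrC memv_add //.
  by rewrite memvN (subvP (diffvSl _ _) _ zZ).
move: XE kX; rewrite Y0 addr0 => -> kZ.
by apply/eqP; rewrite -memv0 -(capv_diff zz k) memv_cap zZ.
Qed.

End Reductive.

(** * Vanishing of cocycles *)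

Section Core.

Variables (K : fieldType) (d : K -> K).
Hypothesis d_der : is_derivation d.
Hypothesis d_closed : delta_closed d.
Hypothesis char0 : [pchar K] =i pred0.
Variables (q v : nat) (G : 'M[K]_q -> Prop).
Local Notation mat := 'M[K]_v.+1.
Hypothesis G1 : G 1%:M.
Hypothesis G_mul : forall A B, G A -> G B -> G (A *m B).
Hypothesis G_unit : forall A, G A -> A \in unitmx.
Hypothesis G_inv : forall A, G A -> G (invmx A).
Hypothesis G_irr : forall r (p p' : {mpoly K[q * q * r.+1]}),
  vanish (@jset K d _ G r) (p * p') ->
  vanish (@jset K d _ G r) p \/ vanish (@jset K d _ G r) p'.
Hypothesis G_closed : forall A,
  (forall r p, vanish (@jset K d _ G r) p -> deval d p (mxvec A) = 0) -> G A.
Variables (iV : 'M[K]_(v.+1, q)) (pV : 'M[K]_(q, v.+1)).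
Hypothesis iVd : map_mx d iV = 0.
Hypothesis pVd : map_mx d pV = 0.
Hypothesis iVpV : iV *m pV = 1%:M.
Local Notation rb := (vb iV pV).
Hypothesis rep : forall A, G A -> iV *m A = rb A *m iV.
Hypothesis faithful : forall A, G A -> rb A = 1%:M -> A = 1%:M.
Local Notation H := (image_group G iV pV).
Hypothesis ss : semisimple_rows H.
Variable g : {vspace mat}.
Hypothesis gP : forall X, X \in g <-> exists2 z, @jtan K d _ H 0 z & mcomp z 0 = X.
Hypothesis Hom0 : forall phi : mat -> 'rV[K]_v.+1,
  (forall a X Y, phi (a *: X + Y) = a *: phi X + phi Y) ->
  (forall A X, H A -> X \in g -> phi (invmx A *m X *m A) = phi X *m A) ->
  forall X, X \in g -> phi X = 0.

Let closedK : alg_closed K := delta_closed_alg_closed d_der char0 d_closed.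
Let H1 : H 1%:M := image_group1 G1 iVpV.
Let H_mul A B : H A -> H B -> H (A *m B). Proof. exact: (image_group_mul G_mul rep). Qed.
Let H_unit A : H A -> A \in unitmx. Proof. exact: (image_group_unit G_unit iVpV rep). Qed.
Let H_inv A : H A -> H (invmx A). Proof. exact: (image_group_inv G_unit G_inv iVpV rep). Qed.

Let B1 : 'M[K]_(q * q * 1, v.+1 * v.+1 * 1) :=
  linmx (fun x : 'rV[K]_(q * q * 1) => menc 1 (fun k => rb (mcomp x k))).

Let B1E x : x *m B1 = menc 1 (fun k => rb (mcomp x k)).
Proof.
apply: linmxE => a u w; rewrite -menc_lin; apply: menc_ext => k _.
by rewrite mcomp_lin vb_lin.
Qed.

Let B1jet A : jet d 1 (mxvec A) *m B1 = jet d 1 (mxvec (rb A)).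
Proof.
rewrite B1E [RHS]jet_menc; apply: menc_ext => k ltk.
by rewrite mcomp_jet // (vb_jseq d_der).
Qed.

Lemma vanish_image p : vanish (@jset K d _ H 0) p <-> vanish (@jset K d _ G 0) (linsub B1 p).
Proof.
split=> [Ip _ [A GA ->]|Ip _ [_ [A GA <-] ->]].
  by rewrite linsubE B1jet; apply: Ip; exists (rb A) => //; exists A.
by rewrite -B1jet -linsubE; apply: Ip; exists A.
Qed.

Lemma image_irr (p p' : {mpoly K[v.+1 * v.+1 * 1]}) :
  vanish (@jset K d _ H 0) (p * p') ->
  vanish (@jset K d _ H 0) p \/ vanish (@jset K d _ H 0) p'.
Proof.
move/vanish_image; rewrite /linsub rmorphM => /G_irr[] Ip; [left|right];
exact/vanish_image.
Qed.

Let complement := stable_complement d_der closedK char0 H1 H_mul H_unit H_inv image_irr ss gP.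

(** Every stable subspace of g is a direct summand, so an equivariant map on it
    extends to g by 0. *)
Lemma partial_hom (k : {vspace mat}) (phi : mat -> 'rV[K]_v.+1) : (k <= g)%VS -> conj_stable H k ->
    (forall a X Y, phi (a *: X + Y) = a *: phi X + phi Y) ->
    (forall A X, H A -> X \in k -> phi (invmx A *m X *m A) = phi X *m A) ->
  forall X, X \in k -> phi X = 0.
Proof.
move=> kg kH philin phieq X kX.
have phi0 : phi 0 = 0.
  by have := philin (-1) 0 0; rewrite scaler0 add0r scaleN1r addNr.
have [k' [k'g k'H gkk' kk0]] := complement kg kH.
pose R (X : mat) u := exists Y Z, [/\ Y \in k, Z \in k', X = Y + Z & u = phi Y].
have R0 : R 0 0 by exists 0, 0; rewrite !mem0v addr0 phi0.
have [|||f [flin fR]] := @linear_of_relation K _ 'rV[K]_v.+1 R g R0.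
- move=> a _ _ _ _ [Y [Z [kY kZ -> ->]]] [Y' [Z' [kY' kZ' -> ->]]].
  exists (a *: Y + Y'), (a *: Z + Z'); rewrite !memvD ?memvZ // philin scalerDr.
  by split=> //; rewrite addrACA.
- move=> u [Y [Z [kY kZ /esym/eqP]]]; rewrite addr_eq0 => /eqP EY ->.
  by rewrite (kk0 Y) // EY memvN.
- move=> W gW; have /memv_addP[Y kY [Z kZ ->]] := subvP gkk' _ gW.
  by exists (phi Y), Y, Z.
have Rf Y Z : Y \in k -> Z \in k' -> f (Y + Z) = phi Y.
  move=> kY kZ; apply: fR; last by exists Y, Z.
  by rewrite memvD //; [apply: (subvP kg)|apply: (subvP k'g)].
rewrite -(Rf X 0) ?mem0v // addr0; apply: Hom0 => //; last exact: (subvP kg).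
move=> A W HA gW; have /memv_addP[Y kY [Z kZ ->]] := subvP gkk' _ gW.
by rewrite mulmxDr mulmxDl !Rf ?phieq //; [apply: kH|apply: k'H].
Qed.

(** Differentiate i times an equation p of the image group: at 1 the gradients of
    the i-th total derivative have index at most i, and the one of index i is the
    gradient of p. *)
Lemma jet_leading r z i : @jtan K d _ G r z -> (i < r.+1)%N ->
  (forall k, (k < i)%N -> rb (mcomp z k) = 0) -> rb (mcomp z i) \in g.
Proof.
move=> Tz lti vz; apply/gP; pose y : 'rV[K]_(v.+1 * v.+1 * 1) := menc 1 (fun=> rb (mcomp z i)).
exists y; last by rewrite /y mencK.
move=> p Ip; pose one := mxvec (1%:M : 'M[K]_q).
pose Bv : 'M[K]_(q * q, v.+1 * v.+1) := linmx (fun x : 'rV[K]_(q * q) => mxvec (rb (vec_mx x))).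
have BvE x : x *m Bv = mxvec (rb (vec_mx x)).
  by apply: linmxE => a u w; rewrite linearP /= vb_lin linearP.
have Bvd : map_mx d Bv = 0.
  apply/row_matrixP => j; rewrite -map_row row0 /Bv rowK map_mxvec.
  suff -> : map_mx d (rb (vec_mx (delta_mx 0 j))) = 0 by rewrite linear0.
  case/mxvec_indexP: j => j l; rewrite vec_mx_delta /vb !(derM_mx d_der) iVd pVd.
  by rewrite (der_delta_mx d_der) !(mul0mx, mulmx0, addr0).
have BvTd : map_mx d Bv^T = 0 by rewrite -map_trmx Bvd trmx0.
pose h := dgrad d p (mxvec (1%:M : mat)) 0.
have [P [IP [Pi Pk]]] : exists P : {mpoly K[q * q * i.+1]}, vanish (@jset K d _ G i) P /\
    dgrad d P one i = h *m Bv^T /\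
    forall k, exists2 b : 'rV[K]_(v.+1 * v.+1), dgrad d P one k = b *m Bv^T & (i < k)%N -> b = 0.
  elim: (i) => [|j [P [IP [Pj Pk]]]].
    exists (linsub B1 p); split; first exact/vanish_image.
    have E0 : dgrad d (linsub B1 p) one 0 = h *m Bv^T.
      apply: trmx_inj; apply/row_matrixP => a; rewrite !rowE; apply/matrixP => b c.
      rewrite !ord1 trmx_mul trmxK mulmxA BvE; set x := delta_mx 0 a.
      have := dd_jets d (linsub B1 p) one (enc 1 (fun=> x)).
      rewrite big_ord1 encK // => <-; rewrite dd_linsub B1jet vb1 // B1E dd_jets big_ord1.
      by rewrite encK //= /mcomp encK.
    split=> // -[|k]; first by exists h.
    exists 0 => //; rewrite mul0mx /dgrad dec_out //.
  have [P' [EP' GP']] := total_derivative d_der P; exists P'; split.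
    move=> _ [A GA ->]; rewrite -[LHS]/(deval d P' (mxvec A)) -deval_dev EP' // deval_dev.
    by rewrite /deval IP ?(der0 d_der) //; exists A.
  split.
    have [b Eb b0] := Pk j.+1.
    by rewrite GP' Pj Eb b0 // mul0mx (der0_mx d_der) add0r.
  move=> k; have [b Eb b0] := Pk k; have [b' Eb' b0'] := Pk k.-1.
  exists (map_mx d b + if k is 0 then 0 else b').
    rewrite GP' Eb (derM_mx d_der) BvTd mulmx0 addr0 mulmxDl.
    by case: k Eb' {b0 b0' Eb} => [|k] /= Eb'; rewrite ?mul0mx ?Eb'.
  move=> ltk; rewrite b0 ?(ltnW ltk) // (der0_mx d_der) add0r.
  by case: k ltk b0' {Eb b0 Eb'} => // k ltk; apply.
have [P' [EP' GP']] := lift_order d P lti.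
have IP' : vanish (@jset K d _ G r) P'.
  move=> _ [A GA ->]; rewrite -[LHS]/(deval d P' (mxvec A)) -deval_dev EP' deval_dev.
  by apply: IP; exists A.
have := Tz P' IP'; rewrite /jid dd_jets (bigD1 (Ordinal lti)) //= GP' Pi.
rewrite trmx_mul trmxK mulmxA BvE -/(mcomp z i) big1 => [|k nek]; last first.
  rewrite GP'; have [b -> b0] := Pk k; rewrite trmx_mul trmxK mulmxA BvE -/(mcomp z k).
  have [ltk|ltk|eqk] := ltngtP k i; last by case/eqP: nek; apply: val_inj.
    by rewrite vz // linear0 mul0mx mxE.
  by rewrite b0 // trmx0 mulmx0 mxE.
by rewrite addr0 dd_jets big_ord1 /y encK.
Qed.

Lemma vb_jmul (Y Z : nat -> 'M[K]_q) k : (forall a, (a <= k)%N -> iV *m Y a = rb (Y a) *m iV) ->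
  rb (jmul Y Z k) = jmul (fun a => rb (Y a)) (fun a => rb (Z a)) k.
Proof.
move=> sY; rewrite /jmul vb_sum; apply: eq_bigr => a _.
rewrite -!scaler_nat vbZ; congr (_ *: _); apply: vb_mul; apply: sY.
by rewrite -ltnS.
Qed.

Lemma jmul_stable (Y Z : nat -> 'M[K]_q) k :
  (forall a, (a <= k)%N -> iV *m Y a = rb (Y a) *m iV) ->
  (forall a, (a <= k)%N -> iV *m Z a = rb (Z a) *m iV) ->
  iV *m jmul Y Z k = rb (jmul Y Z k) *m iV.
Proof.
move=> sY sZ; rewrite vb_jmul // /jmul mulmx_sumr mulmx_suml; apply: eq_bigr => a _.
rewrite -!scaler_nat -scalemxAr -scalemxAl; congr (_ *: _).
have lea : (a <= k)%N by rewrite -ltnS.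
by rewrite mulmxA sY // -(mulmxA _ iV) sZ ?leq_subr // mulmxA.
Qed.

(** Up to the first component with nonzero image, Leibniz' rule leaves only the
    conjugation by the zeroth component of the jet of A. *)
Lemma vb_jconj r z A i : G A -> @jtan K d _ G r z -> (i < r.+1)%N ->
    (forall k, (k < i)%N -> rb (mcomp z k) = 0) ->
  (forall k, (k < i)%N -> rb (mcomp (jconj d A z) k) = 0) /\
  rb (mcomp (jconj d A z) i) = invmx (rb A) *m rb (mcomp z i) *m rb A.
Proof.
move=> GA Tz lti vz; have GA' := G_inv GA.
have sA B k : G B -> iV *m jseq d B k = rb (jseq d B k) *m iV by apply: (jseq_stable d_der iVd pVd rep).
have sz k : (k < r.+1)%N -> iV *m mcomp z k = rb (mcomp z k) *m iV.
  by move=> ltk; apply: (tan_stable d_der iVd pVd rep Tz).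
have main k : (k <= i)%N -> rb (mcomp (jconj d A z) k) = invmx (rb A) *m rb (mcomp z k) *m rb A.
  move=> lek; have ltk : (k < r.+1)%N by apply: leq_ltn_trans lti.
  rewrite jconj_comp // vb_jmul => [|a lea]; last first.
    apply: jmul_stable => b leb; first exact: sA.
    by apply: sz; apply: leq_ltn_trans (leq_trans leb lea) ltk.
  have E a : (a <= k)%N -> rb (jmul (jseq d (invmx A)) (mcomp z) a) = invmx (rb A) *m rb (mcomp z a).
    move=> lea; rewrite vb_jmul => [|b _]; last exact: sA.
    have [|_ ->] := @jmul_first K _ (fun a => rb (mcomp z a)) (fun a => rb (jseq d (invmx A) a)) a.
      by move=> l ltl; apply: vz; apply: leq_trans ltl (leq_trans lea lek).
    by rewrite jseq0 (vb_inv G_unit iVpV rep GA).2.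
  have [|-> _] := @jmul_first K _ (fun a => rb (jmul (jseq d (invmx A)) (mcomp z) a))
     (fun a => rb (jseq d A a)) k.
    by move=> l ltl; rewrite E ?(ltnW ltl) // vz ?mulmx0 // (leq_trans ltl).
  by rewrite E // jseq0.
split=> [k ltk|]; last exact: main.
by rewrite main ?(ltnW ltk) // vz // mulmx0 mul0mx.
Qed.

(** The row w represents a vector fixed by the group modulo the submodule with
    inclusion iV and projection pV. *)
Definition cocycle (w : 'rV[K]_q) A : 'rV[K]_v.+1 := (w *m A - w) *m pV.

Definition admissible w := forall A, G A -> w *m A - w = cocycle w A *m iV.

Definition dcocycle (w : 'rV[K]_q) r (z : 'rV[K]_(q * q * r.+1)) := w *m mcomp z 0 *m pV.

Lemma cocycle_shift w u A : G A ->
  cocycle (w - u *m iV) A = cocycle w A - (u *m rb A - u).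
Proof.
move=> GA; rewrite /cocycle (mulmxBl w) -(mulmxA u) rep // !mulmxBl.
rewrite (mulmxA u).
rewrite -[_ *m iV *m pV]mulmxA -[u *m iV *m pV]mulmxA iVpV !mulmx1.
by rewrite !opprB -!addrA; congr (_ + _); rewrite addrCA [RHS]addrCA [X in _ + X]addrC.
Qed.

Lemma admissible_shift w u : admissible w -> admissible (w - u *m iV).
Proof.
move=> adm A GA; rewrite cocycle_shift // (mulmxBl (cocycle w A)) -adm // (mulmxBl w) -(mulmxA u) rep //.
rewrite mulmxBl mulmxA !opprB addrACA [RHS]addrACA; congr (_ + _).
by rewrite addrC.
Qed.

Section OneCocycle.

Variable w : 'rV[K]_q.
Hypothesis adm : admissible w.

Lemma cocycleM A B : G A -> G B -> cocycle w (A *m B) = cocycle w A *m rb B + cocycle w B.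
Proof.
move=> GA GB; have -> : cocycle w A *m rb B = (w *m A - w) *m B *m pV.
  by rewrite adm // -[RHS]mulmxA -[RHS]mulmxA /vb !mulmxA.
rewrite /cocycle -mulmxDl; congr (_ *m _).
by rewrite mulmxBl mulmxA addrA subrK.
Qed.

Lemma cocycle_inv A : G A -> cocycle w (invmx A) *m rb A = - cocycle w A.
Proof.
move=> GA; apply/eqP; rewrite -addr_eq0 -cocycleM //; last exact: G_inv.
by rewrite mulVmx ?G_unit // /cocycle mulmx1 subrr mul0mx.
Qed.

Lemma dcocycle_tan r z : @jtan K d _ G r z -> w *m mcomp z 0 = dcocycle w z *m iV.
Proof.
move=> Tz; apply/eqP; rewrite -subr_eq0 /dcocycle -mulmxA -{1}[w *m _]mulmx1 -mulmxBr.
apply/eqP; apply: (tan_rel0 (D := w *m (1%:M - pV *m iV))) Tz => A GA.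
rewrite -[w *m A](subrK w) adm // mulmxDl -[RHS]add0r; congr (_ + _).
by rewrite mulmxBr mulmx1 mulmxA -(mulmxA _ iV) iVpV mulmx1 subrr.
Qed.

Lemma dcocycle_conj r z A : G A -> @jtan K d _ G r z ->
  dcocycle w (jconj d A z) =
    dcocycle w z *m rb A + cocycle w (invmx A) *m rb (mcomp z 0) *m rb A.
Proof.
move=> GA Tz; rewrite /dcocycle jconj_comp // !jmul_at0 !jseq0.
rewrite !mulmxA -[w *m invmx A](subrK w) adm; last exact: G_inv.
rewrite !mulmxDl addrC dcocycle_tan //; congr (_ + _).
  by rewrite -(mulmxA _ iV pV) iVpV mulmx1.
rewrite -(mulmxA _ iV (mcomp z 0)) (tan_stable d_der iVd pVd rep Tz (ltn0Sn r)) /vb !mulmxA.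
by rewrite -[_ *m pV *m iV *m pV]mulmxA -[_ *m pV *m (iV *m pV)]mulmxA iVpV mulmx1.
Qed.

(** Descending induction on the number i of components whose image vanishes.  For
    i > r the jet is 0 at order 0 by hypothesis.  If the claim holds for i + 1,
    then for i the value of the differentiated cocycle depends only on the
    i-th image, which lies in g by jet_leading, and the dependence is linear and
    equivariant; so it is zero by partial_hom. *)
Lemma dcocycle_kernel r :
    (forall z, @jtan K d _ G r z -> (forall k, (k < r.+1)%N -> rb (mcomp z k) = 0) ->
       mcomp z 0 = 0) ->
  forall z, @jtan K d _ G r z -> rb (mcomp z 0) = 0 -> dcocycle w z = 0.
Proof.
move=> star.
suff main n i : (0 < i)%N -> (i + n = r.+1)%N -> forall z, @jtan K d _ G r z ->
    (forall k, (k < i)%N -> rb (mcomp z k) = 0) -> dcocycle w z = 0.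
  by move=> z Tz vz; apply: (main r 1%N) => // -[].
elim: n i => [|n IHn] i i0 Ei z Tz vz.
  rewrite /dcocycle star ?mulmx0 ?mul0mx // => k ltk; apply: vz.
  by rewrite -(addn0 i) Ei.
have lti : (i < r.+1)%N by rewrite -Ei addnS ltnS leq_addr.
have IH := IHn i.+1 isT; rewrite addSn -addnS in IH; have {}IH := IH Ei.
pose fil y := @jtan K d _ G r y /\ forall k, (k < i)%N -> rb (mcomp y k) = 0.
have fil_lin a y y' : fil y -> fil y' -> fil (a *: y + y').
  move=> [Ty vy] [Ty' vy']; split=> [|k ltk]; first exact: tangent_lin.
  by rewrite mcomp_lin vb_lin vy // vy' // scaler0 addr0.
have fil0 : fil 0.
  by split=> [|k _]; [apply: tangent0|rewrite /mcomp dec0 linear0 vb0].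
pose R (X : mat) u := exists2 y, fil y & X = rb (mcomp y i) /\ u = dcocycle w y.
have R0 : R 0 0.
  by exists 0 => //; rewrite /dcocycle /mcomp !dec0 !linear0 ?mulmx0 mul0mx vb0.
have [|a _ _ [y fy ->] [y' fy' ->]|k kP] := @vspace_of_pred_ex _ _ (fun X => exists2 y, fil y & X = rb (mcomp y i)).
- by exists 0 => //; rewrite /mcomp dec0 linear0 vb0.
- by exists (a *: y + y'); [apply: fil_lin|rewrite mcomp_lin vb_lin].
have [|||f [flin fR]] := @linear_of_relation K _ 'rV[K]_v.+1 R k R0.
- move=> a _ _ _ _ [y fy [-> ->]] [y' fy' [-> ->]].
  exists (a *: y + y'); first exact: fil_lin.
  by rewrite mcomp_lin vb_lin /dcocycle mcomp_lin mulmxDr mulmxDl -scalemxAr -scalemxAl.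
- move=> u [y [Ty vy] [Ey ->]]; apply: IH => // l.
  by rewrite ltnS leq_eqVlt => /orP[/eqP->|/vy].
- by move=> X /kP[y fy ->]; exists (dcocycle w y), y.
rewrite -(fR (rb (mcomp z i)) (dcocycle w z)); last 2 first.
- by apply/kP; exists z.
- by exists z.
have kf y : fil y -> rb (mcomp y i) \in k /\ f (rb (mcomp y i)) = dcocycle w y.
  by move=> fy; have ky : rb (mcomp y i) \in k; [apply/kP; exists y|split=> //; apply: fR => //; exists y].
have fil_conj A y : G A -> fil y -> fil (jconj d A y) /\
    rb (mcomp (jconj d A y) i) = invmx (rb A) *m rb (mcomp y i) *m rb A.
  move=> GA [Ty vy]; have [vy' E] := vb_jconj GA Ty lti vy; split=> //.
  by split=> //; apply: jtan_conj.
apply: (@partial_hom k) => //.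
- by apply/subvP => X /kP[y [Ty vy] ->]; apply: jet_leading Ty lti vy.
- move=> _ X [A GA <-] /kP[y fy ->]; have [fy' <-] := fil_conj A y GA fy.
  by apply: (kf _ fy').1.
- move=> _ X [A GA <-] /kP[y fy ->]; have [fy' E] := fil_conj A y GA fy.
  rewrite -E (kf _ fy').2 (kf _ fy).2 dcocycle_conj //; last by case: fy.
  by case: fy => _ /(_ _ i0) ->; rewrite mulmx0 mul0mx addr0.
by apply/kP; exists z.
Qed.

End OneCocycle.

(** Let k0 be the Lie algebra formed by the images of tangent jets of order r.  The
    differentiated cocycle induces a map f on k0, which vanishes on the ideal rr of
    elements acting trivially on U, by partial_hom.  If a stable complement hh of
    rr in k0 is zero then so is f, and the cocycle is constant.  Otherwise the
    trace form on U is nondegenerate on hh and has a Casimir operator Om, which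
    commutes with the group and has trace dim hh <> 0 on U.  The invariance of
    sum_ij f(x_i) x^j under conjugation shows that the product of the cocycle with
    Om is a coboundary, and so is its product with N s(N), where N = P Om.  Writing
    the characteristic polynomial of N as X^k Q with Q(0) <> 0 and
    Q = Q(0) + s X, the cocycle is cohomologous to its product with Q(N) / Q(0),
    which lies in a smaller subspace because N is not nilpotent. *)
Lemma casimir_reduction r w (U : mat) :
    (forall z, @jtan K d _ G r z -> (forall k, (k < r.+1)%N -> rb (mcomp z k) = 0) ->
       mcomp z 0 = 0) ->
    admissible w -> stable_row H U -> (forall A, G A -> (cocycle w A <= U)%MS) ->
  (forall A, G A -> cocycle w A = 0) \/
  exists t (U2 : mat), [/\ (\rank U2 < \rank U)%N, stable_row H U2 &
    forall A, G A -> (cocycle (w - t *m iV) A <= U2)%MS].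
Proof.
move=> star adm sU cU; have [U' [sU' fU capU]] := ss sU.
pose P : mat := proj_mx U U'.
have PU : (P <= U)%MS by rewrite -[P]mul1mx proj_mx_sub.
have idP n (B : 'M_(n, v.+1)) : (B <= U)%MS -> B *m P = B by apply: proj_mx_id.
have PP : P *m P = P by apply: idP.
have commP a : H a -> a *m P = P *m a.
  move=> Ha; have E1 : P *m a *m P = P *m a.
    by apply: idP; apply: submx_trans (sU _ Ha); apply: submxMr.
  have E2 : (1%:M - P) *m a *m P = 0.
    have sub : (1%:M - P <= U')%MS.
      by rewrite -[P in 1%:M - P]mul1mx proj_mx_compl_sub // submx_full.
    by apply: (proj_mx_0 capU); apply: submx_trans (sU' _ Ha); apply: submxMr.
  by rewrite -E1 -[LHS]subr0 -E2 !mulmxBl mul1mx opprB addrC subrK.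
have [k0 k0P] := image_lie_ex d G iV pV r.
have k0span := image_in_span k0P.
have k0H := image_conj d_der G_mul G_unit G_inv iVd pVd iVpV rep k0P.
have k0br := image_bracket d_der G1 G_mul iVd pVd rep k0P.
have k0rep := image_replica d_der G1 G_mul iVd pVd iVpV rep closedK k0P.
have k0g : (k0 <= g)%VS by apply/subvP => X /k0P[z Tz <-]; apply: jet_leading Tz _ _.
have k0comm X : X \in k0 -> X *m P = P *m X.
  by move=> kX; apply: (in_span_comm (G := H)) commP; apply: k0span.
have [|a X Y [kX PX] [kY PY]|rr rrP] := @vspace_of_pred_ex _ _ (fun X => X \in k0 /\ P *m X = 0).
- by rewrite mem0v mulmx0.
- by rewrite memvD ?memvZ // mulmxDr -scalemxAr PX PY scaler0 addr0.
have rrH : conj_stable H rr.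
  move=> a X Ha /rrP[kX PX]; apply/rrP; split; first exact: k0H.
  by rewrite !mulmxA -(commP _ (H_inv Ha)) -(mulmxA _ P) PX mulmx0 mul0mx.
have rrk0 : (rr <= k0)%VS by apply/subvP => X /rrP[].
have [m [mg mH grm rm0]] := complement (subv_trans rrk0 k0g) rrH.
pose hh := (k0 :&: m)%VS.
have hhP X : X \in hh -> X \in k0 /\ X \in m by rewrite memv_cap => /andP[].
have hhH : conj_stable H hh.
  by move=> a X Ha /hhP[kX mX]; rewrite memv_cap k0H // mH.
have decomp X : X \in k0 -> exists Y Z, [/\ Y \in rr, Z \in hh & X = Y + Z].
  move=> kX; have /memv_addP[Y rY [Z mZ E]] := subvP grm _ (subvP k0g _ kX).
  exists Y, Z; split=> //; rewrite memv_cap mZ andbT -[Z](addKr Y) -E.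
  by rewrite memvD // memvN (subvP rrk0).
have gU : gram hh P \in unitmx.
  apply: gram_unit => X hX HX; have [kX mX] := hhP _ hX.
  apply: rm0 => //; apply/rrP; split=> //.
  apply: (trace_form_nondegenerate closedK char0 H_unit H_inv ss PP commP k0span k0H k0br k0rep kX).
  move=> Y kY; have [Y1 [Y2 [/rrP[_ PY1] hY2 ->]]] := decomp _ kY.
  by rewrite mulmxDr linearD /= (HX _ hY2) -k0comm // -mulmxA PY1 mulmx0 linear0 addr0.
pose R (X : mat) u := exists2 z, @jtan K d _ G r z & X = rb (mcomp z 0) /\ u = dcocycle w z.
have [||||f [flin fR]] := @linear_of_relation K _ 'rV[K]_v.+1 R k0.
- exists 0; first exact: tangent0.
  by rewrite /dcocycle /mcomp !dec0 !linear0 ?mulmx0 mul0mx vb0.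
- move=> a _ _ _ _ [y Ty [-> ->]] [y' Ty' [-> ->]].
  exists (a *: y + y'); first exact: tangent_lin.
  by rewrite mcomp_lin vb_lin /dcocycle mcomp_lin mulmxDr mulmxDl -scalemxAr -scalemxAl.
- by move=> u [y Ty [Ey ->]]; apply: dcocycle_kernel star _ Ty _.
- by move=> X /k0P[z Tz <-]; exists (dcocycle w z), z.
have fE z : @jtan K d _ G r z -> f (rb (mcomp z 0)) = dcocycle w z.
  by move=> Tz; apply: fR; [apply/k0P; exists z|exists z].
have fconj A X : G A -> X \in k0 -> f (invmx (rb A) *m X *m rb A) =
    f X *m rb A + cocycle w (invmx A) *m X *m rb A.
  move=> GA /k0P[z Tz <-]; rewrite fE // -dcocycle_conj //.
  have [|_ <-] := vb_jconj GA Tz (ltn0Sn r); first by [].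
  by rewrite fE //; apply: jtan_conj.
have frr X : X \in rr -> f X = 0.
  apply: (@partial_hom rr) => //; first exact: (subv_trans rrk0).
  move=> _ Y [A GA <-] /rrP[kY PY]; rewrite fconj // -(idP _ (cocycle w _)); last first.
    by apply: cU; apply: G_inv.
  by rewrite -(mulmxA _ P) PY mulmx0 mul0mx addr0.
have [dim0|dim_gt0] := posnP (\dim hh).
  left; have hh0 X : X \in hh -> X = 0.
    by have /eqP := dim0; rewrite dimv_eq0 => /eqP ->; rewrite memv0 => /eqP.
  have wZ z : @jtan K d _ G r z -> w *m mcomp z 0 = 0.
    move=> Tz; rewrite dcocycle_tan // -fE //.
    have kz : rb (mcomp z 0) \in k0 by apply/k0P; exists z.
    have [Y [Z [rY hZ E]]] := decomp _ kz.
    by rewrite E (hh0 _ hZ) addr0 frr // mul0mx.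
  pose L i : 'M[K]_q := pV *m delta_mx i 0 *m w.
  have trL B i : \tr (B *m L i) = (w *m B *m pV) 0 i by rewrite trace_entry.
  have key := @constant_traces _ _ d_der _ _ G1 G_mul r _ L (fun i => (w *m pV) 0 i) char0 (@G_irr r).
  move=> A GA; apply/eqP; rewrite /cocycle mulmxBl subr_eq0; apply/eqP/rowP => i.
  rewrite -trL; apply: key => // [j|z Tz]; first by rewrite -[L j]mul1mx trL mulmx1.
  exists 0 => B j GB; rewrite trL mulmxA wZ // !mul0mx mxE big1 // => l _.
  by rewrite mxE mul0r.
right; pose x (i : 'I_(\dim hh)) : mat := (vbasis hh)`_i.
pose Bi := invmx (gram hh P).
have xk i : x i \in k0 by apply: (hhP _ (vbasis_in i)).1.
pose Om : mat := \sum_i \sum_j Bi i j *: (x i *m x j).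
pose v0 : 'rV[K]_v.+1 := \sum_i \sum_j Bi i j *: (f (x i) *m x j).
have sig_lin a e X Y : invmx a *m (e *: X + Y) *m a =
    e *: (invmx a *m X *m a) + invmx a *m Y *m a :> mat.
  by rewrite mulmxDr mulmxDl -scalemxAr -scalemxAl.
have sig_tr a X Y : H a -> \tr (P *m (invmx a *m X *m a) *m (invmx a *m Y *m a)) = \tr (P *m X *m Y).
  move=> Ha; have Ua := H_unit Ha.
  rewrite !mulmxA -[_ *m a *m invmx a]mulmxA mulmxV // mulmx1 -(commP _ (H_inv Ha)).
  by rewrite mxtrace_mulC !mulmxA mulmxV // mul1mx.
have OmH a : H a -> a *m Om = Om *m a.
  move=> Ha; have Ua := H_unit Ha.
  have bl e (X X' Y : mat) : (e *: X + X') *m Y = e *: (X *m Y) + X' *m Y.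
    by rewrite mulmxDl -scalemxAl.
  have br e (X Y Y' : mat) : X *m (e *: Y + Y') = e *: (X *m Y) + X *m Y'.
    by rewrite mulmxDr -scalemxAr.
  have := @gram_inv_invariant K _ hh P (fun X => invmx a *m X *m a) _ (fun X Y => X *m Y) gU
    (sig_lin a) (fun X => hhH a X Ha) (fun X Y _ _ => sig_tr a X Y Ha) bl br.
  rewrite -/Bi -/Om => E.
  have {}E : invmx a *m Om *m a = Om.
    rewrite -[RHS]E /Om mulmx_sumr mulmx_suml; apply: eq_bigr => i _.
    rewrite mulmx_sumr mulmx_suml; apply: eq_bigr => j _.
    rewrite -scalemxAr -scalemxAl; congr (_ *: _).
    by rewrite !mulmxA -[_ *m a *m invmx a]mulmxA mulmxV // mulmx1.
  by have := congr1 (mulmx a) E; rewrite !mulmxA mulmxV // mul1mx => ->.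
(* The tensor sum Bi i j x_i x_j is invariant under conjugation by a, under which
   f changes by X |-> c' X a. *)
have key A : G A -> cocycle w A *m Om = v0 *m rb A - v0.
  move=> GA; have Ha : H (rb A) by exists A.
  have Ua := H_unit Ha; set a := rb A in Ha Ua *; set c' := cocycle w (invmx A).
  have fc X : X \in k0 -> f (invmx a *m X *m a) = f X *m a + c' *m X *m a by apply: fconj.
  have ca : c' *m a = - cocycle w A by apply: cocycle_inv.
  clearbody a c'.
  have bl e (X X' Y : mat) : f (e *: X + X') *m Y = e *: (f X *m Y) + f X' *m Y.
    by rewrite flin mulmxDl -scalemxAl.
  have br e (X Y Y' : mat) : f X *m (e *: Y + Y') = e *: (f X *m Y) + f X *m Y'.
    by rewrite mulmxDr -scalemxAr.
  have := @gram_inv_invariant K _ hh P (fun X => invmx a *m X *m a) _ (fun X Y => f X *m Y) gU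
    (sig_lin a) (fun X => hhH a X Ha) (fun X Y _ _ => sig_tr a X Y Ha) bl br.
  rewrite -/Bi -/v0 => E.
  have {}E : v0 *m a + c' *m Om *m a = v0.
    rewrite -[RHS]E /v0 /Om -mulmxDl mulmx_sumr -big_split mulmx_suml.
    apply: eq_bigr => i _ /=; rewrite mulmx_sumr -big_split mulmx_suml.
    apply: eq_bigr => j _ /=; rewrite -scalemxAr -scalerDr -scalemxAl; congr (_ *: _).
    rewrite fc ?xk // -/(x i) -/(x j) (mulmxA c').
    rewrite -(mulmxDl (f (x i)) _ (x j)) -(mulmxDl (f (x i)) _ a) !mulmxA.
    by rewrite -[_ *m a *m invmx a]mulmxA mulmxV // mulmx1.
  by rewrite -[X in _ - X]E -mulmxA -OmH // mulmxA ca mulNmx opprD opprK addrA subrr add0r.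
pose N : mat := P *m Om.
have NH a : H a -> a *m N = N *m a.
  move=> Ha; transitivity (P *m a *m Om); first by rewrite mulmxA (commP a Ha).
  by rewrite -[LHS]mulmxA (OmH a Ha) [LHS]mulmxA.
have OmP : Om *m P = P *m Om.
  rewrite /Om mulmx_sumr mulmx_suml; apply: eq_bigr => i _.
  rewrite mulmx_sumr mulmx_suml; apply: eq_bigr => j _.
  by rewrite -scalemxAr -scalemxAl -[_ *m P]mulmxA (k0comm _ (xk j)) mulmxA (k0comm _ (xk i)) mulmxA.
have trN : \tr N = (\dim hh)%:R.
  rewrite -(mxtrace1 K (\dim hh)) -(mulVmx gU) -/Bi /N /Om mulmx_sumr linear_sum.
  apply: eq_bigr => i _; rewrite mulmx_sumr linear_sum mxE; apply: eq_bigr => j _ /=.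
  rewrite -scalemxAr linearZ /= mxE; congr (_ * _).
  by rewrite mulmxA -(k0comm _ (xk i)) -[_ *m P *m _]mulmxA mxtrace_mulC.
have cN A : G A -> cocycle w A *m N = v0 *m rb A - v0.
  by move=> GA; rewrite /N mulmxA idP ?key //; apply: cU.
have nzchi : char_poly N != 0 by rewrite monic_neq0 // char_poly_monic.
have [k [Q [Q0 EQ]]] : exists k Q, Q.[0] != 0 /\ char_poly N = Q * 'X^k.
  have [k [Q]] := multiplicity_XsubC (char_poly N) 0; rewrite nzchi /= => Q0 ->.
  by exists k, Q; rewrite subr0.
(* Multiplying the cocycle by s(N) N changes it by a coboundary, so that Q(N)
   acts on its class as the scalar Q(0). *)
have [s Es] : exists s : {poly K}, Q = (Q.[0])%:P + s * 'X.
  have /factor_theorem[s Es] : root (Q - (Q.[0])%:P) 0 by rewrite /root !hornerE subrr.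
  by exists s; rewrite subr0 in Es; rewrite -Es addrC subrK.
pose rN := horner_mx N Q; pose t : 'rV[K]_v.+1 := (Q.[0])^-1 *: (v0 *m horner_mx N s).
have sNH p a : H a -> a *m horner_mx N p = horner_mx N p *m a.
  by move=> Ha; apply: esym; apply: comm_horner_mx; apply: esym; apply: NH.
have rNE : rN = (Q.[0])%:M + N *m horner_mx N s.
  rewrite /rN {1}Es rmorphD rmorphM /= horner_mx_C horner_mx_X; congr (_ + _).
  by apply: (comm_horner_mx (A := N) (B := N)); apply: erefl.
have nN : ~ exists l, N ^+ l = 0.
  case=> l Nl; have := nilpotent_trace0 closedK Nl; rewrite trN => /eqP.
  by rewrite (proj1 (pcharf0P K) char0) eqn0Ngt dim_gt0.
(* If rN = Q(N) were injective on U, then Q(N) N^k = 0 would make N nilpotent. *)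
exists (- t), (U *m rN); split.
- rewrite ltnNge; apply/negP => le_rank; apply: nN; exists k.
  have kerU : (U :&: kermx rN)%MS = 0.
    apply/eqP; rewrite -mxrank_eq0 -leqn0 -(leq_add2l (\rank (U *m rN))) mxrank_mul_ker addn0.
    exact: le_rank.
  have UN (B : mat) : (B <= U)%MS -> (B *m N <= U)%MS.
    by move=> BU; rewrite /N mulmxA (idP _ _ BU) -(idP _ _ BU) -mulmxA -OmP mulmxA;
       apply: submx_trans PU; apply: submxMl.
  have UNk l : (P *m N ^+ l <= U)%MS.
    by elim: l => [|l IHl]; [rewrite expr0 mulmx1|rewrite exprSr -[_ * _]/(_ *m _) mulmxA; apply: UN].
  have PNk : P *m N ^+ k = 0.
    apply/eqP; rewrite -submx0 -kerU sub_capmx UNk; apply/sub_kermxP.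
    rewrite -mulmxA -[_ *m rN]/(_ * rN).
    have -> : N ^+ k * rN = horner_mx N (char_poly N).
      by rewrite EQ rmorphM rmorphXn /= horner_mx_X; apply: esym; apply: commrX; apply: comm_horner_mx.
    by rewrite Cayley_Hamilton mulmx0.
  have PN : P *m N = N by rewrite /N mulmxA PP.
  case: k PNk {EQ} => [|k] PNk; last by rewrite -PNk exprS -[_ * _]/(_ *m _) mulmxA PN.
  move: PNk; rewrite expr0 mulmx1 => P0; move: trN; rewrite /N P0 mul0mx linear0 => /esym/eqP.
  by rewrite (proj1 (pcharf0P K) char0) eqn0Ngt dim_gt0.
- move=> a Ha; rewrite -mulmxA -sNH // mulmxA; apply: submxMr; exact: sU.
move=> A GA; have -> : cocycle (w - (- t) *m iV) A = (Q.[0])^-1 *: (cocycle w A *m rN).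
  rewrite cocycle_shift // rNE mulmxDr mul_mx_scalar mulmxA cN // scalerDr scalerA mulVf // scale1r.
  congr (_ + _); rewrite mulNmx opprB opprK addrC /t -scalemxAl -scalerBr; congr (_ *: _).
  have HA : H (rb A) by exists A.
  by rewrite mulmxBl -[v0 *m rb A *m _]mulmxA (sNH s _ HA) [v0 *m (_ *m rb A)]mulmxA.
by apply: scalemx_sub; apply: submxMr; apply: cU.
Qed.

(** Induction on the rank of a stable subspace that contains the values of the
    cocycle. *)
Theorem cocycle_trivial w : admissible w ->
  exists u, forall A, G A -> cocycle w A = u *m rb A - u.
Proof.
move=> adm.
have [r star] := faithful_jets d_der G1 G_mul iVd pVd iVpV rep d_closed char0 G_closed faithful.
suff main n (U : mat) w1 : (\rank U <= n)%N -> admissible w1 -> stable_row H U ->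
    (forall A, G A -> (cocycle w1 A <= U)%MS) ->
    exists u, forall A, G A -> cocycle w1 A = u *m rb A - u.
  apply: (main _ (1%:M : mat) w (leqnn _)) => //; first by move=> A _; rewrite submx1.
  by move=> A _; rewrite submx1.
elim: n U w1 => [|n IHn] U w1 rU adm1 sU cU.
  have U0 : U = 0 by apply/eqP; rewrite -mxrank_eq0 -leqn0.
  exists 0 => A GA; rewrite mul0mx subrr; apply/eqP; rewrite -submx0 -U0.
  exact: cU.
have [c0|[t [U2 [ltU sU2 cU2]]]] := casimir_reduction star adm1 sU cU.
  by exists 0 => A GA; rewrite mul0mx subrr c0.
have [||u Hu] := IHn U2 (w1 - t *m iV) _ _ sU2 cU2.
- by rewrite -ltnS (leq_trans ltU).
- exact: admissible_shift.
exists (u + t) => A GA; have := Hu A GA; rewrite cocycle_shift // => /eqP.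
rewrite subr_eq => /eqP ->; rewrite mulmxDl opprD; apply: addrACA.
Qed.

End Core.

(** * Embedding a representation into a Kolchin closed matrix group *)

Section Denominators.

Variables (K : fieldType) (d : K -> K).
Hypothesis d_der : is_derivation d.
Variable n : nat.

Local Notation ev A := (teval d (idfun : {rmorphism K -> K}) (mxvec A 0)).
Local Notation evGL A := (teval d (idfun : {rmorphism K -> K}) (GL_coords A 0)).

Definition det_term : dterm K (n * n) :=
  TSum (index_enum {perm 'I_n}) (fun s => TMul (TConst ((-1) ^+ s))
    (TProd (index_enum 'I_n) (fun i => TVar (mxvec_index i (s i))))).

Lemma det_termE (A : 'M[K]_n) : ev A det_term = \det A.
Proof.
rewrite (teval_sum d (idfun : {rmorphism K -> K})); apply: eq_bigr => s _.
rewrite [LHS]/=; congr (_ * _).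
rewrite (teval_prod d (idfun : {rmorphism K -> K})); apply: eq_bigr => i _.
by rewrite /= mxvecE.
Qed.

Lemma GL_coordsl (A : 'M[K]_n) i : GL_coords A 0 (lshift 1 i) = mxvec A 0 i.
Proof. by rewrite row_mxEl. Qed.

Lemma GL_coordsr (A : 'M[K]_n) i : GL_coords A 0 (rshift (n * n) i) = (\det A)^-1.
Proof. by rewrite row_mxEr mxE. Qed.

(** For a derivative: det^(k+1) x' = det (det^k x)' - k det' (det^k x). *)
Lemma clear_denominators (t : dterm K (n * n + 1)) : exists k (t' : dterm K (n * n)),
  forall A, A \in unitmx -> ev A t' = \det A ^+ k * evGL A t.
Proof.
elim: t => [c|i|a [k [a' Ha]] b [l [b' Hb]]|a [k [a' Ha]] b [l [b' Hb]]|a [k [a' Ha]]].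
- by exists 0%N, (TConst c) => A _; rewrite mul1r.
- rewrite -(splitK i); case: (split i) => j /=.
    by exists 0%N, (TVar j) => A _; rewrite mul1r GL_coordsl.
  exists 1%N, (TConst 1) => A; rewrite unitmxE unitfE => uA.
  by rewrite /= GL_coordsr expr1 mulfV.
- exists (k + l)%N, (TAdd (TMul (TExp det_term l) a') (TMul (TExp det_term k) b')) => A uA.
  rewrite /= !(teval_exp d (idfun : {rmorphism K -> K})) det_termE Ha // Hb //.
  by rewrite exprD; ring.
- exists (k + l)%N, (TMul a' b') => A uA.
  by rewrite /= Ha // Hb // exprD; ring.
exists k.+1, (TSub (TMul det_term (TDer a')) (TMul (TConst k%:R) (TMul (TDer det_term) a'))) => A uA.
rewrite (teval_sub d (idfun : {rmorphism K -> K})) /= det_termE Ha // (derM d_der).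
have -> : d (\det A ^+ k) = k%:R * d (\det A) * \det A ^+ k.-1.
  elim: (k) => [|j IHj]; first by rewrite (der1 d_der) !mul0r.
  rewrite exprS (derM d_der) IHj; case: j {IHj} => [|j] /=; first by rewrite !mul0r mulr0 addr0 !mul1r.
  by rewrite exprS -[j.+2]addn1 natrD; ring.
case: k {Ha} => [|k] /=; first by rewrite !mul0r; ring.
by rewrite !exprS; ring.
Qed.

(** Inverting the determinant gives no new closed subsets of GL_n. *)
Lemma closed_of_term (t : dterm K (n * n + 1)) :
  kolchin_closed d (fun A : 'M[K]_n => A \in unitmx /\ evGL A t = 0).
Proof.
exists (fun r p => forall A, A \in unitmx -> evGL A t = 0 -> deval d p (mxvec A) = 0) => A.
split=> [[uA tA]|[uA HA]]; first by split=> // r p; apply.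
split=> //; have [k [t' Ht']] := clear_denominators t.
have [r0 /(_ r0 (leqnn _))[p Hp]] := mpoly_of_dterm d_der t'.
have pE B : deval d p (mxvec B) = ev B t'.
  by rewrite -deval_dev Hp //; split.
have /eqP : deval d p (mxvec A) = 0.
  by apply: HA => B uB tB; rewrite pE Ht' // tB mulr0.
have nzd : \det A != 0 by move: uA; rewrite unitmxE unitfE.
by rewrite pE Ht' // mulf_eq0 expf_eq0 (negPf nzd) andbF /= => /eqP.
Qed.

Lemma irreducible_terms (G : 'M[K]_n -> Prop) (t1 t2 : dterm K (n * n + 1)) :
    kolchin_irreducible d G -> (forall A, G A -> A \in unitmx) ->
    (forall A, G A -> evGL A t1 * evGL A t2 = 0) ->
  (forall A, G A -> evGL A t1 = 0) \/ (forall A, G A -> evGL A t2 = 0).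
Proof.
move=> [_ irr] uG H.
have [A GA|H1|H2] := irr _ _ (closed_of_term t1) (closed_of_term t2).
- have /eqP := H A GA; rewrite mulf_eq0 => /orP[]/eqP E; [left|right]; split=> //; exact: uG.
- by left=> A /H1[].
- by right=> A /H2[].
Qed.

End Denominators.

Section Embedding.

Variables (K : fieldType) (d : K -> K).
Hypothesis d_der : is_derivation d.
Variables (n m : nat) (G : 'M[K]_n -> Prop).
Variables (rho : 'M[K]_n -> 'M[K]_m) (c : 'M[K]_n -> 'rV[K]_m).
Local Notation q := ((m + 1) + (n + 1))%N.
Local Notation evGL A := (teval d (idfun : {rmorphism K -> K}) (GL_coords A 0)).
Local Notation evq M := (teval d (idfun : {rmorphism K -> K}) ((mxvec M : 'rV[K]_(q * q)) 0)).

(** The block rho A, c A carries the module and its extension by the cocycle.  The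
    blocks A^T and 1 / det A make the image closed: they determine A, and the other
    entries are differential polynomials in them.  Transposition reconciles the
    multiplication of matrices with their action on rows. *)
Definition emb (A : 'M[K]_n) : 'M[K]_q :=
  block_mx (block_mx (rho A) 0 (c A) 1%:M) 0 0 (block_mx A^T 0 0 (const_mx (\det A)^-1)).

Definition emb_group (M : 'M[K]_q) := exists2 A, G A & emb A = M.

Hypothesis rho1 : rho 1%:M = 1%:M.
Hypothesis rhoM : forall A B, G A -> G B -> rho (A *m B) = rho B *m rho A.
Hypothesis cM : forall A B, G A -> G B -> c (A *m B) = c B *m rho A + c A.
Hypothesis G_ldag : linear_diff_alg_group d G.
Hypothesis G_irr : kolchin_irreducible d G.
Hypothesis rho_terms : forall i j, exists t, forall A, G A -> rho A i j = evGL A t.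
Hypothesis c_terms : forall j, exists t, forall A, G A -> c A 0 j = evGL A t.

Lemma ldag_unit A : G A -> A \in unitmx.
Proof. by case: G_ldag => -[S HS] _ _ _ /HS[]. Qed.

Lemma c1 : c 1%:M = 0.
Proof.
have [_ G1 _ _] := G_ldag; have := cM G1 G1; rewrite mulmx1 rho1 mulmx1.
by move/eqP; rewrite -subr_eq0 opprD addrA subrr add0r oppr_eq0 => /eqP.
Qed.

Lemma embM A B : G A -> G B -> emb A *m emb B = emb (B *m A).
Proof.
move=> GA GB; rewrite /emb !mulmx_block !mulmx0 !mul0mx !addr0 !add0r rhoM // cM //.
rewrite !mul1mx trmx_mul det_mulmx invfM; congr (block_mx _ _ _ (block_mx _ _ _ _)).
by apply/matrixP => i j; rewrite !mxE big_ord1 !mxE mulrC.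
Qed.

Lemma emb1 : emb 1%:M = 1%:M.
Proof.
rewrite /emb rho1 c1 trmx1 det1 invr1 (scalar_mx_block (m + 1) (n + 1)).
rewrite (scalar_mx_block m 1) (scalar_mx_block n 1); congr (block_mx _ _ _ (block_mx _ _ _ _)).
by apply/matrixP => i j; rewrite !ord1 !mxE eqxx.
Qed.

Lemma emb_group1 : emb_group 1%:M.
Proof. by exists 1%:M; [case: G_ldag|apply: emb1]. Qed.

Lemma emb_groupM X Y : emb_group X -> emb_group Y -> emb_group (X *m Y).
Proof.
case=> [A GA <-] [B GB <-]; exists (B *m A); last by rewrite embM.
by case: G_ldag => _ _ GM _; apply: GM.
Qed.

Lemma emb_inv A : G A -> emb A \in unitmx /\ invmx (emb A) = emb (invmx A).
Proof.
move=> GA; have GA' : G (invmx A) by case: G_ldag => _ _ _; apply.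
have E : emb A *m emb (invmx A) = 1%:M by rewrite embM // mulVmx ?emb1 ?ldag_unit.
have [U _] := mulmx1_unit E; split=> //.
by rewrite -[LHS]mulmx1 -E mulKmx.
Qed.

Lemma emb_group_unit X : emb_group X -> X \in unitmx.
Proof. by case=> A /emb_inv[U _] <-. Qed.

Lemma emb_groupV X : emb_group X -> emb_group (invmx X).
Proof.
case=> A GA <-; have [_ ->] := emb_inv GA; exists (invmx A) => //.
by case: G_ldag => _ _ _; apply.
Qed.

Lemma emb_terms (i j : 'I_q) : exists t, forall A, G A -> emb A i j = evGL A t.
Proof.
have const (a : K) : exists t : dterm K (n * n + 1), forall A : 'M[K]_n, G A -> a = evGL A t.
  by exists (TConst a).
rewrite -(splitK i) -(splitK j); case: (split i) => {}i; case: (split j) => {}j /=.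
- rewrite -(splitK i) -(splitK j); case: (split i) => {}i; case: (split j) => {}j /=.
  + have [t Ht] := rho_terms i j; exists t => A GA.
    by rewrite block_mxEul block_mxEul Ht.
  + have [t Ht] := const 0; exists t => A GA.
    by rewrite block_mxEul block_mxEur mxE -Ht.
  + have [t Ht] := c_terms j; exists t => A GA.
    by rewrite block_mxEul block_mxEdl ord1 Ht.
  + have [t Ht] := const ((i == j)%:R); exists t => A GA.
    by rewrite block_mxEul block_mxEdr mxE -Ht.
- have [t Ht] := const 0; exists t => A GA.
  by rewrite block_mxEur mxE -Ht.
- have [t Ht] := const 0; exists t => A GA.
  by rewrite block_mxEdl mxE -Ht.
rewrite -(splitK i) -(splitK j); case: (split i) => {}i; case: (split j) => {}j /=.
- exists (TVar (lshift 1 (mxvec_index j i))) => A GA.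
  by rewrite block_mxEdr block_mxEul mxE /= GL_coordsl mxvecE.
- have [t Ht] := const 0; exists t => A GA.
  by rewrite block_mxEdr block_mxEur mxE -Ht.
- have [t Ht] := const 0; exists t => A GA.
  by rewrite block_mxEdr block_mxEdl mxE -Ht.
- exists (TVar (rshift (n * n) ord0)) => A GA.
  by rewrite block_mxEdr block_mxEdr mxE /= GL_coordsr.
Qed.

(** A left inverse of emb, in the coordinates of GL_n. *)
Definition emb_coords (M : 'M[K]_q) : 'rV[K]_(n * n + 1) :=
  row_mx (mxvec (ulsubmx (drsubmx M))^T) (drsubmx (drsubmx M)).

Lemma emb_coordsE A : emb_coords (emb A) = GL_coords A.
Proof.
rewrite /emb_coords /emb block_mxKdr block_mxKul block_mxKdr trmxK.
by congr row_mx; apply/matrixP => i j; rewrite !mxE.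
Qed.

Lemma emb_coords_terms k : exists t : dterm K (q * q),
  forall M, evq M t = emb_coords M 0 k.
Proof.
rewrite -(splitK k); case: (split k) => {}k /=.
  case/mxvec_indexP: k => i j.
  exists (TVar (mxvec_index (rshift (m + 1) (lshift 1 j)) (rshift (m + 1) (lshift 1 i)))) => M.
  by rewrite /= mxvecE row_mxEl mxvecE !mxE.
exists (TVar (mxvec_index (rshift (m + 1) (rshift n ord0)) (rshift (m + 1) (rshift n k)))) => M.
by rewrite /= mxvecE row_mxEr !mxE.
Qed.

Lemma emb_poly_terms r (p : {mpoly K[q * q * r]}) : exists t : dterm K (n * n + 1),
  forall A, G A -> deval d p (mxvec (emb A)) = evGL A t.
Proof.
have [tp Htp] := dterm_of_mpoly p.
have /functional_choice[T HT] : forall k : 'I_(q * q), exists t, forall A, G A ->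
    mxvec (emb A) 0 k = evGL A t.
  by move=> k; case/mxvec_indexP: k => i j; have [t Ht] := emb_terms i j; exists t => A GA; rewrite mxvecE Ht.
exists (tsubst T tp) => A GA; rewrite (teval_subst d) -deval_dev -Htp.
by apply: teval_ext => k; rewrite HT.
Qed.

Lemma emb_group_irr r (p p' : {mpoly K[q * q * r.+1]}) :
  vanish (@jset K d _ emb_group r) (p * p') ->
  vanish (@jset K d _ emb_group r) p \/ vanish (@jset K d _ emb_group r) p'.
Proof.
have [t Ht] := emb_poly_terms p; have [t' Ht'] := emb_poly_terms p' => Ipp.
have [A GA|H|H] := irreducible_terms (t1 := t) (t2 := t') d_der G_irr ldag_unit.
- rewrite -Ht // -Ht' // /deval -mevalM; apply: Ipp.
  by exists (emb A) => //; exists A.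
- left=> _ [_ [A GA <-] ->]; rewrite -[LHS]/(deval d p _) Ht //; exact: H.
- right=> _ [_ [A GA <-] ->]; rewrite -[LHS]/(deval d p' _) Ht' //; exact: H.
Qed.

(** The coordinates read off from M satisfy the equations of the group, so they are
    those of some A in it, and the remaining entries of M are the differential
    polynomials in them that define emb A. *)
Lemma emb_group_closed M :
    (forall r p, vanish (@jset K d _ emb_group r) p -> deval d p (mxvec M) = 0) ->
  emb_group M.
Proof.
move=> HM.
have HT (t : dterm K (q * q)) : (forall A, G A -> evq (emb A) t = 0) -> evq M t = 0.
  move=> Ht; have [r0 /(_ r0.+1 (leqnSn _))[p Hp]] := mpoly_of_dterm d_der t.
  have pE X : deval d p (mxvec X) = evq X t by rewrite -deval_dev Hp //; split.
  by rewrite -pE; apply: HM => _ [_ [A GA <-] ->]; rewrite -[LHS]/(deval d p _) pE Ht.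
have /functional_choice[T0 HT0] := emb_coords_terms.
pose A0 := (ulsubmx (drsubmx M))^T.
have coordl X k : emb_coords X 0 (lshift 1 k) = mxvec (ulsubmx (drsubmx X))^T 0 k.
  by rewrite row_mxEl.
have det0 : emb_coords M 0 (rshift (n * n) ord0) * \det A0 = 1.
  pose t := TSub (TMul (T0 (rshift (n * n) ord0)) (tsubst (fun k => T0 (lshift 1 k)) (det_term K n)))
     (TConst 1).
  have tE X : evq X t = emb_coords X 0 (rshift (n * n) ord0) * \det (ulsubmx (drsubmx X))^T - 1.
    rewrite (teval_sub d (idfun : {rmorphism K -> K})) /= HT0 (teval_subst d) -(det_termE d).
    by congr (_ * _ - _); apply: teval_ext => k; rewrite HT0 coordl.
  apply/eqP; rewrite -subr_eq0 -tE; apply/eqP; apply: HT => A GA.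
  rewrite tE emb_coordsE GL_coordsr /emb block_mxKdr block_mxKul trmxK mulVf ?subrr //.
  by have := ldag_unit GA; rewrite unitmxE unitfE.
have uA0 : A0 \in unitmx.
  rewrite unitmxE unitfE; apply/eqP => dA0.
  by move/eqP: det0; rewrite dA0 mulr0 eq_sym oner_eq0.
have coordsE : emb_coords M = GL_coords A0.
  apply/rowP => k; rewrite -(splitK k); case: (split k) => {}k /=.
    by rewrite coordl GL_coordsl.
  rewrite GL_coordsr [k]ord1 -[LHS]mulr1 -(mulfV (x := \det A0)) ?mulrA ?det0 ?mul1r //.
  by move: uA0; rewrite unitmxE unitfE.
have GA0 : G A0.
  case: G_ldag => -[S HS] _ _ _; apply/HS; split=> // r p Sp.
  have [tp Htp] := dterm_of_mpoly p.
  have tE X : evq X (tsubst (fun k => T0 (lshift 1 k)) tp) =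
      deval d p (mxvec (ulsubmx (drsubmx X))^T).
    rewrite (teval_subst d) -deval_dev -Htp; apply: teval_ext => k.
    by rewrite HT0 coordl.
  rewrite -tE; apply: HT => A GA; rewrite tE /emb block_mxKdr block_mxKul trmxK.
  by have [_] := (HS A).1 GA; apply.
exists A0 => //; apply/matrixP => i j; have [t Ht] := emb_terms i j.
rewrite (Ht _ GA0) -coordsE.
have tE X : evq X (TSub (TVar (mxvec_index i j)) (tsubst T0 t)) =
    X i j - teval d (idfun : {rmorphism K -> K}) (emb_coords X 0) t.
  rewrite (teval_sub d (idfun : {rmorphism K -> K})) /= mxvecE (teval_subst d).
  by congr (_ - _); apply: teval_ext => k; rewrite HT0.
apply/esym/eqP; rewrite -subr_eq0 -tE; apply/eqP; apply: HT => A GA.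
by rewrite tE emb_coordsE -Ht // subrr.
Qed.

End Embedding.

(** Terms instead of polynomials in jets of a given order, because the entries of
    rho and c may have different orders. *)
Definition term_function (K : fieldType) (d : K -> K) n (G : 'M[K]_n -> Prop)
    (f : 'M[K]_n -> K) :=
  exists t, forall A, G A -> f A = teval d (idfun : {rmorphism K -> K}) (GL_coords A 0) t.

Lemma term_function_poly (K : fieldType) (d : K -> K) n (G : 'M[K]_n -> Prop) f :
  delta_polynomial_on d G f -> term_function d G f.
Proof.
move=> [r [p Hp]]; have [t Ht] := dterm_of_mpoly p; exists t => A GA.
by rewrite Ht deval_dev Hp.
Qed.

Lemma term_function_affine (K : fieldType) (d : K -> K) n (G : 'M[K]_n -> Prop) I (r : seq I)
    (f : I -> 'M[K]_n -> K) (a : I -> K) b h :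
    (forall i, term_function d G (f i)) ->
    (forall A, G A -> h A = \sum_(i <- r) a i * f i A + b) ->
  term_function d G h.
Proof.
move=> /functional_choice[T HT] Eh.
exists (TAdd (TSum r (fun i => TMul (TConst (a i)) (T i))) (TConst b)) => A GA.
rewrite Eh //= (teval_sum d (idfun : {rmorphism K -> K})); congr (_ + _).
by apply: eq_bigr => i _; rewrite /= HT.
Qed.

(** The statement of cocycle_trivial for the group emb_group, with the submodule
    given by the first m coordinates and w the following basis vector. *)
Theorem matrix_cocycle (K : fieldType) (d : K -> K) (n m : nat) (G : 'M[K]_n -> Prop)
    (rho : 'M[K]_n -> 'M[K]_m) (c : 'M[K]_n -> 'rV[K]_m) :
    is_derivation d -> delta_closed d -> [pchar K] =i pred0 ->
    linear_diff_alg_group d G -> kolchin_irreducible d G ->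
    rho 1%:M = 1%:M -> (forall A B, G A -> G B -> rho (A *m B) = rho B *m rho A) ->
    (forall A B, G A -> G B -> c (A *m B) = c B *m rho A + c A) ->
    (forall i j, term_function d G (fun A => rho A i j)) ->
    (forall j, term_function d G (fun A => c A 0 j)) ->
    (forall A, G A -> rho A = 1%:M -> A = 1%:M) ->
    semisimple_rows (fun g => exists2 A, G A & rho A = g) ->
    (forall phi : 'M[K]_m -> 'rV[K]_m,
      (forall a X Y, phi (a *: X + Y) = a *: phi X + phi Y) ->
      (forall A X, G A -> @jtan K d m (fun g => exists2 A, G A & rho A = g) 0 (menc 1 (fun=> X)) ->
         phi (invmx (rho A) *m X *m rho A) = phi X *m rho A) ->
      forall X, @jtan K d m (fun g => exists2 A, G A & rho A = g) 0 (menc 1 (fun=> X)) -> phi X = 0) ->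
  exists u, forall A, G A -> c A = u *m rho A - u.
Proof.
move=> d_der d_closed char0 G_ldag G_irr rho1 rhoM cM rho_t c_t faith ss Hom0.
case: m rho c rho1 rhoM cM rho_t c_t faith ss Hom0 => [|m] rho c rho1 rhoM cM rho_t c_t faith ss Hom0.
  by exists 0 => A _; rewrite mul0mx subrr; apply/rowP => -[].
pose q := ((m.+1 + 1) + (n + 1))%N.
pose iV : 'M[K]_(m.+1, q) := row_mx (row_mx 1%:M 0) 0.
pose pV : 'M[K]_(q, m.+1) := col_mx (col_mx 1%:M 0) 0.
pose w : 'rV[K]_q := row_mx (row_mx 0 1%:M) 0.
have iVE A : iV *m emb rho c A = row_mx (row_mx (rho A) 0) 0.
  by rewrite /iV /emb !mul_row_block !mul1mx !mul0mx ?mulmx0 !addr0.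
have wE A : w *m emb rho c A = row_mx (row_mx (c A) 1%:M) 0.
  by rewrite /w /emb !mul_row_block !mul1mx !mul0mx ?mulmx0 !add0r ?addr0.
have iVpV : iV *m pV = 1%:M by rewrite /iV /pV !mul_row_col !mul1mx !mul0mx !addr0.
have vbE A : vb iV pV (emb rho c A) = rho A.
  by rewrite /vb iVE /pV !mul_row_col mulmx1 !mulmx0 !addr0.
have rep M : emb_group G rho c M -> iV *m M = vb iV pV M *m iV.
  by case=> [A GA <-]; rewrite vbE iVE /iV !mul_mx_row mulmx1 !mulmx0.
have iVd : map_mx d iV = 0 by rewrite !map_row_mx (der_scalar_mx d_der) !(der0_mx d_der) !row_mx0.
have pVd : map_mx d pV = 0 by rewrite !map_col_mx (der_scalar_mx d_der) !(der0_mx d_der) !col_mx0.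
have HE : image_group (emb_group G rho c) iV pV = (fun g => exists2 A, G A & rho A = g).
  apply: functional_extensionality => g; apply: boolp.propext; split.
    by case=> [_ [A GA <-] <-]; exists A; rewrite ?vbE.
  by case=> [A GA <-]; exists (emb rho c A); [exists A|rewrite vbE].
have [|a X Y TX TY|g gP] := @vspace_of_pred_ex _ _ (fun X : 'M[K]_m.+1 =>
  @jtan K d _ (image_group (emb_group G rho c) iV pV) 0 (menc 1 (fun=> X))).
- have -> : menc 1 (fun=> 0 : 'M[K]_m.+1) = 0; last exact: tangent0.
  by rewrite -[RHS]mcompK; apply: menc_ext => k _; rewrite /mcomp dec0 linear0.
- by rewrite menc_lin; apply: tangent_lin.
have gP' X : X \in g <-> exists2 z, @jtan K d _ (image_group (emb_group G rho c) iV pV) 0 z & mcomp z 0 = X.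
  rewrite gP; split=> [TX|[z Tz <-]]; first by eexists; [exact: TX|rewrite mencK].
  rewrite (_ : menc _ _ = z) // -[RHS]mcompK; apply: menc_ext => k.
  by rewrite ltnS leqn0 => /eqP->.
have dE A : w *m emb rho c A - w = row_mx (row_mx (c A) 0) 0.
  by rewrite wE /w !opp_row_mx !add_row_mx subrr !oppr0 !addr0.
have cE A : cocycle pV w (emb rho c A) = c A.
  by rewrite /cocycle dE /pV !mul_row_col mulmx1 !mulmx0 !addr0.
have adm : admissible (emb_group G rho c) iV pV w.
  by move=> _ [A GA <-]; rewrite cE dE /iV !mul_mx_row mulmx1 !mulmx0.
have [|||||u Hu] := cocycle_trivial d_der d_closed char0 (emb_group1 rho1 cM G_ldag)
  (emb_groupM rhoM cM G_ldag) (emb_group_unit rho1 rhoM cM G_ldag) (emb_groupV rho1 rhoM cM G_ldag) _ _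
  iVd pVd iVpV rep _ _ gP' _ adm.
- by move=> r p p'; apply: emb_group_irr.
- by move=> M; apply: emb_group_closed.
- move=> _ [A GA <-]; rewrite vbE => /(faith _ GA) ->; apply: (emb1 rho1 cM G_ldag).
- by rewrite HE.
- move=> phi philin phieq X /gP; rewrite HE => TX; apply: Hom0 TX => // A Y GA TY.
  by apply: phieq; [rewrite HE; exists A|apply/gP; rewrite HE].
exists u => A GA; rewrite -(cE A) -(vbE A); apply: Hu.
by exists A.
Qed.

(** * From vector spaces to matrices *)

Import VectorInternalTheory.

Section VectorMatrices.

Variable K : fieldType.
Implicit Types (U V W : vectType K).

Lemma v2r_lfun U V (X : 'Hom(U, V)) x : v2r (X x) = v2r x *m f2mx X.
Proof. by rewrite unlock /= r2vK. Qed.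

Lemma lfun_r2v U V (X : 'Hom(U, V)) u : X (r2v u) = r2v (u *m f2mx X).
Proof. by apply: (can_inj v2rK); rewrite v2r_lfun !r2vK. Qed.

Lemma mx_act_inj n m (A B : 'M[K]_(n, m)) : (forall u : 'rV_n, u *m A = u *m B) -> A = B.
Proof. by move=> H; apply/row_matrixP => i; rewrite !rowE H. Qed.

Lemma f2mx_comp U V W (X : 'Hom(V, W)) (Y : 'Hom(U, V)) :
  f2mx (X \o Y)%VF = f2mx Y *m f2mx X.
Proof.
apply: mx_act_inj => u; rewrite mulmxA.
by rewrite -[u]r2vK -!v2r_lfun comp_lfunE.
Qed.

Lemma f2mx1 V : f2mx (\1%VF : 'End(V)) = 1%:M.
Proof. by apply: mx_act_inj => u; rewrite -[u]r2vK -v2r_lfun id_lfunE mulmx1. Qed.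

Lemma f2mx_lin U V a (X Y : 'Hom(U, V)) : f2mx (a *: X + Y) = a *: f2mx X + f2mx Y.
Proof.
apply: mx_act_inj => u; rewrite mulmxDr -scalemxAr.
by rewrite -[u]r2vK -!v2r_lfun add_lfunE scale_lfunE linearP.
Qed.

Lemma f2mx_inj U V (X Y : 'Hom(U, V)) : f2mx X = f2mx Y -> X = Y.
Proof. by case: X; case: Y => X Y /= ->. Qed.

Lemma hom_of U V (F : U -> V) : (forall a x y, F (a *: x + y) = a *: F x + F y) ->
  exists X : 'Hom(U, V), forall x, X x = F x.
Proof.
move=> Flin; exists (Hom (linmx (fun u => v2r (F (r2v u))))) => x.
apply: (can_inj v2rK); rewrite v2r_lfun /= linmxE ?v2rK // => a u w.
by rewrite linearP Flin linearP.
Qed.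

Lemma f2mx_inv V (g : 'End(V)) : lker g = 0%VS ->
  f2mx g \in unitmx /\ f2mx (g^-1)%VF = invmx (f2mx g).
Proof.
move=> /eqP kg; have E : f2mx g *m f2mx (g^-1)%VF = 1%:M.
  by rewrite -f2mx_comp lker0_compVf ?f2mx1.
have [U _] := mulmx1_unit E; split=> //.
by rewrite -[RHS]mulmx1 -E mulKmx.
Qed.

Lemma lker_unit V (g : 'End(V)) : f2mx g \in unitmx -> lker g = 0%VS.
Proof.
move=> ug; apply/eqP/lker0P => x y /(congr1 v2r); rewrite !v2r_lfun.
by move/(can_inj (mulmxK ug))/(can_inj v2rK).
Qed.

Lemma trace_functional m (l : 'M[K]_m -> K) : (forall a X Y, l (a *: X + Y) = a * l X + l Y) ->
  exists L, forall X, l X = \tr (X *m L).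
Proof.
move=> llin; exists (\matrix_(b, a) l (delta_mx a b)) => X.
have l0 : l 0 = 0 by have := llin (-1) 0 0; rewrite scaler0 add0r mulN1r addNr.
have lD X1 X2 : l (X1 + X2) = l X1 + l X2 by rewrite -[X1]scale1r llin mul1r scale1r.
rewrite {1}[X]matrix_sum_delta (big_morph l lD l0); apply: eq_bigr => a _.
rewrite mxE (big_morph l lD l0); apply: eq_bigr => b _.
by rewrite -[_ *: _]addr0 llin l0 addr0 mxE.
Qed.

Lemma coord_functional U (l : U -> K) : (forall a x y, l (a *: x + y) = a * l x + l y) ->
  forall x, l x = \sum_(k < \dim {:U}) l (vbasis {:U})`_k * coord (vbasis {:U}) k x.
Proof.
move=> llin x.
have l0 : l 0 = 0 by have := llin (-1) 0 0; rewrite scaler0 add0r mulN1r addNr.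
have lD x1 x2 : l (x1 + x2) = l x1 + l x2 by rewrite -[x1]scale1r llin mul1r scale1r.
rewrite {1}(coord_vbasis (memvf x)) (big_morph l lD l0); apply: eq_bigr => k _.
by rewrite -[_ *: _]addr0 llin l0 addr0 mulrC.
Qed.

End VectorMatrices.

(** The polynomials vanishing on the group and on its Zariski closure are the same,
    so both have the same Lie algebra.  Equivariance under the group extends to the
    closure, because after multiplication by a determinant it is a polynomial
    condition. *)
Section ZariskiTransfer.

Variables (K : fieldType) (d : K -> K).
Hypothesis d_der : is_derivation d.
Variables (V : vectType K) (Im : 'End(V) -> Prop).
Local Notation m := (dim V).
Variable Gam : 'M[K]_m -> Prop.
Hypothesis Gam_Im : forall X : 'End(V), Im X <-> Gam (f2mx X).
Hypothesis Gam_mul : forall A B, Gam A -> Gam B -> Gam (A *m B).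
Hypothesis Gam_unit : forall A, Gam A -> A \in unitmx.
Hypothesis Gam_inv : forall A, Gam A -> Gam (invmx A).

Local Notation N := (\dim {:'End(V)}).
Local Notation bas k := ((vbasis {:'End(V)})`_k).
Local Notation tg X := (@jtan K d m Gam 0 (menc 1 (fun=> X))).
Local Notation cl := (zariski_closure Im).

Let crd (X : 'End(V)) : 'rV[K]_N := \row_k End_coords X k.

Let crd_sum (X : 'End(V)) : f2mx X = \sum_k crd X 0 k *: f2mx (bas k).
Proof.
have f0 : f2mx (0 : 'End(V)) = 0.
  by have := f2mx_lin (-1) (0 : 'End(V)) 0; rewrite scaler0 add0r scaleN1r addNr.
have fD (X1 X2 : 'End(V)) : f2mx (X1 + X2) = f2mx X1 + f2mx X2.
  by rewrite -[X1]scale1r f2mx_lin !scale1r.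
rewrite {1}(coord_vbasis (memvf X)) (big_morph _ fD f0); apply: eq_bigr => k _.
by rewrite -[_ *: bas k]addr0 f2mx_lin f0 addr0 mxE.
Qed.

Let meval_crd f X : f.@[crd X 0] = f.@[End_coords X].
Proof. by apply: meval_eq => k; rewrite mxE. Qed.

Let Im_cl g : Im g -> cl g.
Proof.
move=> Ig; split; last by move=> f; apply.
by apply: lker_unit; apply: Gam_unit; apply/Gam_Im.
Qed.

Lemma tangent_closure X : X \in LieAlg cl <-> tg (f2mx X).
Proof.
rewrite memLieAlg.
have ddE f : \sum_i (mderiv i f).@[End_coords \1%VF] * End_coords X i = dd f (crd \1%VF) (crd X).
  by apply: eq_bigr => i _; rewrite meval_crd mxE.
have jetE' (A : 'M[K]_m) : jet d 1 (mxvec A) = menc 1 (fun=> A).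
  rewrite jet_menc; apply: menc_ext => k; rewrite ltnS leqn0 => /eqP->.
  exact: jseq0.
split=> [TX p Ip|TX f If].
  pose B : 'M[K]_(N, m * m * 1) := linmx (fun u => menc 1 (fun=> \sum_k u 0 k *: f2mx (bas k))).
  have BE Y : crd Y *m B = menc 1 (fun=> f2mx Y).
    rewrite linmxE -?crd_sum // => a u w; rewrite -menc_lin; congr menc.
    apply: functional_extensionality => _; rewrite scaler_sumr -big_split.
    by apply: eq_bigr => k _; rewrite !mxE scalerDl scalerA.
  have := TX (linsub B p); rewrite ddE dd_linsub !BE f2mx1 /jid jetE'; apply=> g [_]; apply=> h Ih.
  rewrite -meval_crd linsubE BE -jetE'; apply: Ip; exists (f2mx h) => //.
  exact/Gam_Im.
pose C : 'M[K]_(m * m * 1, N) := linmx (fun x => crd (Hom (mcomp x 0))).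
have CE Y : menc 1 (fun=> f2mx Y) *m C = crd Y.
  rewrite linmxE => [|a u w]; first by rewrite mencK //; congr crd; apply: f2mx_inj.
  rewrite mcomp_lin (_ : Hom _ = a *: Hom (mcomp u 0) + Hom (mcomp w 0)).
    by apply/rowP => k; rewrite !mxE /End_coords linearP.
  by apply: f2mx_inj; rewrite f2mx_lin.
rewrite ddE -!CE -dd_linsub f2mx1 -jetE'; apply: TX => _ [A GA ->].
rewrite linsubE jetE' -[A]/(f2mx (Hom A)) CE meval_crd; apply: If; apply: Im_cl.
exact/Gam_Im.
Qed.

Lemma tangent_conj A X : Gam A -> tg X -> tg (invmx A *m X *m A).
Proof.
move=> GA TX; have := jtan_conj d_der Gam_mul Gam_unit Gam_inv GA TX.
rewrite (_ : menc 1 (fun=> invmx A *m X *m A) = jconj d A (menc 1 (fun=> X))) // -[RHS]mcompK.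
apply: menc_ext => k; rewrite ltnS leqn0 => /eqP->.
by rewrite jconj_comp // !jmul_at0 !jseq0 mencK.
Qed.

Let Xg : 'M[{mpoly K[N]}]_m := \matrix_(i, j) \sum_(k < N) (f2mx (bas k) i j)%:MP * 'X_k.

Let XgE X : map_mx (meval (End_coords X)) Xg = f2mx X.
Proof.
rewrite [RHS]crd_sum; apply/matrixP => i j; rewrite !mxE summxE.
rewrite (big_morph _ (mevalD _) (meval0 _)); apply: eq_bigr => k _.
by rewrite mevalM mevalC mevalXU !mxE mulrC.
Qed.

Let CE (X : 'End(V)) n p (Y : 'M[K]_(n, p)) :
  map_mx (meval (End_coords X)) (map_mx (@mpolyC N K) Y) = Y.
Proof. by apply/matrixP => i j; rewrite !mxE mevalC. Qed.

Let adjE (A : 'M[K]_m) : A \in unitmx -> \adj A = \det A *: invmx A.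
Proof.
move=> uA; rewrite /invmx uA scalerA mulfV ?scale1r //.
by move: uA; rewrite unitmxE unitfE.
Qed.

(** Multiplied by det g, both sides become polynomials in g. *)
Let closure_identity X L R :
    (forall A, Gam A -> \tr (invmx A *m X *m A *m L) = \tr (A *m R)) ->
  forall g, cl g -> \tr (invmx (f2mx g) *m X *m f2mx g *m L) = \tr (f2mx g *m R).
Proof.
move=> HG g [kg Hg]; have [ug _] := f2mx_inv kg.
pose Q := \tr (\adj Xg *m map_mx (@mpolyC N K) X *m Xg *m map_mx (@mpolyC N K) L)
   - \det Xg * \tr (Xg *m map_mx (@mpolyC N K) R).
have QE h : f2mx h \in unitmx -> Q.@[End_coords h] = \det (f2mx h) *
    (\tr (invmx (f2mx h) *m X *m f2mx h *m L) - \tr (f2mx h *m R)).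
  move=> uh; rewrite /Q mevalB mevalM -!trace_map_mx !map_mxM map_mx_adj !CE !XgE.
  by rewrite -det_map_mx XgE adjE // -!scalemxAl mxtraceZ mulrBr.
have := Hg Q; rewrite QE // => H; apply/eqP; rewrite -subr_eq0.
have /eqP : \det (f2mx g) * (\tr (invmx (f2mx g) *m X *m f2mx g *m L) - \tr (f2mx g *m R)) = 0.
  apply: H => h /Gam_Im Ih; rewrite QE; last exact: Gam_unit.
  by rewrite HG // subrr mulr0.
by rewrite mulf_eq0 => /orP[] // /eqP d0; move: ug; rewrite unitmxE unitfE d0 eqxx.
Qed.

Lemma hom_transfer (phi : 'M[K]_m -> 'rV[K]_m) : Hom_Lie_zero cl ->
    (forall a X Y, phi (a *: X + Y) = a *: phi X + phi Y) ->
    (forall A X, Gam A -> tg X -> phi (invmx A *m X *m A) = phi X *m A) ->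
  forall X, tg X -> phi X = 0.
Proof.
move=> Hom0 philin phieq X TX.
have [|a X1 X2 T1 T2|h hP] := @vspace_of_pred_ex _ _ (fun X : 'M[K]_m => tg X).
- have -> : menc 1 (fun=> 0 : 'M[K]_m) = 0; last exact: tangent0.
  by rewrite -[RHS]mcompK; apply: menc_ext => k _; rewrite /mcomp dec0 linear0.
- by rewrite menc_lin; apply: tangent_lin.
have clconj g Y : cl g -> tg Y -> tg (invmx (f2mx g) *m Y *m f2mx g).
  move=> cg TY; apply/hP; apply: memv_trace => L HL.
  rewrite (closure_identity (R := 0)) ?mulmx0 ?linear0 // => A GA.
  by rewrite mulmx0 linear0 HL //; apply/hP; apply: tangent_conj.
have cleq g Y : cl g -> tg Y -> phi (invmx (f2mx g) *m Y *m f2mx g) = phi Y *m f2mx g.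
  move=> cg TY; apply/rowP => j.
  have [|L EL] := @trace_functional K m (fun Z => phi Z 0 j).
    by move=> a X1 X2; rewrite philin !mxE.
  have E A : (phi Y *m A) 0 j = \tr (A *m (delta_mx j 0 *m phi Y)).
    by rewrite -[phi Y *m A]mulmx1 trace_entry mul1mx.
  rewrite EL (closure_identity (R := delta_mx j 0 *m phi Y)) // => A GA.
  by rewrite -EL phieq.
have [|Phi PhiE] := @hom_of K (subvs_of (LieAlg cl)) V (fun Y => r2v (phi (f2mx (vsval Y)))).
  by move=> a Y Z; rewrite linearP /= f2mx_lin philin linearP.
have Phi0 : Phi = 0.
  apply: Hom0 => g cg Y; rewrite AdE !PhiE /Ad_fun.
  have [kg _] := cg; have [ug gV] := f2mx_inv kg.
  have TY : tg (f2mx (vsval Y)) by apply/tangent_closure; apply: subvsP.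
  have gYE : f2mx (g \o vsval Y \o g^-1)%VF = invmx (f2mx g) *m f2mx (vsval Y) *m f2mx g.
    by rewrite !f2mx_comp gV mulmxA.
  rewrite vsprojK; last by apply/tangent_closure; rewrite gYE; apply: clconj.
  by rewrite gYE cleq // /tautological_rep lfun_r2v.
have LX : Hom X \in LieAlg cl by apply/tangent_closure.
have := PhiE (vsproj _ (Hom X)); rewrite Phi0 zero_lfunE vsprojK //=.
by move/(congr1 v2r); rewrite r2vK linear0.
Qed.

End ZariskiTransfer.

Theorem theorem4p6 (K : fieldType) (d : K -> K)
    (char0 : [pchar K] =i pred0)
    (d_der : is_derivation d)
    (d_closed : delta_closed d)
    (n : nat) (G : 'M[K]_n -> Prop)
    (G_ldag : linear_diff_alg_group d G)
    (G_connected : kolchin_irreducible d G)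
    (V W : vectType K)
    (rhoV : 'M[K]_n -> 'End(V)) (rhoW : 'M[K]_n -> 'End(W))
    (V_module : is_module d G rhoV)
    (W_module : is_module d G rhoW)
    (V_faithful : faithful_on G rhoV)
    (V_semisimple : semisimple_rep G rhoV)
    (f : 'Hom(V, W)) (p : 'Hom(W, K^o))
    (exact_VW1 : short_exact G rhoV rhoW (@trivial_rep K n) f p)
    (Hom_0 : Hom_Lie_zero (zariski_closure (image_in_End G rhoV))) :
  splits G rhoW (@trivial_rep K n) p.
Proof.
have [_ G1 G_mul G_inv] := G_ldag.
have [rhoV1 rhoVM rhoVp] := V_module; have [rhoW1 rhoWM rhoWp] := W_module.
have [feq peq kerf imf imp] := exact_VW1.
have [w0 pw0] : exists w0, p w0 = 1.
  have : (1 : K^o) \in limg p by rewrite imp memvf.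
  by case/memv_imgP => w0 _ ->; exists w0.
pose cv A : V := (f^-1)%VF (rhoW A w0 - w0).
have fcv A : G A -> f (cv A) = rhoW A w0 - w0.
  move=> GA; apply: limg_lfunVK; rewrite imf memv_ker linearB /= peq //.
  by rewrite /trivial_rep id_lfunE subrr.
have finj : injective f by apply/lker0P; rewrite kerf.
pose rho A := f2mx (rhoV A); pose c A := v2r (cv A).
have rho1 : rho 1%:M = 1%:M by rewrite /rho rhoV1 f2mx1.
have rhoM A B : G A -> G B -> rho (A *m B) = rho B *m rho A.
  by move=> GA GB; rewrite /rho rhoVM // f2mx_comp.
have cM A B : G A -> G B -> c (A *m B) = c B *m rho A + c A.
  move=> GA GB; rewrite -v2r_lfun -linearD; congr v2r; apply: finj.
  rewrite linearD /= feq // !fcv //; last exact: G_mul.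
  by rewrite rhoWM // comp_lfunE linearB /= addrA subrK.
have rho_t i j : term_function d G (fun A => rho A i j).
  pose l (X : 'End(V)) : K := f2mx X i j.
  have llin a X Y : l (a *: X + Y) = a * l X + l Y by rewrite /l f2mx_lin !mxE.
  apply: (term_function_affine (r := index_enum _) (b := 0)
    (f := fun k A => coord (vbasis {:'End(V)}) k (rhoV A)) (a := fun k : 'I_(\dim {:'End(V)}) => l (vbasis {:'End(V)})`_k)).
    by move=> k; apply: term_function_poly; apply: rhoVp.
  by move=> A _; rewrite addr0 -(coord_functional llin).
have c_t j : term_function d G (fun A => c A 0 j).
  pose l (X : 'End(W)) : K := v2r ((f^-1)%VF (X w0)) 0 j.
  have llin a X Y : l (a *: X + Y) = a * l X + l Y.
    by rewrite /l add_lfunE scale_lfunE !linearP !mxE.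
  apply: (term_function_affine (r := index_enum _) (b := - v2r ((f^-1)%VF w0) 0 j)
    (f := fun k A => coord (vbasis {:'End(W)}) k (rhoW A)) (a := fun k : 'I_(\dim {:'End(W)}) => l (vbasis {:'End(W)})`_k)).
    by move=> k; apply: term_function_poly; apply: rhoWp.
  move=> A _; rewrite -(coord_functional llin) /c /cv /l !linearB.
  by rewrite !mxE.
have faith A : G A -> rho A = 1%:M -> A = 1%:M.
  by move=> GA; rewrite -rho1 => /f2mx_inj; apply: V_faithful.
pose Gam (g : 'M[K]_(dim V)) := exists2 A, G A & rho A = g.
have Gam_Im X : image_in_End G rhoV X <-> Gam (f2mx X).
  by split=> [[A GA <-]|[A GA /f2mx_inj <-]]; exists A.
have rhoV_inv A : G A -> rho A *m rho (invmx A) = 1%:M.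
  move=> GA; have uA : A \in unitmx by apply: (ldag_unit G_ldag).
  by rewrite -(rhoM _ _ (G_inv _ GA) GA) mulVmx // rho1.
have Gam_mul A B : Gam A -> Gam B -> Gam (A *m B).
  by case=> [A' GA <-] [B' GB <-]; exists (B' *m A'); [apply: G_mul|apply: rhoM].
have Gam_unit A : Gam A -> A \in unitmx.
  by case=> [A' /rhoV_inv/mulmx1_unit[U _] <-].
have Gam_inv A : Gam A -> Gam (invmx A).
  case=> A' GA <-; exists (invmx A'); first exact: G_inv.
  have E := rhoV_inv _ GA; have [U _] := mulmx1_unit E.
  by rewrite -[RHS]mulmx1 -E mulKmx.
have ss : semisimple_rows Gam.
  move=> U sU.
  have [|a x y Ux Uy|L LP] := @vspace_of_pred_ex _ _ (fun x : V => (v2r x <= U)%MS).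
  - by rewrite linear0 sub0mx.
  - by rewrite linearP addmx_sub // scalemx_sub.
  have [|L' [sL' LL' capL]] := V_semisimple L.
    move=> A GA; apply/subvP => _ /memv_imgP[x /LP Ux ->]; apply/LP.
    rewrite v2r_lfun; apply: submx_trans (sU (rho A) _); last by exists A.
    exact: submxMr.
  have [|a u u' Lu Lu'|U' UP'] := @submx_of_pred _ _ (fun u : 'rV[K]_(dim V) => r2v u \in L').
  - by rewrite linear0 mem0v.
  - by rewrite linearP memvD ?memvZ.
  exists U'; split.
  - move=> _ [A GA <-]; apply/row_subP => i; rewrite row_mul; apply/UP'.
    rewrite -lfun_r2v; apply: (subvP (sL' A GA)); apply: memv_img.
    by apply/UP'; apply: row_sub.
  - rewrite -sub1mx; apply/row_subP => i; set u := row i _.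
    have /memv_addP[x Lx [y Ly E]] : r2v u \in (L + L')%VS by rewrite LL' memvf.
    rewrite -[u]r2vK E linearD /=; apply: addmx_sub.
      by apply: submx_trans (addsmxSl _ _); apply/LP.
    by apply: submx_trans (addsmxSr _ _); apply/UP'; rewrite v2rK.
  apply/eqP; rewrite -submx0; apply/row_subP => i; set u := row i _.
  have : (u <= U :&: U')%MS by apply: row_sub.
  rewrite sub_capmx => /andP[uU /UP' uU'].
  have : r2v u \in (L :&: L')%VS by rewrite memv_cap uU' andbT; apply/LP; rewrite r2vK.
  by rewrite capL memv0 => /eqP/(congr1 v2r); rewrite r2vK linear0 => ->; apply: sub0mx.
have [phi philin phieq X TX|u Hu] := matrix_cocycle d_der d_closed char0 G_ldag G_connected rho1 rhoM cM rho_t c_t faith ss.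
  apply: (hom_transfer d_der Gam_Im Gam_mul Gam_unit Gam_inv Hom_0 philin) TX => _ Y [A GA <-] TY.
  exact: phieq.
pose w1 := w0 - f (r2v u).
have w1fix A : G A -> rhoW A w1 = w1.
  move=> GA; rewrite /w1 linearB /= -feq // -[rhoW A w0](subrK w0) -fcv //.
  have -> : cv A = rhoV A (r2v u) - r2v u.
    apply: (can_inj v2rK); have := Hu A GA; rewrite /c => ->.
    by rewrite [RHS]linearB /= v2r_lfun r2vK.
  by rewrite linearB /= addrAC [_ - _ - _]addrAC subrr add0r addrC.
have pw1 : p w1 = 1.
  rewrite /w1 linearB /= pw0 (_ : p (f _) = 0) ?subr0 //.
  by apply/eqP; rewrite -memv_ker -imf memv_img // memvf.
have [|s Hs] := @hom_of K K^o W (fun a => (a : K) *: w1).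
  by move=> a x y; rewrite scalerDl scalerA.
exists s; split=> [A GA x|].
  by rewrite /trivial_rep id_lfunE Hs linearZ /= w1fix.
apply/lfunP => x; rewrite comp_lfunE Hs linearZ /= pw1 id_lfunE.
exact: mulr1.
Qed.
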